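(* Let $T>0$, let $\mathcal X, Z, H, V$ be separable real Hilbert spaces such that $V\hookrightarrow H\hookrightarrow V^*$ is a Gelfand triple, and set $\mathcal U=H^1(0,T;V)$ with inner product $(u,v)_{\mathcal U}=\int_0^T(\dot u(t),\dot v(t))_V\,dt+(u(0),v(0))_V$, $\mathcal W=L^2(0,T;V^* )$, $\mathcal Y=L^2(0,T;Z)$. Let $f:(0,T)\times V\times\mathcal X\to V^*$ and $g:(0,T)\times V\times\mathcal X\to Z$ be Carath\'eodory mappings and $u_0:\mathcal X\to V$. Assume that for almost all $t\in(0,T)$ the maps $f(t,\cdot,\cdot)$ and $g(t,\cdot,\cdot)$ are G\^ateaux differentiable on $V\times\mathcal X$ with linear and continuous derivatives, that $u_0$ is G\^ateaux differentiable with linear and continuous derivative, and that $f$ is locally Lipschitz continuous in the sense that for every $M\ge0$ there is $L(M)\ge0$ such that for almost every $t\in(0,T)$ $$\|f(t,v_1,\theta_1)-f(t,v_2,\theta_2)\|_{V^*}\le L(M)\big(\|v_1-v_2\|_V+\|\theta_1-\theta_2\|_{\mathcal X}\big)$$ whenever $\|v_i\|_V,\|\theta_i\|_{\mathcal X}\le M$, $i=1,2$, with $f(\cdot,0,0)\in\mathcal W$; assume the same for $g$ with $V^*,\mathcal W$ replaced by $Z,\mathcal Y$. Let $$\mathbb F:\mathcal U\times\mathcal X\to\mathcal W\times V\times\mathcal Y,\qquad \mathbb F(u,\theta)=\big(\dot u-f(\cdot,u,\theta),\;u(0)-u_0(\theta),\;g(\cdot,u,\theta)\big),$$ with G\^ateaux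 derivative $$\mathbb F'(u,\theta)=\begin{pmatrix}\frac{d}{dt}-f'_u(\cdot,u,\theta) & -f'_\theta(\cdot,u,\theta)\\ \delta_0 & -u_0'(\theta)\\ g'_u(\cdot,u,\theta) & g'_\theta(\cdot,u,\theta)\end{pmatrix}.$$ Then for every $(u,\theta)\in\mathcal U\times\mathcal X$ the Hilbert space adjoint $\mathbb F'(u,\theta)^\star:\mathcal W\times V\times\mathcal Y\to\mathcal U\times\mathcal X$ is $$\mathbb F'(u,\theta)^\star=\begin{pmatrix}\big(\frac{d}{dt}-f'_u(\cdot,u,\theta)\big)^\star & \delta_0^\star & g'_u(\cdot,u,\theta)^\star\\ -f'_\theta(\cdot,u,\theta)^\star & -u_0'(\theta)^\star & g'_\theta(\cdot,u,\theta)^\star\end{pmatrix},$$ where for $w\in\mathcal W$, $h\in V$, $z\in\mathcal Y$: \begin{align*} g'_u(\cdot,u,\theta)^\star z&=u^z, & g'_\theta(\cdot,u,\theta)^\star z&=\int_0^T g'_\theta(t,u(t),\theta)^*z(t)\,dt,\\ \delta_0^\star h&=u^h, & u_0'(\theta)^\star&=u_0'(\theta)^*\tilde I^{-1},\\ \Big(\Big(\tfrac{d}{dt}-f'_u(\cdot,u,\theta)\Big)^\star w\Big)(t)&=u^w(t)+\int_0^t\tilde I^*Iw(s)\,ds, & f'_\theta(\cdot,u,\theta)^\star w&=\int_0^T f'_\theta(t,u(t),\theta)^*Iw(t)\,dt, \end{align*} and $u^z,u^w,u^h$ solve $$\begin{cases}\ddot u^z(t)=-\tilde I g'_u(t,u(t),\theta)^*z(t),\quad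 t\in(0,T)\\ \dot u^z(T)=0,\quad \dot u^z(0)-u^z(0)=0,\end{cases}$$ $$\begin{cases}\ddot u^w(t)=\tilde I f'_u(t,u(t),\theta)^*Iw(t),\quad t\in(0,T)\\ \dot u^w(T)=0,\quad \dot u^w(0)-u^w(0)=0,\end{cases}$$ $$\begin{cases}\ddot u^h(t)=0,\quad t\in(0,T)\\ \dot u^h(T)=0,\quad \dot u^h(0)-u^h(0)=-h.\end{cases}$$
   Context: A Carath\'eodory mapping is measurable in $t$ for each fixed $(v,\theta)$ and continuous in $(v,\theta)$ for almost every $t$. For $u\in\mathcal U$, $f(\cdot,u,\theta)$ denotes the Nemytskii operator $t\mapsto f(t,u(t),\theta)$, and similarly for $g$; $f'_u,f'_\theta,g'_u,g'_\theta$ are the partial derivatives in the second and third arguments, acting pointwise in time: $(f'_u(\cdot,u,\theta)v)(t)=f'_u(t,u(t),\theta)v(t)$, $(f'_\theta(\cdot,u,\theta)\xi)(t)=f'_\theta(t,u(t),\theta)\xi$, etc. $\dot u$ is regarded as an element of $\mathcal W$ via $V\hookrightarrow V^*$; $\delta_0v=v(0)$. Product spaces carry the canonical sum inner products. The superscript $^\star$ denotes the Hilbert space adjoint of operators between the Hilbert spaces $\mathcal U,\mathcal X,\mathcal W,V,\mathcal Y$ (e.g. $g'_u(\cdot,u,\theta):\mathcal U\to\mathcal Y$, $g'_\theta(\cdot,u,\theta):\mathcal X\to\mathcal Y$, $u_0'(\theta):\mathcal X\to V$). The superscript $^*$ denotes the Banach space adjoint of the pointwise operators, with $V^{**}=V$,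 $Z^*=Z$, $\mathcal X^*=\mathcal X$ identified: $f'_u(t,u(t),\theta)^*:V\to V^*$, $f'_\theta(t,u(t),\theta)^*:V\to\mathcal X$, $g'_u(t,u(t),\theta)^*:Z\to V^*$, $g'_\theta(t,u(t),\theta)^*:Z\to\mathcal X$, $u_0'(\theta)^*:V^*\to\mathcal X$. $I:V^*\to V$ and $\tilde I:V^*\to V$ are the isomorphisms defined by $\langle u^*,Iv^*\rangle_{V^*,V}=(u^*,v^* )_{V^*}$ for all $u^*,v^*\in V^*$ and $(\tilde Iu^*,v)_V=\langle u^*,v\rangle_{V^*,V}$ for all $u^*\in V^*$, $v\in V$. In the expression $\tilde I^*I w(s)$, $\tilde I^*:V\to V$ is the adjoint with respect to $(\cdot,\cdot)_V$ of $\tilde I$ restricted to $V\subset V^*$ (embedding through $H$), i.e. $(\tilde I^*p,v)_V=(p,\tilde Iv)_V$ for $p,v\in V$. The second-order differential equations in time are $V$-valued and hold for almost every $t$. *)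

(* Defs.v *)
From HB Require Import structures.
From mathcomp Require Import all_boot all_order all_algebra.
From mathcomp Require Import all_classical all_reals all_analysis.

Set Implicit Arguments.
Unset Strict Implicit.
Unset Printing Implicit Defensive.

Import Order.TTheory GRing.Theory Num.Theory.
Import numFieldNormedType.Exports.

Local Open Scope classical_set_scope.
Local Open Scope ring_scope.

HB.mixin Record CompleteNormedModule_isHilbert (R : realType) V
    & CompleteNormedModule R V := {
  ip : V -> V -> R ;
  ip_sym : forall x y : V, ip x y = ip y x ;
  ip_linearl : forall (a : R) (x y z : V),
    ip (a *: x + y) z = a * ip x z + ip y z ;
  ip_norm : forall x : V, ip x x = `|x| ^+ 2 }.

#[short(type="hilbertType")]
HB.structure Definition Hilbert (R : realType) :=
  {V of CompleteNormedModule_isHilbert R V & CompleteNormedModule R V}.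

Definition separable (E : topologicalType) : Prop :=
  exists2 D : set E, countable D & dense D.

Section Bochner.
Context {R : realType}.
Notation mu := (@lebesgue_measure R).

(* The list of pairs (A_i, x_i) stands for the simple function
   sum_i 1_(A_i) x_i. *)
Definition simple (E : normedModType R) := seq (set R * E).

Definition is_simple (E : normedModType R) (s : simple E) : Prop :=
  forall i, (i < size s)%N ->
    measurable ((nth (set0, 0) s i).1 : set (measurableTypeR R)).

Definition simple_fun (E : normedModType R) (s : simple E) (t : R) : E :=
  \sum_(p <- s) (\1_(p.1) t : R) *: p.2.

Definition simple_int (E : normedModType R) (D : set R) (s : simple E) : E :=
  \sum_(p <- s) fine (mu (p.1 `&` D)) *: p.2.

(* Being an almost everywhere limit, this notion is insensitive to the choice
   between the Borel and the Lebesgue sigma-algebra. *)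
Definition strongly_measurable (E : normedModType R) (D : set R)
    (F : R -> E) : Prop :=
  exists2 s : nat -> simple E, (forall n, is_simple (s n)) &
    {ae mu, forall t, D t -> (fun n => simple_fun (s n) t) @ \oo --> F t}.

Definition is_bochner (E : normedModType R) (D : set R) (F : R -> E) (y : E)
    : Prop :=
  strongly_measurable D F /\
  exists s : nat -> simple E, [/\ forall n, is_simple (s n),
    (fun n => \int[mu]_(t in D) (`|F t - simple_fun (s n) t|)%:E)%E
      @ \oo --> 0%E &
    (fun n => simple_int D (s n)) @ \oo --> y].

Definition bochner (E : normedModType R) (D : set R) (F : R -> E) : E :=
  xget 0 [set y | is_bochner D F y].

Definition L2 (E : normedModType R) (T : R) (F : R -> E) : Prop :=
  strongly_measurable `]0, T[ F /\
  (\int[mu]_(t in `]0%R, T[) (`|F t| ^+ 2)%:E < +oo)%E.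

Definition ip_L2 (E : hilbertType R) (T : R) (F G : R -> E) : R :=
  \int[mu]_(t in `]0, T[) ip (F t) (G t).

(* [u] is the absolutely continuous representative on [0, T] of an element of
   H^1(0,T;E), and [p] represents its derivative. *)
Definition is_ddt (E : normedModType R) (T : R) (u p : R -> E) : Prop :=
  L2 T p /\ forall t, 0 <= t <= T -> u t = u 0 + bochner `]0, t[ p.

Definition H1 (E : normedModType R) (T : R) (u : R -> E) : Prop :=
  exists p, is_ddt T u p.

(* Determined up to a null set. *)
Definition ddt (E : normedModType R) (T : R) (u : R -> E) : R -> E :=
  xget (fun=> 0) [set p | is_ddt T u p].

Definition ip_H1 (E : hilbertType R) (T : R) (u v : R -> E) : R :=
  ip_L2 T (ddt T u) (ddt T v) + ip (u 0) (v 0).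

End Bochner.

Section Operators.
Context {R : realType}.

(* Elements of L^2 and H^1 are handled through representatives, so a Hilbert
   space is presented by a vector space of representatives, the subset of
   those that do represent an element, and the inner product;
   two representatives at distance 0 represent the same element ([heq]). *)
Record hspace := HSpace {
  hcar :> lmodType R ;
  hmem : set hcar ;
  hip : hcar -> hcar -> R }.

Definition hnorm (E : hspace) (x : E) : R := Num.sqrt (hip x x).

Definition heq (E : hspace) (x y : E) : Prop := hnorm (x - y) = 0.

Definition hs_full (E : hilbertType R) : hspace :=
  @HSpace E setT (fun x y => ip x y).

Definition hs_L2 (T : R) (E : hilbertType R) : hspace :=
  @HSpace (R -> E) (L2 T) (ip_L2 T).

Definition hs_H1 (T : R) (E : hilbertType R) : hspace :=
  @HSpace (R -> E) (H1 T) (ip_H1 T).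

Definition hs_prod (E F : hspace) : hspace :=
  @HSpace (E * F)%type [set x | hmem x.1 /\ hmem x.2]
    (fun x y => hip x.1 y.1 + hip x.2 y.2).

Definition maps_into (E F : hspace) (A : E -> F) : Prop :=
  forall x, hmem x -> hmem (A x).

Definition bounded_linear_op (E F : hspace) (A : E -> F) : Prop :=
  [/\ maps_into A,
      forall (a : R) (x y : E), hmem x -> hmem y ->
        heq (A (a *: x + y)) (a *: A x + A y) &
      exists C : R, forall x : E, hmem x -> hnorm (A x) <= C * hnorm x].

(* [B] is the Hilbert space adjoint of the bounded linear operator [A]; the
   identity determines [B] up to [heq] and makes it linear and bounded. *)
Definition is_adjoint (E F : hspace) (A : E -> F) (B : F -> E) : Prop :=
  [/\ bounded_linear_op A, maps_into B &
      forall (x : E) (y : F), hmem x -> hmem y ->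
        hip (A x) y = hip x (B y)].

Definition is_gateaux (E F : hspace) (Phi : E -> F) (x : E) (A : E -> F)
    : Prop :=
  bounded_linear_op A /\
  forall d : E, hmem d ->
    (fun s : R => hnorm (s^-1 *: (Phi (x + s *: d) - Phi x) - A d))
      @ 0^' --> (0 : R).

Definition linear_and_continuous (E F : normedModType R) (A : E -> F) : Prop :=
  linear A /\ continuous A.

Definition gateaux_differentiable (E F : normedModType R) (Phi : E -> F)
    : Prop :=
  forall x, (forall d, derivable Phi x d) /\
            linear_and_continuous (fun d => 'D_d Phi x).

(* Banach space adjoint A^* : F' -> E' of A : E -> F, for E' and F' in
   duality with E and F through [bE] and [bF]. *)
Definition banach_adjoint (E F : Type) (E' : normedModType R) (F' : Type)
    (bE : E' -> E -> R) (bF : F' -> F -> R) (A : E -> F) (phi : F') : E' :=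
  xget 0 [set psi | forall x, bE psi x = bF phi (A x)].

End Operators.
Arguments hspace : clear implicits.

Section Gelfand.
Context {R : realType} {V H Vd : hilbertType R}.
Variables (iota : V -> H) (dual : Vd -> V -> R).

(* [Vd] is the dual V^*, [dual] its pairing with V.  The norm given by the
   inner product of [Vd] is only required to be equivalent to the dual norm;
   equality (c = C = 1) would force I = I~ below. *)
Definition is_dual_space : Prop :=
  [/\ forall v, linear (fun phi => dual phi v : R^o),
      forall phi, linear (dual phi : V -> R^o),
      forall l : V -> R^o, linear_and_continuous l -> exists phi, dual phi = l,
      exists C : R, forall phi v, `|dual phi v| <= C * `|phi| * `|v| &
      exists2 c : R, 0 < c & forall phi (K : R), 0 <= K ->
        (forall v, `|dual phi v| <= K * `|v|) -> c * `|phi| <= K].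

(* V -> H continuous, injective, with dense range. *)
Definition gelfand_triple : Prop :=
  [/\ linear_and_continuous iota, injective iota, dense (range iota) &
      is_dual_space].

(* Pairing of V^** = V with V^*. *)
Definition bidual (p : V) (phi : Vd) : R := dual phi p.

(* H = H^* embeds into V^* by the Banach adjoint of [iota]. *)
Definition emb_H : H -> Vd :=
  banach_adjoint dual (fun h k : H => ip h k) iota.

Definition emb (v : V) : Vd := emb_H (iota v).

Definition isoI (phi : Vd) : V :=
  xget 0 [set p | forall psi, dual psi p = ip psi phi].

Definition isoIt (phi : Vd) : V :=
  xget 0 [set p | forall v, ip p v = dual phi v].

Definition isoIt_inv (p : V) : Vd := xget 0 [set phi | isoIt phi = p].

Definition isoIt_adj : V -> V :=
  banach_adjoint (fun p q : V => ip p q) (fun p q : V => ip p q)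
    (fun v => isoIt (emb v)).

End Gelfand.

Section Nemytskii.
Context {R : realType} {V X F : hilbertType R}.
Notation mu := (@lebesgue_measure R).
(* Only the values for t in (0, T) matter. *)
Variables (T : R) (f : R -> V * X -> F).

Definition caratheodory : Prop :=
  (forall x, strongly_measurable `]0, T[ (fun t => f t x)) /\
  {ae mu, forall t, `]0, T[%classic t -> continuous (f t)}.

Definition ae_gateaux : Prop :=
  {ae mu, forall t, `]0, T[%classic t -> gateaux_differentiable (f t)}.

Definition locally_lipschitz : Prop :=
  (forall M : R, 0 <= M -> exists2 L : R, 0 <= L &
    {ae mu, forall t, `]0, T[%classic t ->
      forall (v1 v2 : V) (th1 th2 : X),
        `|v1| <= M -> `|v2| <= M -> `|th1| <= M -> `|th2| <= M ->
        `|f t (v1, th1) - f t (v2, th2)|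
          <= L * (`|v1 - v2| + `|th1 - th2|)}) /\
  L2 T (fun t => f t (0, 0)).

Definition diff_u (t : R) (v : V) (th : X) : V -> F :=
  fun eta => 'D_eta (fun v' => f t (v', th)) v.

Definition diff_th (t : R) (v : V) (th : X) : X -> F :=
  fun xi => 'D_xi (fun th' => f t (v, th')) th.

Definition nem (u : R -> V) (th : X) : R -> F := fun t => f t (u t, th).

Definition nem_u (u : R -> V) (th : X) (v : R -> V) : R -> F :=
  fun t => diff_u t (u t) th (v t).

Definition nem_th (u : R -> V) (th : X) (xi : X) : R -> F :=
  fun t => diff_th t (u t) th xi.

End Nemytskii.

(* u'' = rhs a.e. in (0,T), u'(T) = 0, u'(0) - u(0) = b; here [p] is the
   absolutely continuous representative of u', which has point values. *)
Definition solves_bvp (R : realType) (V : hilbertType R) (T : R)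
    (rhs : R -> V) (b : V) (u : R -> V) : Prop :=
  exists p q : R -> V,
    [/\ is_ddt T u p, is_ddt T p q,
        {ae @lebesgue_measure R, forall t, `]0, T[%classic t -> q t = rhs t},
        p T = 0 & p 0 - u 0 = b].

Section AllAtOnce.
Context {R : realType} {X Z H V Vd : hilbertType R}.
Variables (T : R) (iota : V -> H) (dual : Vd -> V -> R).
Variables (f : R -> V * X -> Vd) (g : R -> V * X -> Z) (u0 : X -> V).

Definition dom_space : hspace R := hs_prod (hs_H1 T V) (hs_full X).
Definition cod_space : hspace R :=
  hs_prod (hs_prod (hs_L2 T Vd) (hs_full V)) (hs_L2 T Z).

Definition FF (x : dom_space) : cod_space :=
  (fun t => emb iota dual (ddt T x.1 t) - nem f x.1 x.2 t,
   x.1 0 - u0 x.2,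
   nem g x.1 x.2).

Definition du0 (th : X) : X -> V := fun xi => 'D_xi u0 th.

(* d/dt - f'_u(., u, th) *)
Definition ddt_sub_nem_u (u : R -> V) (th : X) (v : R -> V) : R -> Vd :=
  fun t => emb iota dual (ddt T v t) - nem_u f u th v t.

Definition dFF (u : R -> V) (th : X) (d : dom_space) : cod_space :=
  (fun t => ddt_sub_nem_u u th d.1 t - nem_th f u th d.2 t,
   d.1 0 - du0 th d.2,
   fun t => nem_u g u th d.1 t + nem_th g u th d.2 t).

Section PointwiseAdjoints.
Variables (u : R -> V) (th : X) (t : R).

Definition fu_adj : V -> Vd :=
  banach_adjoint dual (bidual dual) (diff_u f t (u t) th).
Definition fth_adj : V -> X :=
  banach_adjoint (fun xi eta : X => ip xi eta) (bidual dual)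
    (diff_th f t (u t) th).
Definition gu_adj : Z -> Vd :=
  banach_adjoint dual (fun z y : Z => ip z y) (diff_u g t (u t) th).
Definition gth_adj : Z -> X :=
  banach_adjoint (fun xi eta : X => ip xi eta) (fun z y : Z => ip z y)
    (diff_th g t (u t) th).
Definition u0_adj : Vd -> X :=
  banach_adjoint (fun xi eta : X => ip xi eta) dual (du0 th).

End PointwiseAdjoints.

Definition solves_uz (u : R -> V) (th : X) (z : R -> Z) : (R -> V) -> Prop :=
  solves_bvp T (fun t => - isoIt dual (gu_adj u th t (z t))) 0.

Definition solves_uw (u : R -> V) (th : X) (w : R -> Vd) : (R -> V) -> Prop :=
  solves_bvp T (fun t => isoIt dual (fu_adj u th t (isoI dual (w t)))) 0.

Definition solves_uh (h : V) : (R -> V) -> Prop :=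
  solves_bvp T (fun=> 0) (- h).

Definition fth_star (u : R -> V) (th : X) (w : R -> Vd) : X :=
  bochner `]0, T[ (fun t => fth_adj u th t (isoI dual (w t))).

Definition gth_star (u : R -> V) (th : X) (z : R -> Z) : X :=
  bochner `]0, T[ (fun t => gth_adj u th t (z t)).

Definition u0_star (th : X) (h : V) : X := u0_adj th (isoIt_inv dual h).

Definition ddt_sub_nem_u_star (uw : (R -> Vd) -> R -> V) (w : R -> Vd)
    : R -> V :=
  fun t => uw w t +
    bochner `]0, t[ (fun s => isoIt_adj iota dual (isoI dual (w s))).

Definition FF_star (uz : (R -> Z) -> R -> V) (uw : (R -> Vd) -> R -> V)
    (uh : V -> R -> V) (u : R -> V) (th : X) (y : cod_space) : dom_space :=
  let: (w, h, z) := y in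
  (fun t => ddt_sub_nem_u_star uw w t + uh h t + uz z t,
   - fth_star u th w - u0_star th h + gth_star u th z).

End AllAtOnce.

Arguments dom_space {R X V} T.
Arguments cod_space {R Z V Vd} T.
Arguments FF {R X Z H V Vd} T iota dual f g u0 x.
Arguments dFF {R X Z H V Vd} T iota dual f g u0 u th d.
Arguments FF_star {R X Z H V Vd} T iota dual f g u0 uz uw uh u th y.

(* Main.v *)
(* All spaces being separable, strong measurability is weak measurability and
   the Bochner integral is determined by
   [ip (bochner D F) e = \int_D ip (F t) e], so everything about vector-valued
   functions reduces to scalar integrals.  A solution of [u'' = r],
   [u'(T) = 0], [u'(0) - u(0) = b] satisfies [u'(t) = - \int_t^T r], and Fubini
   gives [(v, u)_H1 = - (v, r)_L2 - (v(0), b)] for all [v] in H1: the boundary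
   value problems are the Riesz representations, in H1, of functionals of
   [v] and [v(0)].  The isomorphisms I and I~ turn the Banach adjoints into
   such representers, e.g. [(I~ f'_u^* I w, v)_V = (w, f'_u v)_V^*].
   Differentiability of F along every direction is dominated convergence, the
   difference quotients being dominated thanks to the local Lipschitz bound. *)

Require Import Defs.
From HB Require Import structures.
From mathcomp Require Import all_boot all_order all_algebra.
From mathcomp Require Import all_classical all_reals all_analysis.
From mathcomp Require Import measurable_realfun ring lra.

Set Implicit Arguments.
Unset Strict Implicit.
Unset Printing Implicit Defensive.

Import Order.TTheory GRing.Theory Num.Theory.
Import numFieldNormedType.Exports.

Local Open Scope classical_set_scope.
Local Open Scope ring_scope.

(** * Hilbert spaces *)

Section Hilbert.
Context {R : realType} {E : hilbertType R}.
Implicit Types (x y z : E) (a : R).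

(** Two obstacles shape the development. Everything is known only up to null sets: [ddt] is a choice
    of derivative, and a pointwise adjoint is meaningful only at those times where [f t] or [g t] is
    Gateaux differentiable. Integrands are therefore handled through the classes [aemeas] and
    [aeint], stable under change on a null set, and operators are linear only up to [heq]. Fubini's
    theorem, however, needs a jointly Borel kernel, supplied by [borel_representative]. The other
    obstacle is that the norm of [Vd] is merely equivalent to the dual norm, so I and I~ differ. The
    constant [c] of [is_dual_space] bounds I~ from below. Its inverse is then bounded, which yields
    the existence of I, the continuity of the embedding of V into V^*, and the separability of V^*,
    on which the passage from weak to strong measurability of V^*-valued functions relies. A state
    in H1 is bounded on [0, T], so one Lipschitz constant serves at almost all times: it bounds the
    difference quotients, then their limits, then the adjoints of these. *)

Lemma ip0l y : ip 0 y = 0.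
Proof.
by have := ip_linearl 1 0 0 y; rewrite scale1r addr0 mul1r => /eqP; rewrite -subr_eq0 opprD addNKr oppr_eq0 => /eqP.
Qed.

Lemma ipDl x y z : ip (x + y) z = ip x z + ip y z.
Proof. by have := ip_linearl 1 x y z; rewrite scale1r mul1r. Qed.

Lemma ipZl a x y : ip (a *: x) y = a * ip x y.
Proof. by have := ip_linearl a x 0 y; rewrite addr0 ip0l addr0. Qed.

Lemma ipNl x y : ip (- x) y = - ip x y.
Proof. by rewrite -scaleN1r ipZl mulN1r. Qed.

Lemma ipBl x y z : ip (x - y) z = ip x z - ip y z.
Proof. by rewrite ipDl ipNl. Qed.

Lemma ip0r x : ip x 0 = 0.
Proof. by rewrite ip_sym ip0l. Qed.

Lemma ipDr x y z : ip x (y + z) = ip x y + ip x z.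
Proof. by rewrite ip_sym ipDl !(ip_sym x). Qed.

Lemma ipZr a x y : ip x (a *: y) = a * ip x y.
Proof. by rewrite ip_sym ipZl ip_sym. Qed.

Lemma ipNr x y : ip x (- y) = - ip x y.
Proof. by rewrite ip_sym ipNl ip_sym. Qed.

Lemma ipBr x y z : ip x (y - z) = ip x y - ip x z.
Proof. by rewrite ipDr ipNr. Qed.

Lemma ip_ge0 x : 0 <= ip x x.
Proof. by rewrite ip_norm exprn_ge0. Qed.

Lemma ip_eq0 x : ip x x = 0 -> x = 0.
Proof. by rewrite ip_norm => /eqP; rewrite expf_eq0/= normr_eq0 => /eqP. Qed.

Lemma sqr_normB x y : `|x - y| ^+ 2 = `|x| ^+ 2 - 2 * ip x y + `|y| ^+ 2.
Proof. rewrite -!ip_norm ipBl !ipBr (ip_sym y x); ring. Qed.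

Lemma ip_inj x y : (forall e, ip x e = ip y e) -> x = y.
Proof.
by move=> xy; apply/eqP; rewrite -subr_eq0; apply/eqP/ip_eq0; rewrite ipBl xy subrr.
Qed.

Lemma ip_le x y : `|ip x y| <= `|x| * `|y|.
Proof.
have [->|y0] := eqVneq y 0; first by rewrite ip0r !normr0 mulr0.
have y_gt0 : 0 < `|y| by rewrite normr_gt0.
rewrite -(ler_pXn2r (_ : 0 < 2)%N)// ?nnegrE ?mulr_ge0//.
(* The residual of the orthogonal projection of [x] onto the line spanned by [y]. *)
have := ip_ge0 (x - (ip x y / `|y| ^+ 2) *: y).
rewrite ip_norm sqr_normB ipZr normrZ !exprMn [X in _ -> X <= _]real_normK ?num_real//.
set b := ip x y; have y2 : 0 < `|y| ^+ 2 by rewrite exprn_gt0.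
set Y := `|y| ^+ 2 in y2 *.
move=> h; move: h.
have -> : `|x| ^+ 2 - 2 * (b / Y * b) + `|b / Y| ^+ 2 * Y =
   `|x| ^+ 2 - b ^+ 2 / Y.
  rewrite real_normK ?num_real//; field; exact: lt0r_neq0.
by rewrite subr_ge0 ler_pdivrMr.
Qed.

(** Polarization writes the inner product through squared norms, so continuity of the norm
    suffices. *)
Lemma cvg_ip {I} (F : set_system I) {FF : Filter F} (u v : I -> E) x y :
  u @ F --> x -> v @ F --> y -> (fun i => ip (u i) (v i)) @ F --> ip x y.
Proof.
move=> ux vy.
have nE i : ip (u i) (v i) = (`|u i| ^+ 2 - `|u i - v i| ^+ 2 + `|v i| ^+ 2) / 2.
  rewrite sqr_normB; lra.
have -> : ip x y = (`|x| ^+ 2 - `|x - y| ^+ 2 + `|y| ^+ 2) / 2.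
  rewrite sqr_normB; lra.
rewrite (_ : (fun i => ip (u i) (v i)) = fun i => (`|u i| ^+ 2 - `|u i - v i| ^+ 2 + `|v i| ^+ 2) / 2); last exact/funext.
have sq (w : I -> E) z : w @ F --> z -> (fun i => `|w i| ^+ 2) @ F --> `|z| ^+ 2.
  move=> /cvg_norm wz; rewrite expr2.
  by under eq_fun do rewrite expr2; exact: cvgM.
apply: cvgMl; apply: cvgD; [apply: cvgB|]; apply: sq => //; exact: cvgB.
Qed.
End Hilbert.

(** * The Riesz representation theorem *)

Section Riesz.
Context {R : realType} {E : hilbertType R}.
Variables (l : E -> R) (C : R).
Hypothesis lD : forall a x y, l (a *: x + y) = a * l x + l y.
Hypothesis lC : forall x, `|l x| <= C * `|x|.

Let J x := `|x| ^+ 2 - 2 * l x.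

Let l0 : l 0 = 0.
Proof. by have := lC 0; rewrite normr0 mulr0 normr_le0 => /eqP. Qed.

Let lZ a x : l (a *: x) = a * l x.
Proof. by have := lD a x 0; rewrite !addr0 l0 addr0. Qed.

Let lA x y : l (x + y) = l x + l y.
Proof. by have := lD 1 x y; rewrite scale1r mul1r. Qed.

Let J_lb x : - C ^+ 2 <= J x.
Proof.
have h : l x <= C * `|x| by rewrite (le_trans (ler_norm _)).
rewrite /J; have := sqr_ge0 (`|x| - C); nra.
Qed.

Let J_parallelogram x y :
  `|x - y| ^+ 2 = 2 * J x + 2 * J y - 4 * J (2^-1 *: (x + y)).
Proof.
rewrite /J lZ lA normrZ exprMn -!ip_norm ipBl !ipBr ipDl !ipDr (ip_sym y x).
rewrite ger0_norm ?invr_ge0//; by field.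
Qed.

(* The representing vector minimizes [J]; the parallelogram identity makes
   minimizing sequences Cauchy. *)
Lemma riesz : exists y, forall x, l x = ip x y.
Proof.
pose m := inf (range J).
have Jinf : has_inf (range J).
  split; first by exists (J 0), 0.
  by exists (- C ^+ 2) => _ [x _ <-]; exact: J_lb.
have mJ x : m <= J x by apply: ge_inf; [case: Jinf|exists x].
have /choice[u Ju] : forall n : nat, exists x, J x < m + n.+1%:R^-1.
  move=> n; have [] := @inf_adherent _ (range J) n.+1%:R^-1 _ Jinf.
    by rewrite invr_gt0.
  by move=> _ [x _ <-] h; exists x.
have uu n k : `|u n - u k| ^+ 2 <= 2 * (n.+1%:R^-1 + k.+1%:R^-1).
  rewrite J_parallelogram.
  have H (r a b c A B : R) : r <= c -> a < r + A -> b < r + B ->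
    2 * a + 2 * b - 4 * c <= 2 * (A + B) by lra.
  by apply: (H m); [exact: mJ|exact: Ju|exact: Ju].
have : cauchy (u @ \oo).
  apply/cauchyP => e e0.
  have e2 : 0 < e ^+ 2 / 4 by rewrite divr_gt0// exprn_gt0.
  have [N _ HN] := near_infty_natSinv_lt (PosNum e2).
  exists (u N); exists N => // n /= Nn.
  rewrite -ball_normE/= -(ltr_pXn2r (_ : 0 < 2)%N)// ?nnegrE// ?(ltW e0)//.
  rewrite (le_lt_trans (uu _ _))//.
  have h1 : N.+1%:R^-1 < e ^+ 2 / 4 by exact: (HN N (leqnn _)).
  have h2 : n.+1%:R^-1 < e ^+ 2 / 4 by exact: (HN n Nn).
  by move: (N.+1%:R^-1) (n.+1%:R^-1) h1 h2 => a b; lra.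
move=> /cauchy_cvg /cvg_ex[y uy]; exists y => h.
have Jy : J y = m.
  apply/eqP; rewrite eq_le mJ andbT.
  have lu : (fun n => l (u n)) @ \oo --> l y.
    apply/cvgrPdist_le => /= e e0.
    have C1 : 0 < `|C| + 1 by rewrite ltr_wpDl.
    have /cvgrPdist_le/(_ (e / (`|C| + 1))) := uy.
    rewrite divr_gt0// => /(_ isT); apply: filterS => n nh.
    have -> : l y - l (u n) = l (y - u n).
      by rewrite lA -[- u n]scaleN1r lZ mulN1r.
    rewrite (le_trans (lC _))// (@le_trans _ _ ((`|C| + 1) * `|y - u n|))//.
      by rewrite ler_wpM2r// (le_trans (ler_norm C))// lerDl.
    by rewrite mulrC -ler_pdivlMr.
  have Jc : (fun n => J (u n)) @ \oo --> J y.
    apply: cvgB; last exact: cvgMr.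
    under eq_fun do rewrite -ip_norm; rewrite -ip_norm; exact: cvg_ip.
  have mc : (fun n => m + n.+1%:R^-1 : R) @ \oo --> m.
    rewrite -[X in _ --> X]addr0; apply: cvgD; first exact: cvg_cst.
    exact: cvg_harmonic.
  rewrite -(cvg_lim _ Jc)// -(cvg_lim _ mc)//.
  apply: ler_lim; [exact: cvgP Jc|exact: cvgP mc|].
  by apply: nearW => n; exact: ltW.
(* First-order condition: moving the minimizer by [s *: h] cannot decrease [J], and a quadratic in
   [s] without constant term is nonnegative everywhere only if its linear coefficient vanishes. *)
have key s : 0 <= 2 * s * (ip h y - l h) + s ^+ 2 * `|h| ^+ 2.
  have := mJ (y + s *: h); rewrite -Jy /J -!ip_norm lA lZ ipDl !ipDr !ipZl !ipZr.
  rewrite (ip_sym y h); lra.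
set a := ip h y - l h in key.
suff : a = 0 by rewrite /a => /eqP; rewrite subr_eq0 => /eqP ->.
have [h0|h0] := eqVneq (`|h| ^+ 2) 0.
  have := key (- a); rewrite h0 mulr0 addr0; have := sqr_ge0 a => ? ?.
  by apply/eqP; rewrite -sqrf_eq0 eq_le sqr_ge0 andbT; nra.
have h_gt0 : 0 < `|h| ^+ 2 by rewrite lt0r h0 exprn_ge0.
(* The value of [s] that minimizes this quadratic. *)
have := key (- a / `|h| ^+ 2).
have -> : 2 * (- a / `|h| ^+ 2) * a + (- a / `|h| ^+ 2) ^+ 2 * `|h| ^+ 2 =
  - (a ^+ 2 / `|h| ^+ 2) by move: (`|h| ^+ 2) h0 => H H0; field.
rewrite oppr_ge0 => a0; apply/eqP; rewrite -sqrf_eq0 eq_le sqr_ge0 andbT.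
by move: a0; rewrite pmulr_lle0// invr_gt0.
Qed.
End Riesz.

(** * Almost everywhere integrable functions *)

Section AeIntegralGeneral.
Context d (T : measurableType d) (R : realType) (mu : {measure set T -> \bar R}).

Import HBNNSimple.

Let nnint_le (f g : T -> \bar R) (N : set T) : measurable N -> mu N = 0%E ->
  (forall t, (0 <= f t)%E) -> (forall t, (0 <= g t)%E) ->
  (forall t, ~ N t -> f t = g t) ->
  (\int[mu]_t f t <= \int[mu]_t g t)%E.
Proof.
move=> mN N0 f0 g0 fg; rewrite ge0_integralTE// [leRHS]ge0_integralTE//.
apply: ge_ereal_sup => _ [h hf <-].
have mC : measurable (~` N) by exact: measurableC.
pose h' := mul_nnsfun h (indic_nnsfun R mC).
have h'E t : h' t = h t * \1_(~` N) t by [].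
apply: (@le_trans _ _ (sintegral mu h')); last first.
  apply: ereal_sup_ubound; exists h' => // t.
  change ((h t * \1_(~` N) t)%:E <= g t)%E; rewrite indicE; case: (boolP (t \in ~` N)) => [|_].
    by rewrite inE => Nt; rewrite mulr1 -fg.
  by rewrite mulr0.
rewrite -!integralT_nnsfun le_eqVlt; apply/orP; left; apply/eqP.
apply: ge0_ae_eq_integral => //.
- exact/measurable_EFinP.
- exact/measurable_EFinP.
- by move=> t _; rewrite lee_fin.
- by move=> t _; rewrite lee_fin.
- exists N; split => // t /=; apply: contra_notP => Nt _.
  by change ((h t)%:E = (h t * \1_(~` N) t)%:E); rewrite indicE mem_set// mulr1.
Qed.

(* No measurability: the integral of a nonnegative function is a lower
   integral. *)
Lemma ae_eq_integral_nomeas (D : set T) (f g : T -> \bar R) :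
  {ae mu, forall t, D t -> f t = g t} ->
  (\int[mu]_(t in D) f t = \int[mu]_(t in D) g t)%E.
Proof.
move=> [N [mN N0 fgN]].
have fg t : ~ N t -> (f \_ D) t = (g \_ D) t.
  move=> Nt; rewrite /patch; case: ifPn => // /set_mem Dt.
  by apply: contrapT => h; apply/Nt/fgN => /= /(_ Dt).
have H (F G : T -> \bar R) : (forall t, (0 <= F t)%E) -> (forall t, (0 <= G t)%E) ->
    (forall t, ~ N t -> F t = G t) -> (\int[mu]_t F t = \int[mu]_t G t)%E.
  move=> F0 G0 FG; apply/eqP; rewrite eq_le (nnint_le mN)//=.
  by apply: (nnint_le mN) => // t Nt; rewrite FG.
rewrite integral_mkcond [RHS]integral_mkcond integralE [RHS]integralE.
congr (_ - _)%E; apply: H => // t Nt.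
  by rewrite !funeposE fg.
by rewrite !funenegE fg.
Qed.

End AeIntegralGeneral.

Section AlmostEverywhereIntegral.
Context {R : realType}.
Notation mu := (@lebesgue_measure R).
Implicit Types (D : set R) (phi psi : R -> R).

#[global] Instance ae_lebesgue_filter :
  Filter (nbhs (almost_everywhere (@lebesgue_measure R))).
Proof. exact: ae_filter_ringOfSetsType. Qed.

Lemma ae_eq_Rintegral D phi psi : {ae mu, forall t, D t -> phi t = psi t} ->
  \int[mu]_(t in D) phi t = \int[mu]_(t in D) psi t.
Proof.
move=> h; congr fine; apply: ae_eq_integral_nomeas.
by apply: filterS h => t + Dt => ->.
Qed.

(** The Borel sigma-algebra is not complete, so a function equal almost everywhere to a measurable
    one need not be measurable. [aemeas] and [aeint] ask only for a good representative. *)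
Definition aemeas D phi := exists2 psi : R -> R, measurable_fun (D : set (measurableTypeR R)) (psi : measurableTypeR R -> R) &
  {ae mu, forall t, D t -> phi t = psi t}.

Definition aeint D phi := exists2 psi : R -> R, mu.-integrable D (EFin \o psi) &
  {ae mu, forall t, D t -> phi t = psi t}.

Lemma ae_and (P Q : R -> Prop) : {ae mu, forall t, P t} ->
  {ae mu, forall t, Q t} -> {ae mu, forall t, P t /\ Q t}.
Proof. by move=> p q; apply: filterS2 p q. Qed.

Section On.
Variable D : set R.
Hypothesis mD : measurable (D : set (measurableTypeR R)).

Lemma aemeas_ae phi psi : {ae mu, forall t, D t -> phi t = psi t} ->
  aemeas D psi -> aemeas D phi.
Proof.
move=> h [p mp hp]; exists p => //; apply: filterS2 h hp => t h1 h2 Dt.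
by rewrite h1// h2.
Qed.

Lemma aeint_ae phi psi : {ae mu, forall t, D t -> phi t = psi t} ->
  aeint D psi -> aeint D phi.
Proof.
move=> h [p mp hp]; exists p => //; apply: filterS2 h hp => t h1 h2 Dt.
by rewrite h1// h2.
Qed.

Lemma aeint_meas phi : aeint D phi -> aemeas D phi.
Proof. by move=> [p /measurable_int/measurable_EFinP ? ?]; exists p. Qed.

Lemma aemeasW phi :
  measurable_fun (D : set (measurableTypeR R)) (phi : measurableTypeR R -> R) -> aemeas D phi.
Proof. by move=> m; exists phi => //; exact: aeW. Qed.

Lemma aemeas_cst c : aemeas D (fun=> c).
Proof. exact: aemeasW. Qed.

Lemma aemeas2 (op : R -> R -> R) phi psi :
  (forall p q : measurableTypeR R -> R,
    measurable_fun (D : set (measurableTypeR R)) p -> measurable_fun D q ->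
    measurable_fun D (fun t => op (p t) (q t))) ->
  aemeas D phi -> aemeas D psi -> aemeas D (fun t => op (phi t) (psi t)).
Proof.
move=> mop [p mp hp] [q mq hq]; exists (fun t => op (p t) (q t)); first exact: mop.
by apply: filterS2 hp hq => t h1 h2 Dt; rewrite h1// h2.
Qed.

Lemma aemeasD phi psi : aemeas D phi -> aemeas D psi ->
  aemeas D (fun t => phi t + psi t).
Proof. apply: (@aemeas2 +%R) => p q; exact: measurable_funD. Qed.

Lemma aemeasB phi psi : aemeas D phi -> aemeas D psi ->
  aemeas D (fun t => phi t - psi t).
Proof. apply: (@aemeas2 (fun x y => x - y)) => p q; exact: measurable_funB. Qed.

Lemma aemeasM phi psi : aemeas D phi -> aemeas D psi ->
  aemeas D (fun t => phi t * psi t).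
Proof. apply: (@aemeas2 *%R) => p q; exact: measurable_funM. Qed.

Lemma aemeas_max phi psi : aemeas D phi -> aemeas D psi ->
  aemeas D (fun t => Num.max (phi t) (psi t)).
Proof. apply: (@aemeas2 Num.max) => p q; exact: measurable_maxr. Qed.

Lemma aemeasZ c phi : aemeas D phi -> aemeas D (fun t => c * phi t).
Proof. by apply: aemeasM; exact: aemeas_cst. Qed.

Lemma aemeas_comp (h : R -> R) phi : measurable_fun setT h ->
  aemeas D phi -> aemeas D (fun t => h (phi t)).
Proof.
move=> mh [p mp hp]; exists (h \o p); first exact: measurableT_comp.
by apply: filterS hp => t h1 Dt /=; rewrite h1.
Qed.

(** The countably many exceptional sets are merged into one measurable null set [N]. Off [N] the
    representatives converge, and on [N] they are replaced by 0, so that a limit exists at every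
    point of [D]. *)
Lemma aemeas_lim (phi_ : nat -> R -> R) phi : (forall n, aemeas D (phi_ n)) ->
  {ae mu, forall t, D t -> (fun n => phi_ n t) @ \oo --> phi t} ->
  aemeas D phi.
Proof.
move=> m_ hlim; have [p_ mp hp] := all_sig2 (fun n => cid2 (m_ n)).
have /= [N [mN N0 sN]] := ae_and (ae_foralln hp) hlim.
have good t : ~ N t -> (forall n, D t -> phi_ n t = p_ n t) /\
    (D t -> (fun n => phi_ n t) @ \oo --> phi t).
  by move=> Nt; apply: contrapT => h; exact/Nt/sN.
have mC : measurable (~` N : set (measurableTypeR R)) by exact: measurableC.
exists (phi \_ (~` N)); last first.
  exists N; split => // t /=; apply: contra_notP => Nt Dt.
  by rewrite patchE mem_set.
apply: (@measurable_fun_cvg _ _ _ _ (fun n => p_ n \_ (~` N))).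
  move=> n; apply/measurable_restrict => //.
  by apply: measurable_funS (mp n) => // t [].
move=> t Dt; rewrite patchE; case: ifPn => [/set_mem Nt|tN].
  have [h1 /(_ Dt)] := good t Nt; apply: cvg_trans.
  apply: near_eq_cvg; apply: nearW => n; rewrite h1// patchE mem_set//.
have -> : (fun n => (p_ n \_ (~` N)) t) = fun=> 0.
  by apply/funext => n; rewrite patchE (negbTE tN).
exact: cvg_cst.
Qed.

(** Integrability by domination needs the bound at every point of [D]; the representative of [phi]
    is therefore set to 0 on the null set where the bound may fail. *)
Lemma aeint_le phi psi : aemeas D phi -> aeint D psi ->
  {ae mu, forall t, D t -> `|phi t| <= psi t} -> aeint D phi.
Proof.
move=> [p mp hp] [q iq hq] hle.
have /= [N [mN N0 sN]] := ae_and (ae_and hp hq) hle.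
have good t : D t -> ~ N t -> [/\ phi t = p t, psi t = q t & `|phi t| <= psi t].
  move=> Dt Nt.
  suff [[a b] c] : ((D t -> phi t = p t) /\ (D t -> psi t = q t)) /\
      (D t -> `|phi t| <= psi t) by split; auto.
  by apply: contrapT => h; exact/Nt/sN.
have mC : measurable (~` N : set (measurableTypeR R)) by exact: measurableC.
exists (p \_ (~` N)); last first.
  exists N; split => // t /=; apply: contra_notP => Nt Dt.
  by rewrite patchE mem_set//; case: (good t Dt Nt).
apply: le_integrable iq => //.
  apply/measurable_EFinP/measurable_restrict => //.
  by apply: measurable_funS mp => // t [].
move=> t Dt; rewrite /= lee_fin patchE; case: ifPn => [/set_mem Nt|tN].
  have [<- <- h] := good t Dt Nt; exact: le_trans (ler_norm _).
by rewrite normr0.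
Qed.

Lemma aeint_norm phi : aeint D phi -> aeint D (fun t => `|phi t|).
Proof.
move=> [p ip hp]; exists (fun t => `|p t|); first exact: integrable_norm.
by apply: filterS hp => t h Dt; rewrite h.
Qed.

Lemma aeintD phi psi : aeint D phi -> aeint D psi ->
  aeint D (fun t => phi t + psi t).
Proof.
move=> [p ip hp] [q iq hq]; exists (fun t => p t + q t).
  by have := integrableD mD ip iq; exact: eq_integrable.
by apply: filterS2 hp hq => t h1 h2 Dt; rewrite h1// h2.
Qed.

Lemma aeintZ c phi : aeint D phi -> aeint D (fun t => c * phi t).
Proof.
move=> [p ip hp]; exists (fun t => c * p t).
  by have := integrableZl mD c ip; exact: eq_integrable.
by apply: filterS hp => t h1 Dt; rewrite h1.
Qed.

Lemma aeintN phi : aeint D phi -> aeint D (fun t => - phi t).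
Proof.
by move=> /(aeintZ (-1)); apply: aeint_ae; apply: aeW => t _; rewrite mulN1r.
Qed.

Lemma aeintB phi psi : aeint D phi -> aeint D psi ->
  aeint D (fun t => phi t - psi t).
Proof. by move=> h /aeintN; exact: aeintD. Qed.

Lemma aeint_cst c : (mu D < +oo)%E -> aeint D (fun=> c).
Proof.
move=> Doo; exists (fun=> c); last exact: aeW.
apply: measurable_bounded_integrable => //.
exists `|c|; split; first exact: num_real.
by move=> y cy t _ /=; exact: ltW.
Qed.

Lemma aeint_sub D' phi : measurable (D' : set (measurableTypeR R)) -> D' `<=` D -> aeint D phi -> aeint D' phi.
Proof.
move=> mD' sub [p ip hp]; exists p; first exact: integrableS ip.
by apply: filterS hp => t h /sub.
Qed.

Lemma Rintegral_aeD phi psi : aeint D phi -> aeint D psi ->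
  \int[mu]_(t in D) (phi t + psi t) =
  \int[mu]_(t in D) phi t + \int[mu]_(t in D) psi t.
Proof.
move=> [p ip hp] [q iq hq].
rewrite (ae_eq_Rintegral hp) (ae_eq_Rintegral hq) -RintegralD//.
by apply: ae_eq_Rintegral; apply: filterS2 hp hq => t h1 h2 Dt; rewrite h1// h2.
Qed.

Lemma Rintegral_aeZ c phi : aeint D phi ->
  \int[mu]_(t in D) (c * phi t) = c * \int[mu]_(t in D) phi t.
Proof.
move=> [p ip hp]; rewrite (ae_eq_Rintegral hp) -RintegralZl//.
by apply: ae_eq_Rintegral; apply: filterS hp => t h1 Dt; rewrite h1.
Qed.

Lemma Rintegral_aeN phi : aeint D phi ->
  \int[mu]_(t in D) (- phi t) = - \int[mu]_(t in D) phi t.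
Proof.
move=> i; rewrite -mulN1r -Rintegral_aeZ//.
by apply: eq_Rintegral => t _; rewrite mulN1r.
Qed.

Lemma Rintegral_aeB phi psi : aeint D phi -> aeint D psi ->
  \int[mu]_(t in D) (phi t - psi t) =
  \int[mu]_(t in D) phi t - \int[mu]_(t in D) psi t.
Proof. by move=> i j; rewrite Rintegral_aeD ?Rintegral_aeN//; exact: aeintN. Qed.

Lemma Rintegral_ae_ge0 phi : {ae mu, forall t, D t -> 0 <= phi t} ->
  0 <= \int[mu]_(t in D) phi t.
Proof.
move=> h; rewrite (@ae_eq_Rintegral D phi (fun t => `|phi t|)).
  by apply: Rintegral_ge0.
by apply: filterS h => t h Dt; rewrite ger0_norm// h.
Qed.

Lemma le_Rintegral_ae phi psi : aeint D phi -> aeint D psi ->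
  {ae mu, forall t, D t -> phi t <= psi t} ->
  \int[mu]_(t in D) phi t <= \int[mu]_(t in D) psi t.
Proof.
move=> i j h; rewrite -subr_ge0 -Rintegral_aeB//; apply: Rintegral_ae_ge0.
by apply: filterS h => t h Dt; rewrite subr_ge0 h.
Qed.

Lemma normr_Rintegral_ae phi : aeint D phi ->
  `|\int[mu]_(t in D) phi t| <= \int[mu]_(t in D) `|phi t|.
Proof.
move=> [p ip hp]; rewrite (ae_eq_Rintegral hp).
rewrite (@ae_eq_Rintegral D (fun t => `|phi t|) (fun t => `|p t|)); last first.
  by apply: filterS hp => t h Dt; rewrite h.
exact: le_normr_Rintegral.
Qed.

(** Cauchy-Schwarz against the constant 1: the integral of [(phi - c)^2] is nonnegative for each
    [c], and the best [c] is the mean value [I / M]. *)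
Lemma Rintegral_sqr_ge (M : R) phi : fine (mu D) = M -> (mu D < +oo)%E ->
  aeint D phi -> aeint D (fun t => phi t ^+ 2) ->
  (\int[mu]_(t in D) phi t) ^+ 2 <= M * \int[mu]_(t in D) (phi t ^+ 2).
Proof.
move=> DM Doo i i2; set I := \int[mu]_(t in D) phi t.
have M0 : 0 <= M by rewrite -DM fine_ge0.
have key c : 0 <= \int[mu]_(t in D) (phi t ^+ 2) - 2 * c * I + c ^+ 2 * M.
  rewrite -DM -(Rintegral_cst mu mD) -Rintegral_aeZ// -Rintegral_aeB//; last exact: aeintZ.
  rewrite -Rintegral_aeD//; last 2 first.
    by apply: aeintB => //; exact: aeintZ.
    exact: aeint_cst.
  apply: Rintegral_ge0 => t _; have := sqr_ge0 (phi t - c); lra.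
move: key; set J := Rintegral _ _ _ => key.
have [M00|M_neq0] := eqVneq M 0; last first.
  have M_gt0 : 0 < M by rewrite lt0r M_neq0.
  have := key (I / M).
  have -> : J - 2 * (I / M) * I + (I / M) ^+ 2 * M = J - I ^+ 2 / M by field.
  by rewrite subr_ge0 ler_pdivrMr// mulrC.
rewrite M00 mul0r.
(* For [M = 0] the bound is affine in [c], which forces [I = 0]: otherwise [c = (J + 1) / (2 * I)]
   would make it -1. *)
have key' c : 0 <= J - 2 * c * I by have := key c; rewrite M00 mulr0 addr0.
have := key' (- I); have := key' ((J + 1) * I).
have [->|I0] := eqVneq I 0; first by rewrite expr0n.
have I2 : 0 < I ^+ 2 by rewrite exprn_even_gt0.
have := key' ((J + 1) / (2 * I)).
have -> : J - 2 * ((J + 1) / (2 * I)) * I = -1 by field.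
by rewrite ler0N1.
Qed.

Lemma dominated_cvg_Rintegral (phi_ : nat -> R -> R) phi psi :
  (forall n, aemeas D (phi_ n)) -> aeint D psi ->
  (forall n, {ae mu, forall t, D t -> `|phi_ n t| <= psi t}) ->
  {ae mu, forall t, D t -> (fun n => phi_ n t) @ \oo --> phi t} ->
  (fun n => \int[mu]_(t in D) phi_ n t) @ \oo --> \int[mu]_(t in D) phi t.
Proof.
move=> m_ ipsi le_ lim.
have [p mp hp] : aemeas D phi by exact: aemeas_lim lim.
have [q iq hq] := ipsi.
have [p_ mp_ hp_] := all_sig2 (fun n => cid2 (m_ n)).
have hp_' := ae_foralln hp_; have le_' := ae_foralln le_.
have := @dominated_convergence _ _ _ mu D mD (fun n => EFin \o p_ n) (EFin \o p) (EFin \o q).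
move=> /(_ (fun n => (measurable_EFinP _ _).2 (mp_ n))).
move=> /(_ ((measurable_EFinP _ _).2 mp)).
case.
- apply: filterS3 lim hp hp_' => t h1 h2 h3 Dt; apply/fine_cvgP; split.
    exact: nearW.
  rewrite /comp/= -h2//; under eq_fun do rewrite -h3//; exact: h1.
- exact: iq.
- apply: filterS3 le_' hq hp_' => t h1 h2 h3 n Dt.
  by rewrite /= lee_fin -h2// -h3// h1.
- move=> ip _ /= cv.
  rewrite (ae_eq_Rintegral hp); under eq_fun do rewrite (ae_eq_Rintegral (hp_ _)).
  by apply: fine_cvg; rewrite fineK//; exact: integrable_fin_num.
Qed.

End On.
End AlmostEverywhereIntegral.

(** * Strong measurability and the Bochner integral *)

Section StrongMeasurability.
Context {R : realType}.
Notation mu := (@lebesgue_measure R).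
Notation Rm := (measurableTypeR R).
Implicit Types (E : hilbertType R) (D : set R).

(** The dense set is enumerated by inverting an injection into [nat]. Indices outside its range get
    the default 0, which may lie outside the set but does not affect density. *)
Lemma separable_seq E : separable E ->
  exists d : nat -> E, forall x (r : R), 0 < r -> exists k, `|x - d k| < r.
Proof.
move=> [D /countable_injP[f finj] dD].
exists (fun k => xget 0 [set x | D x /\ f x = k]) => x e e0.
have [] := dD (ball x e); [by exists x; exact: ballxx|exact: ball_open|].
move=> y [xy Dy]; exists (f y).
set z := xget _ _; have [Dz fz] : D z /\ f z = f y.
  by apply: (@xgetPex _ 0 [set z | D z /\ f z = f y]); exists y.
have -> : z = y by apply: finj; rewrite ?inE.
by move: xy; rewrite -ball_normE.
Qed.

Lemma is_simple_cons E (p : set R * E) (s : simple E) :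
  is_simple (p :: s) <-> measurable (p.1 : set Rm) /\ is_simple s.
Proof.
split=> [h|[h1 h2] [|i]//].
  by split; [exact: (h 0%N)|move=> i si; exact: (h i.+1)].
exact: h2.
Qed.

Lemma norm_sqrt E (x : E) : `|x| = Num.sqrt (`|x| ^+ 2).
Proof. by rewrite sqrtr_sqr normr_id. Qed.

Lemma simple_fun_nil E t : simple_fun ([::] : simple E) t = 0.
Proof. exact: big_nil. Qed.

Lemma simple_fun_cons E p (s : simple E) t :
  simple_fun (p :: s) t = (\1_(p.1) t : R) *: p.2 + simple_fun s t.
Proof. exact: big_cons. Qed.

Section On.
Variables (E : hilbertType R) (D : set R).
Hypothesis mD : measurable (D : set Rm).
Implicit Types (F G : R -> E) (e : E).

Lemma aemeas_ip_simple F (s : simple E) : (forall e, aemeas D (fun t => ip (F t) e)) ->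
  is_simple s -> aemeas D (fun t => ip (F t) (simple_fun s t)).
Proof.
move=> wF; elim: s => [_|[A x] s ih /is_simple_cons[/= mA /ih sm]].
  under eq_fun do rewrite simple_fun_nil ip0r; exact: aemeas_cst.
under eq_fun do rewrite simple_fun_cons ipDr ipZr.
apply: aemeasD => //; apply: aemeasM; last exact: wF.
by apply: aemeasW; exact: measurable_indic.
Qed.

Lemma sm_ip_cst F e : strongly_measurable D F -> aemeas D (fun t => ip (F t) e).
Proof.
move=> [s simp sF]; apply: (@aemeas_lim _ _ _ (fun n t => ip (simple_fun (s n) t) e)) => //.
  move=> n; under eq_fun do rewrite ip_sym.
  apply: (@aemeas_ip_simple (fun=> e)) => // e'; exact: aemeas_cst.
by apply: filterS sF => t h Dt; apply: cvg_ip; [exact: h|exact: cvg_cst].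
Qed.

Lemma sm_ip F G : strongly_measurable D F -> strongly_measurable D G ->
  aemeas D (fun t => ip (F t) (G t)).
Proof.
move=> smF [s simp sF].
apply: (@aemeas_lim _ _ _ (fun n t => ip (F t) (simple_fun (s n) t))) => //.
  by move=> n; apply: aemeas_ip_simple => // e; exact: sm_ip_cst.
by apply: filterS sF => t h Dt; apply: cvg_ip; [exact: cvg_cst|exact: h].
Qed.

Lemma sm_norm F : strongly_measurable D F -> aemeas D (fun t => `|F t|).
Proof.
move=> smF; under eq_fun do rewrite norm_sqrt -ip_norm.
apply: (@aemeas_comp _ _ Num.sqrt); last exact: sm_ip.
apply: continuous_measurable_fun; exact: sqrt_continuous.
Qed.

Lemma aemeas_bigmax (phi : nat -> R -> R) n : (forall k, aemeas D (phi k)) ->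
  aemeas D (fun t => \big[Num.max/0]_(k < n) phi k t).
Proof.
elim: n phi => [|n ih] phi mphi.
  by under eq_fun do rewrite big_ord0; exact: aemeas_cst.
under eq_fun do rewrite big_ord_recl/=.
by apply: aemeas_max => //; exact: (ih (fun k => phi k.+1)).
Qed.

(** * Weak measurability implies strong measurability (Pettis) *)

Section Separable.
Variable d : nat -> E.
Hypothesis d_dense : forall x (r : R), 0 < r -> exists k, `|x - d k| < r.

(* |x|^2 is the supremum over k of |x|^2 - |x - d k|^2, which is affine in x. *)
Lemma cvg_bigmax_affine x :
  (fun n => \big[Num.max/0]_(k < n) (2 * ip x (d k) - `|d k| ^+ 2)) @ \oo
    --> `|x| ^+ 2.
Proof.
have ub k : 2 * ip x (d k) - `|d k| ^+ 2 = `|x| ^+ 2 - `|x - d k| ^+ 2.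
  by rewrite sqr_normB; lra.
apply/cvgrPdist_le => /= e e0.
have sq0 : 0 < Num.sqrt e by rewrite sqrtr_gt0.
have [k kx] := d_dense x sq0.
exists k.+1 => // n /= kn.
have le1 : \big[Num.max/0]_(i < n) (2 * ip x (d i) - `|d i| ^+ 2) <= `|x| ^+ 2.
  apply: bigmax_le; first exact: exprn_ge0.
  by move=> i _; rewrite ub gerBl exprn_ge0.
rewrite ger0_norm ?subr_ge0//.
have : 2 * ip x (d k) - `|d k| ^+ 2 <=
    \big[Num.max/0]_(i < n) (2 * ip x (d i) - `|d i| ^+ 2).
  exact: (@le_bigmax _ _ _ 0 (fun i : 'I_n => 2 * ip x (d i) - `|d i| ^+ 2) (Ordinal kn)).
have : `|x - d k| ^+ 2 <= e.
  by rewrite -[leRHS]sqr_sqrtr ?(ltW e0)// ler_pXn2r ?nnegrE ?sqrtr_ge0// ltW.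
rewrite ub; lra.
Qed.

Lemma weak_norm F : (forall e, aemeas D (fun t => ip (F t) e)) ->
  aemeas D (fun t => `|F t|).
Proof.
move=> wF; under eq_fun do rewrite norm_sqrt.
apply: (@aemeas_comp _ _ Num.sqrt).
  by apply: continuous_measurable_fun; exact: sqrt_continuous.
apply: (@aemeas_lim _ _ mD (fun n t => \big[Num.max/0]_(k < n) (2 * ip (F t) (d k) - `|d k| ^+ 2))).
  move=> n; apply: (@aemeas_bigmax (fun k t => 2 * ip (F t) (d k) - `|d k| ^+ 2)).
  by move=> k; apply: aemeasB; [exact: aemeasZ|exact: aemeas_cst].
by apply: aeW => t _; exact: cvg_bigmax_affine.
Qed.

(** Used with representatives [b k] of [|F t - d k|] and [m0] of [|F t|]. The first component then
    takes at [t] a value nearest to [F t] among 0 and the first [n] points [d k]; the second is the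
    distance achieved. At each stage the new set [B] is removed from the older ones, so that the
    sets stay disjoint. *)
Fixpoint nearest (b : nat -> R -> R) (m0 : R -> R) n : simple E * (R -> R) :=
  if n is k.+1 then
    let: (s, m) := nearest b m0 k in
    let B := [set t | D t /\ b k t < m t] in
    ((B, d k) :: [seq (p.1 `\` B, p.2) | p <- s], fun t => Num.min (b k t) (m t))
  else ([::], m0).

Lemma nearest_meas (b : nat -> R -> R) m0 n :
  (forall k, measurable_fun (D : set Rm) (b k)) ->
  measurable_fun (D : set Rm) m0 ->
  is_simple (nearest b m0 n).1 /\ measurable_fun (D : set Rm) (nearest b m0 n).2.
Proof.
move=> mb mm0; elim: n => [|n /=]; first by split.
case: (nearest b m0 n) => s m /= [ss mm]; split; last exact: measurable_minr.
have mB : measurable ([set t | D t /\ b n t < m t] : set Rm).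
  have -> : [set t | D t /\ b n t < m t] =
      D `&` (fun t => b n t < m t) @^-1` [set true].
    by apply/seteqP; split => t [Dt].
  exact: (@measurable_fun_ltr _ _ _ _ _ _ (mb n) mm mD [set true] I).
apply/is_simple_cons; split => // {mm}.
elim: s ss => [|p s ih /is_simple_cons[mp /ih ss]]//=.
by apply/is_simple_cons; split => //=; exact: measurableD.
Qed.

Lemma nearest_dist (b : nat -> R -> R) m0 (x : E) t n : D t ->
  (forall k, `|x - d k| = b k t) -> `|x| = m0 t ->
  `|x - simple_fun (nearest b m0 n).1 t| = (nearest b m0 n).2 t /\
  (forall k, (k < n)%N -> (nearest b m0 n).2 t <= b k t) /\
  (nearest b m0 n).2 t <= m0 t.
Proof.
move=> Dt bE mE; elim: n => [|n /=].
  by rewrite /= simple_fun_nil subr0.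
case: (nearest b m0 n) => s m /= [ih1 [ih2 ih3]].
set B := [set t | D t /\ b n t < m t].
rewrite simple_fun_cons/=.
(* On [B] the older terms vanish, and only the new value [d n] survives. *)
have rE : simple_fun [seq (p.1 `\` B, p.2) | p <- s] t =
    if t \in B then 0 else simple_fun s t.
  elim: s {ih1} => [|p s ih]; first by rewrite simple_fun_nil; case: ifP.
  rewrite !simple_fun_cons/= ih !indicE in_setD; case: ifPn => tB/=.
    by rewrite andbF scale0r addr0.
  by rewrite andbT.
rewrite rE indicE; split; last split.
- case: ifPn => [|].
    rewrite inE => -[_ bm]; rewrite scale1r addr0 bE.
    by rewrite min_l// ltW.
  move=> /negP; rewrite inE => nB; rewrite scale0r add0r ih1 min_r// leNgt.
  by apply/negP => bm; apply: nB.
- by move=> k; rewrite ltnS leq_eqVlt => /predU1P[->|/ih2 kb];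
    rewrite ge_min ?lexx// kb orbT.
- by rewrite ge_min ih3 orbT.
Qed.

(** Nearest points among 0 and the first [d k] converge to [F t] by density. As 0 is always a
    candidate, the error never exceeds [|F t|]; this is the majorant used to integrate the error by
    dominated convergence. *)
Lemma simple_approx F : (forall e, aemeas D (fun t => ip (F t) e)) ->
  exists s : nat -> simple E, [/\ forall n, is_simple (s n),
    {ae mu, forall t, D t -> forall n, `|F t - simple_fun (s n) t| <= `|F t|} &
    {ae mu, forall t, D t -> (fun n => simple_fun (s n) t) @ \oo --> F t}].
Proof.
move=> wF.
have mdist x : aemeas D (fun t => `|F t - x|).
  apply: weak_norm => e; under eq_fun do rewrite ipBl.
  by apply: aemeasB => //; exact: aemeas_cst.
have [m0 mm0 h0] := weak_norm wF.
have [b mb hb] := all_sig2 (fun k => cid2 (mdist (d k))).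
have {}hb := ae_foralln hb.
have key : {ae mu, forall t, D t -> forall n,
  `|F t - simple_fun (nearest b m0 n).1 t| = (nearest b m0 n).2 t /\
  (forall k, (k < n)%N -> (nearest b m0 n).2 t <= `|F t - d k|) /\
  (nearest b m0 n).2 t <= `|F t|}.
  apply: filterS2 h0 hb => t h1 h2 Dt n.
  have [||? [h ?]] := @nearest_dist b m0 (F t) t n Dt.
  - by move=> k; rewrite h2.
  - by rewrite h1.
  - by split=> //; split; [move=> k kn; rewrite h2// h|rewrite h1].
exists (fun n => (nearest b m0 n).1); split.
- by move=> n; have [] := nearest_meas n mb mm0.
- by apply: filterS key => t h Dt n; have [-> []] := h Dt n.
- apply: filterS key => t h Dt; apply/cvgrPdist_lt => /= e e0.
  have [k ke] := d_dense (F t) e0.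
  exists k.+1 => // n /= kn; have [-> [/(_ k kn) h1 _]] := h Dt n.
  exact: le_lt_trans ke.
Qed.
End Separable.

Lemma sm_weak F : separable E -> (forall e, aemeas D (fun t => ip (F t) e)) ->
  strongly_measurable D F.
Proof.
move=> /separable_seq[d dd] /(simple_approx dd)[s [h1 _ h2]].
by exists s.
Qed.

(** * The Bochner integral as a weak integral *)

Section Bochner.
Hypothesis Doo : (mu D < +oo)%E.

Lemma aeint_indic (A : set R) : measurable (A : set Rm) -> aeint D \1_A.
Proof.
move=> mA; exists \1_A; last exact: aeW.
apply: measurable_bounded_integrable => //.
exists 1; split; first exact: num_real.
by move=> y y1 t _ /=; rewrite indicE; case: (t \in A); rewrite ?normr1 ?normr0 ltW// (lt_trans _ y1).
Qed.

Lemma aeint_simple_ip (s : simple E) e : is_simple s ->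
  aeint D (fun t => ip (simple_fun s t) e) /\
  ip (simple_int D s) e = \int[mu]_(t in D) ip (simple_fun s t) e.
Proof.
rewrite /simple_int; elim: s => [_|[A x] s ih /is_simple_cons[/= mA /ih[i1 i2]]].
  under eq_fun do rewrite simple_fun_nil ip0l; split; first exact: aeint_cst.
  rewrite big_nil ip0l.
  by rewrite Rintegral_cst// mul0r.
have E1 t : ip (simple_fun ((A, x) :: s) t) e = ip x e * \1_A t + ip (simple_fun s t) e.
  by rewrite simple_fun_cons ipDl ipZl mulrC.
have i3 : aeint D (fun t => ip x e * \1_A t) by apply: aeintZ => //; exact: aeint_indic.
split; first by under eq_fun do rewrite E1; exact: aeintD.
under eq_Rintegral do rewrite E1.
rewrite big_cons ipDl i2 Rintegral_aeD// Rintegral_aeZ//; last exact: aeint_indic.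
by rewrite ipZl mulrC /Rintegral integral_indic.
Qed.

Lemma aeint_ip F e : strongly_measurable D F -> aeint D (fun t => `|F t|) ->
  aeint D (fun t => ip (F t) e).
Proof.
move=> smF iF; apply: (@aeint_le _ _ _ _ (fun t => `|e| * `|F t|)) => //.
- exact: sm_ip_cst.
- exact: aeintZ.
- by apply: aeW => t _; rewrite mulrC ip_le.
Qed.

(** Pairing [v = y - simple_int D s] with itself gives [|v|^2] as the integral of
    [ip (F t - simple_fun s t) v], hence at most [|v|] times the right-hand side. *)
Lemma simple_int_dist F y (s : simple E) : is_simple s ->
  strongly_measurable D F -> aeint D (fun t => `|F t|) ->
  aeint D (fun t => `|F t - simple_fun s t|) ->
  (forall e, ip y e = \int[mu]_(t in D) ip (F t) e) ->
  `|y - simple_int D s| <= \int[mu]_(t in D) `|F t - simple_fun s t|.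
Proof.
move=> ss smF iF iFs yE; set v := y - _; set I := Rintegral _ _ _.
have I0 : 0 <= I by apply: Rintegral_ge0.
have [->|v0] := eqVneq v 0; first by rewrite normr0.
rewrite -(ler_pM2l (_ : 0 < `|v|)) ?normr_gt0// -expr2 -ip_norm {1}/v.
have [i1 i2] := aeint_simple_ip v ss.
have iv : aeint D (fun t => ip (F t) v) by exact: aeint_ip.
rewrite ipBl yE i2 -Rintegral_aeB// -Rintegral_aeZ//.
apply: le_Rintegral_ae => //; [exact: aeintB|exact: aeintZ|].
apply: aeW => t _; rewrite -ipBl (le_trans (ler_norm _))// mulrC.
exact: ip_le.
Qed.

Lemma aeint_EFin phi : aeint D phi ->
  (\int[mu]_(t in D) (phi t)%:E = (\int[mu]_(t in D) phi t)%:E)%E.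
Proof.
move=> [p ip hp]; rewrite /Rintegral fineK//.
have -> : (\int[mu]_(t in D) (phi t)%:E = \int[mu]_(t in D) (EFin \o p) t)%E.
  by apply: ae_eq_integral_nomeas; apply: filterS hp => t h Dt; rewrite h.
exact: integrable_fin_num.
Qed.

(** Riesz turns the bounded functional of weak integrals into a vector [y]. The dominated simple
    approximants of [F] then show, through [simple_int_dist], that their integrals converge to this
    same [y]. *)
Lemma bochner_exists F : separable E -> strongly_measurable D F ->
  aeint D (fun t => `|F t|) ->
  exists2 y, is_bochner D F y & forall e, ip y e = \int[mu]_(t in D) ip (F t) e.
Proof.
move=> /separable_seq[d dd] smF iF.
have [] := @riesz _ _ (fun e => \int[mu]_(t in D) ip (F t) e) (\int[mu]_(t in D) `|F t|).
- move=> a x y; under eq_Rintegral do rewrite ipDr ipZr.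
  by rewrite Rintegral_aeD ?Rintegral_aeZ//; do ?apply: aeintZ => //; exact: aeint_ip.
- move=> e; apply: (le_trans (normr_Rintegral_ae mD _)); first exact: aeint_ip.
  rewrite mulrC -Rintegral_aeZ//; apply: le_Rintegral_ae => //.
  + by apply: aeint_norm; exact: aeint_ip.
  + exact: aeintZ.
  + by apply: aeW => t _; rewrite mulrC ip_le.
move=> y yE; have {}yE e : ip y e = \int[mu]_(t in D) ip (F t) e.
  by rewrite ip_sym -yE.
have [s [ss sle slim]] := simple_approx dd (fun e => sm_ip_cst e smF).
have weakFs n e : aemeas D (fun t => ip (F t - simple_fun (s n) t) e).
  under eq_fun do rewrite ipBl; apply: aemeasB; first exact: sm_ip_cst.
  by apply: aeint_meas => //; have [] := aeint_simple_ip e (ss n).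
have mFs n : aemeas D (fun t => `|F t - simple_fun (s n) t|) by exact: weak_norm dd _ _.
have iFs n : aeint D (fun t => `|F t - simple_fun (s n) t|).
  apply: aeint_le iF _ => //.
  by apply: filterS sle => t h Dt; rewrite normr_id h.
have to0 : (fun n => \int[mu]_(t in D) `|F t - simple_fun (s n) t|) @ \oo --> (0 : R).
  have -> : (0 : R) = \int[mu]_(t in D) 0 by rewrite Rintegral_cst// mul0r.
  apply: dominated_cvg_Rintegral iF _ _ => //.
    by move=> n; apply: filterS sle => t h Dt; rewrite normr_id h.
  apply: filterS slim => t h Dt; rewrite -[X in _ --> X](normr0 E) -(subrr (F t)).
  by apply: cvg_norm; apply: cvgB; [exact: cvg_cst|exact: h].
exists y => //; split => //; exists s; split => //.
- by under eq_fun do rewrite aeint_EFin//; apply: cvg_EFin => //; exact: nearW.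
- apply/cvgrPdist_le => /= e e0; move/cvgrPdist_le : to0 => /(_ e e0).
  apply: filterS => n; rewrite sub0r normrN ger0_norm ?Rintegral_ge0//.
  by apply: le_trans; exact: simple_int_dist.
Qed.

Lemma aeint_of_lty phi : aemeas D phi -> (forall t, 0 <= phi t) ->
  (\int[mu]_(t in D) (phi t)%:E < +oo)%E -> aeint D phi.
Proof.
move=> [p mp hp] phi0 fin; exists p => //; apply/integrableP; split.
  exact/measurable_EFinP.
have -> // : (\int[mu]_(t in D) `|(EFin \o p) t| = \int[mu]_(t in D) (phi t)%:E)%E.
apply: ae_eq_integral_nomeas.
by apply: filterS hp => t h Dt; rewrite /= -h// ger0_norm.
Qed.

Lemma is_bochner_ip F y e : is_bochner D F y -> aeint D (fun t => `|F t|) ->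
  ip y e = \int[mu]_(t in D) ip (F t) e.
Proof.
move=> [smF [s [ss to0 sy]]] iF.
have /fine_cvgP[fin to0'] := to0.
have c1 : (fun n => ip (simple_int D (s n)) e) @ \oo --> ip y e.
  by apply: cvg_ip => //; exact: cvg_cst.
have c2 : (fun n => ip (simple_int D (s n)) e) @ \oo --> \int[mu]_(t in D) ip (F t) e.
  apply/cvgrPdist_le => /= eps e0.
  (* Adding 1 keeps the divisor positive when [e = 0]. *)
  have e1 : 0 < `|e| + 1 by rewrite ltr_wpDl.
  move/cvgrPdist_le : to0' => /(_ (eps / (`|e| + 1))).
  rewrite divr_gt0// => /(_ isT) to0'.
  near=> n.
  have [i1 i2] := aeint_simple_ip e (ss n).
  (* Convergence to 0 takes place in the extended reals, so these integrals are known to be finite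
     only for large [n]. *)
  have iFs : aeint D (fun t => `|F t - simple_fun (s n) t|).
    apply: aeint_of_lty => //; last by rewrite -ge0_fin_numE ?integral_ge0//; near: n.
    under eq_fun do rewrite norm_sqrt sqr_normB -!ip_norm.
    apply: (@aemeas_comp _ _ Num.sqrt).
      by apply: continuous_measurable_fun; exact: sqrt_continuous.
    have wS v : aemeas D (fun t => ip (simple_fun (s n) t) v).
      by apply: aeint_meas; have [] := aeint_simple_ip v (ss n).
    apply: aemeasD; last exact: aemeas_ip_simple.
    apply: aemeasB; first exact: sm_ip.
    by apply: aemeasZ; apply: aemeas_ip_simple => // v; exact: sm_ip_cst.
  have iFe := aeint_ip e smF iF.
  rewrite i2 -Rintegral_aeB//; apply: (le_trans (normr_Rintegral_ae mD _)).
    exact: aeintB.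
  apply: (@le_trans _ _ (\int[mu]_(t in D) (`|e| * `|F t - simple_fun (s n) t|))).
    apply: le_Rintegral_ae => //.
    - by apply: aeint_norm; exact: aeintB.
    - exact: aeintZ.
    - by apply: aeW => t _; rewrite -ipBl mulrC ip_le.
  rewrite Rintegral_aeZ//.
  have I1 : \int[mu]_(t in D) `|F t - simple_fun (s n) t| <= eps / (`|e| + 1).
    near: n; apply: filterS to0' => n; rewrite sub0r normrN.
    exact: le_trans (ler_norm _).
  rewrite (le_trans (ler_wpM2l _ I1))// mulrCA ler_piMr ?(ltW e0)//.
  by rewrite ler_pdivrMr// mul1r lerDl.
rewrite -(cvg_lim _ c1)// (cvg_lim _ c2)//.
Unshelve. all: by end_near. Qed.

Lemma bochnerP F : separable E -> strongly_measurable D F ->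
  aeint D (fun t => `|F t|) ->
  forall e, ip (bochner D F) e = \int[mu]_(t in D) ip (F t) e.
Proof.
move=> sepE smF iF e; have [y Fy _] := bochner_exists sepE smF iF.
by apply: is_bochner_ip => //; apply: (@xgetPex _ 0 [set y | is_bochner D F y]); exists y.
Qed.
End Bochner.
End On.
End StrongMeasurability.

(** * Primitives and Fubini *)

Section Lebesgue.
Context {R : realType}.
Notation mu := (@lebesgue_measure R).
Notation Rm := (measurableTypeR R).
Implicit Types (phi : R -> R).

Lemma mitv (i : interval R) : measurable ([set` i] : set Rm).
Proof. exact: measurable_itv. Qed.

(** The product majorant makes every section integrable, not just almost every one, so the
    real-valued inner integrals agree everywhere with the extended ones. Joint integrability follows
    from the majorant by iterated integration. *)
Lemma Rintegral_fubini_dominated (K : Rm -> Rm -> R) (a b : Rm -> R) :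
  measurable_fun [set: Rm * Rm] (fun z => K z.1 z.2) ->
  mu.-integrable setT (EFin \o a) -> mu.-integrable setT (EFin \o b) ->
  (forall t s, `|K t s| <= a t * b s) ->
  \int[mu]_t \int[mu]_s K t s = \int[mu]_s \int[mu]_t K t s.
Proof.
move=> mK ia ib Kle.
have mK1 t : measurable_fun setT (K t).
  exact: (measurableT_comp mK (pair1_measurable t)).
have mK2 s : measurable_fun setT (K ^~ s).
  exact: (measurableT_comp mK (pair2_measurable s)).
have /measurable_int/measurable_EFinP ma := ia.
have /measurable_int/measurable_EFinP mb := ib.
have iK1 t : mu.-integrable setT (EFin \o K t).
  apply: (@le_integrable _ _ _ _ _ _ _ (fun s => (a t)%:E * (b s)%:E)%E) => //.
  - exact/measurable_EFinP.
  - by move=> s _; rewrite /= lee_fin (le_trans (Kle t s))// ler_norm.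
  - exact: integrableZl.
have iK2 s : mu.-integrable setT (EFin \o K ^~ s).
  apply: (@le_integrable _ _ _ _ _ _ _ (fun t => (b s)%:E * (a t)%:E)%E) => //.
  - exact/measurable_EFinP.
  - by move=> t _; rewrite /= lee_fin (le_trans (Kle t s))// mulrC ler_norm.
  - exact: integrableZl.
have iK : (mu \x mu)%E.-integrable setT (EFin \o (fun z : Rm * Rm => K z.1 z.2)).
  apply/integrable12ltyP; first exact/measurable_EFinP.
  apply: (@le_lt_trans _ _ (\int[mu]_t (`|a t|%:E * \int[mu]_s `|b s|%:E))%E).
    apply: ge0_le_integral => //.
    - by move=> t _; apply: integral_ge0.
    - apply: (@measurable_fun_fubini_tonelli_F _ _ Rm Rm _ mu (fun z => `|(K z.1 z.2)%:E|)%E) => //.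
      by apply: measurableT_comp => //; exact/measurable_EFinP.
    - apply: emeasurable_funM => //.
      by apply/measurable_EFinP; exact: measurableT_comp.
    - move=> t _; rewrite -ge0_integralZl//; last first.
        by apply/measurable_EFinP; exact: measurableT_comp.
      apply: ge0_le_integral => //.
      + by apply: (measurableT_comp (f := abse)) => //; apply/measurable_EFinP; exact: mK1.
      + by apply/measurable_EFinP; apply: measurable_funM => //; exact: measurableT_comp.
      + by move=> s _; rewrite -EFinM lee_fin -normrM (le_trans (Kle t s))// ler_norm.
  have /integrableP[_ /= Ia] := ia; have /integrableP[_ /= Ib] := ib.
  rewrite ge0_integralZr//; last 2 first.
  - by apply/measurable_EFinP; exact: measurableT_comp.
  - exact: integral_ge0.
  apply: lte_mul_pinfty => //; first by apply: integral_ge0.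
  by rewrite ge0_fin_numE//; apply: integral_ge0.
have E1 t : (\int[mu]_s (K t s)%:E = (\int[mu]_s K t s)%:E)%E.
  by rewrite /Rintegral fineK// (integrable_fin_num measurableT (iK1 t)).
have E2 s : (\int[mu]_t (K t s)%:E = (\int[mu]_t K t s)%:E)%E.
  by rewrite /Rintegral fineK// (integrable_fin_num measurableT (iK2 s)).
have /= := Fubini iK.
under eq_integral do rewrite E1.
under [in X in _ = X -> _]eq_integral do rewrite E2.
by rewrite /Rintegral => ->.
Qed.

(** Lebesgue differentiation: the extension of [phi] by zero is almost everywhere the derivative of
    its primitive, and this primitive vanishes identically on [0, T]. *)
Lemma Rintegral_itv0_eq0 (T : R) phi : aeint `]0, T[ phi ->
  (forall t, 0 <= t <= T -> \int[mu]_(s in `]0, t[) phi s = 0) ->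
  {ae mu, forall t, `]0, T[%classic t -> phi t = 0}.
Proof.
move=> [p ip hp] phi0.
pose f := p \_ `]0, T[.
have if_ : mu.-integrable setT (EFin \o f).
  by rewrite /f -restrict_EFin; apply/(iffLR (integrable_mkcond _ (mitv _))).
have fE t : 0 <= t <= T -> \int[mu]_(s in `]0, t]) f s = 0.
  move=> /andP[t0 tT].
  rewrite -Rintegral_itv_bndo_bndc; last by apply: integrableS if_.
  rewrite -[RHS](phi0 t) ?t0//.
  apply/esym/ae_eq_Rintegral; apply: filterS hp => s h; rewrite /= in_itv/= => /andP[s0 st].
  have sT : s \in `]0, T[%classic by rewrite inE/= in_itv/= s0 (lt_le_trans st).
  by rewrite h; [rewrite /f patchE sT|move: sT; rewrite inE].
have := @FTC1 R f (BRight 0).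
have i1 y : mu.-integrable [set` Interval (BRight 0) (BRight y)] (EFin \o f).
  exact: integrableS if_.
have i2 : locally_integrable [set: R] f by exact: integrable_locally ip.
move=> /(_ i1 i2) /=.
apply: filterS2 hp => t h h2 /[dup] tD; rewrite /= in_itv/= => /andP[t0 tT].
have [|_] := h2; first by rewrite lte_fin.
rewrite /f h// patchE mem_set// => <-.
rewrite derive1E; transitivity ('D_1 (cst 0 : R -> R) t); last by rewrite derive_cst.
apply: near_eq_derive; have tT0 : t \in `]0, T[ by rewrite in_itv/= t0.
apply: filterS (near_in_itvoo tT0) => y; rewrite in_itv/= => /andP[y0 yT].
by apply: (fE y); rewrite !ltW.
Qed.

(** The primitive is continuous on [0, T], hence Borel there; for [T < 0] the domain is empty. *)
Lemma aemeas_primitive (T : R) phi : aeint `]0, T[ phi ->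
  aemeas `]0, T[ (fun t => \int[mu]_(s in `]0, t[) phi s).
Proof.
move=> [p ip hp]; have [T0|T0] := ltP T 0.
  apply: (@aemeas_ae _ _ _ (fun=> 0)); last exact: aemeas_cst.
  apply: aeW => t; rewrite /= in_itv/= => /andP[t0 tT].
  by have := lt_trans t0 (lt_trans tT T0); rewrite ltxx.
pose f := p \_ `]0, T[.
have if_ : mu.-integrable setT (EFin \o f).
  by rewrite /f -restrict_EFin; apply/(iffLR (integrable_mkcond _ (mitv _))).
have := @parameterized_integral_continuous R 0 T f T0.
have i1 : mu.-integrable `[0, T] (EFin \o f) by exact: integrableS if_.
move=> /(_ i1) /(subspace_continuous_measurable_fun (mitv _)) mf.
exists (fun t => \int[mu]_(s in `[0, t]) f s).
  apply: measurable_funS mf => //.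
  by move=> t; rewrite /= !in_itv/= => /andP[/ltW-> /ltW->].
apply: aeW => t; rewrite /= in_itv/= => /andP[t0 tT].
rewrite -Rintegral_itv_obnd_cbnd; last by apply: integrableS if_.
rewrite -Rintegral_itv_bndo_bndc; last by apply: integrableS if_.
apply: ae_eq_Rintegral; apply: filterS hp => s h; rewrite /= in_itv/= => /andP[s0 st].
have sT : s \in `]0, T[%classic by rewrite inE/= in_itv/= s0 (lt_trans st).
by rewrite h; [rewrite /f patchE sT|move: sT; rewrite inE].
Qed.
End Lebesgue.

(** * Fubini's theorem for inner products over a triangle *)

Section FubiniIp.
Context {R : realType}.
Notation mu := (@lebesgue_measure R).
Notation Rm := (measurableTypeR R).
Variables (E : hilbertType R) (D : set R).
Hypothesis mD : measurable (D : set Rm).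

(** Fubini's theorem for the product measure requires a jointly Borel kernel. Restricting the simple
    functions to [C], which is [D] without a null set, and extending by 0 makes them converge at
    every point, to a function whose norm is exactly an integrable function. *)
Lemma borel_representative (F : R -> E) :
  strongly_measurable D F -> aeint D (fun t => `|F t|) ->
  exists (F' : R -> E) (a : R -> R) (s : nat -> simple E),
  [/\ forall n, is_simple (s n),
      forall t, (fun n => simple_fun (s n) t) @ \oo --> F' t,
      mu.-integrable setT (EFin \o a), forall t, `|F' t| = a t &
      {ae mu, forall t, D t -> F t = F' t} /\ forall t, ~ D t -> F' t = 0].
Proof.
move=> [s ss hs] [p ip hp].
have /= [N [mN N0 sN]] := ae_and hs hp.
pose C := D `&` ~` N.
have mC : measurable (C : set Rm) by apply: measurableI => //; exact: measurableC.
have good t : C t -> (fun n => simple_fun (s n) t) @ \oo --> F t /\ `|F t| = p t.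
  move=> [Dt Nt].
  suff [h1 h2] : (D t -> (fun n => simple_fun (s n) t) @ \oo --> F t) /\
    (D t -> `|F t| = p t) by split; auto.
  by apply: contrapT => h; exact/Nt/sN.
have rE (r : simple E) t : simple_fun [seq (q.1 `&` C, q.2) | q <- r] t =
    (\1_C t : R) *: simple_fun r t.
  elim: r => [|q r ih]; first by rewrite /= !simple_fun_nil scaler0.
  by rewrite /= !simple_fun_cons ih scalerDr scalerA indicI /= mulrC.
exists (fun t => (\1_C t : R) *: F t), (p \_ C),
  (fun n => [seq (q.1 `&` C, q.2) | q <- s n]); split.
- move=> n; move: (s n) (ss n); elim=> [|q r ih] // /is_simple_cons[mq /ih ?].
  by apply/is_simple_cons; split => //=; exact: measurableI.
- move=> t; under eq_fun do rewrite rE.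
  rewrite indicE; case: (boolP (t \in C)) => [tC|_].
    have [h _] := good t (set_mem tC); by under eq_fun do rewrite scale1r; rewrite scale1r.
  by under eq_fun do rewrite scale0r; rewrite scale0r; exact: cvg_cst.
- rewrite -restrict_EFin; apply/(iffLR (integrable_mkcond _ mC)).
  by apply: integrableS ip => // t [].
- move=> t; rewrite indicE patchE; case: (boolP (t \in C)) => [tC|_].
    by rewrite scale1r; have [_ ->] := good t (set_mem tC).
  by rewrite scale0r normr0.
- split.
    exists N; split => // t /=; apply: contra_notP => Nt Dt.
    by rewrite indicE mem_set// scale1r.
  move=> t Dt; rewrite indicE; case: (boolP (t \in C)) => [/set_mem[]//|_].
  by rewrite scale0r.
Qed.

Lemma measurable_ip_simple (s r : simple E) : is_simple s -> is_simple r ->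
  measurable_fun [set: Rm * Rm] (fun z => ip (simple_fun s z.1) (simple_fun r z.2)).
Proof.
move=> + sr; elim: s => [_|[A x] s ih /is_simple_cons[/= mA /ih ms]].
  by under eq_fun do rewrite simple_fun_nil ip0l; exact: measurable_cst.
under eq_fun do rewrite simple_fun_cons ipDl ipZl/=.
apply: measurable_funD => //; apply: measurable_funM.
  by apply: (measurableT_comp _ measurable_fst); exact: measurable_indic.
move=> {ih ms}; elim: r sr => [_|[B y] r ihr /is_simple_cons[/= mB /ihr mr]].
  by under eq_fun do rewrite simple_fun_nil ip0r; exact: measurable_cst.
under eq_fun do rewrite simple_fun_cons ipDr ipZr/=.
apply: measurable_funD => //; apply: measurable_funM => //.
by apply: (measurableT_comp _ measurable_snd); exact: measurable_indic.
Qed.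

Lemma measurable_lt_pair :
  measurable_fun [set: Rm * Rm] (fun z => (z.1 < z.2)%R%:R : R).
Proof.
rewrite (_ : (fun z => _) = \1_[set z : Rm * Rm | (z.1 < z.2)%R]); last first.
  by apply/funext => z; rewrite indicE; congr ((nat_of_bool _)%:R); apply/idP/idP; rewrite inE.
apply: measurable_indic.
have := @measurable_fun_ltr _ _ R setT (fst : Rm * Rm -> Rm) snd measurable_fst measurable_snd.
move=> /(_ measurableT [set true] I); rewrite setTI.
by congr measurable; apply/seteqP; split.
Qed.

(** Encoding the triangle [t < s] by an indicator keeps both domains of integration equal to [D].
    Both sides are rewritten with Borel representatives on the whole line, whose kernel is dominated
    by [|F' t| * |G' s|]. *)
Lemma fubini_ip (F G : R -> E) :
  strongly_measurable D F -> aeint D (fun t => `|F t|) ->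
  strongly_measurable D G -> aeint D (fun t => `|G t|) ->
  \int[mu]_(t in D) \int[mu]_(s in D) ((t < s)%R%:R * ip (F t) (G s)) =
  \int[mu]_(s in D) \int[mu]_(t in D) ((t < s)%R%:R * ip (F t) (G s)).
Proof.
move=> smF iF smG iG.
have [F' [a [sF [ssF limF ia aF [FF' F'0]]]]] := borel_representative smF iF.
have [G' [b [sG [ssG limG ib bG [GG' G'0]]]]] := borel_representative smG iG.
pose K (t s : Rm) : R := (t < s)%R%:R * ip (F' t) (G' s).
have mK : measurable_fun [set: Rm * Rm] (fun z => K z.1 z.2).
  apply: measurable_funM; first exact: measurable_lt_pair.
  apply: (@measurable_fun_cvg _ _ _ _ (fun n (z : Rm * Rm) =>
    ip (simple_fun (sF n) z.1) (simple_fun (sG n) z.2))).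
    by move=> n; exact: measurable_ip_simple.
  by move=> z _; apply: cvg_ip.
have Kle t s : `|K t s| <= a t * b s.
  rewrite -aF -bG normrM normr_nat (le_trans _ (ip_le _ _))//.
  by case: (t < s); rewrite ?mul1r// mul0r.
have K1 t s : ~ D t -> K t s = 0 by move=> /F'0 h; rewrite /K h ip0l mulr0.
have K2 t s : ~ D s -> K t s = 0 by move=> /G'0 h; rewrite /K h ip0r mulr0.
have ext (phi : R -> R) : (forall t, ~ D t -> phi t = 0) ->
    \int[mu]_(t in D) phi t = \int[mu]_t phi t.
  move=> h; rewrite Rintegral_mkcond; apply: eq_Rintegral => t _.
  by rewrite patchE; case: ifPn => // /negP; rewrite inE => /h.
have -> : \int[mu]_(t in D) \int[mu]_(s in D) ((t < s)%R%:R * ip (F t) (G s)) =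
    \int[mu]_t \int[mu]_s K t s.
  rewrite -ext; last first.
    move=> t Dt; under eq_Rintegral do rewrite K1//.
    by rewrite Rintegral_cst// mul0r.
  apply: ae_eq_Rintegral; apply: filterS FF' => t h Dt; rewrite -ext; last first.
    by move=> s; exact: K2.
  by apply: ae_eq_Rintegral; apply: filterS GG' => s h' Ds; rewrite /K h// h'.
have -> : \int[mu]_(s in D) \int[mu]_(t in D) ((t < s)%R%:R * ip (F t) (G s)) =
    \int[mu]_s \int[mu]_t K t s.
  rewrite -ext; last first.
    move=> s Ds; under eq_Rintegral do rewrite K2//.
    by rewrite Rintegral_cst// mul0r.
  apply: ae_eq_Rintegral; apply: filterS GG' => s h Ds; rewrite -ext; last first.
    by move=> t; exact: K1.
  by apply: ae_eq_Rintegral; apply: filterS FF' => t h' Dt; rewrite /K h// h'.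
exact: Rintegral_fubini_dominated mK ia ib Kle.
Qed.
End FubiniIp.

(** * The spaces L2 and H1 *)

Section SobolevL2.
Context {R : realType}.
Notation mu := (@lebesgue_measure R).
Notation Rm := (measurableTypeR R).
Variable T : R.
Hypothesis T_gt0 : 0 < T.
Notation D := (`]0, T[%classic : set R).
Implicit Types E : hilbertType R.

Lemma mitvoo_lty (a b : R) : (mu `]a, b[ < +oo)%E.
Proof.
rewrite lebesgue_measure_itv/=; case: ifP => _; last exact: ltry.
by rewrite -EFinB ltry.
Qed.

Lemma fine_mitvoo : fine (mu D) = T.
Proof. by rewrite lebesgue_measure_itv/= lte_fin T_gt0 -EFinB subr0. Qed.

Lemma ae_all_neq (t : R) : {ae mu, forall s, s <> t}.
Proof.
exists [set t]; split; [exact: measurable_set1|exact: lebesgue_measure_set1|].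
by move=> s /= /contrapT.
Qed.

Lemma sm_ae E (F G : R -> E) (A : set R) :
  {ae mu, forall t, A t -> F t = G t} ->
  strongly_measurable A F -> strongly_measurable A G.
Proof.
move=> h [s ss hs]; exists s => //; apply: filterS2 h hs => t h1 h2 At.
by rewrite -h1//; exact: h2.
Qed.

Lemma sm_sub E (F : R -> E) (A B : set R) : B `<=` A ->
  strongly_measurable A F -> strongly_measurable B F.
Proof. by move=> BA [s ss hs]; exists s => //; apply: filterS hs => t h /BA. Qed.

Lemma L2P E (F : R -> E) :
  L2 T F <-> strongly_measurable D F /\ aeint D (fun t => `|F t| ^+ 2).
Proof.
split=> -[smF i]; split=> //; last by rewrite aeint_EFin ?ltry.
apply: aeint_of_lty => //.
apply: (@aemeas_comp _ _ (fun x => x ^+ 2)); last exact: (sm_norm (mitv _) smF).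
exact: exprn_measurable.
Qed.

Lemma L2_sm E (F : R -> E) : L2 T F -> strongly_measurable D F.
Proof. by case. Qed.

Lemma L2_norm E (F : R -> E) : L2 T F -> aeint D (fun t => `|F t|).
Proof.
move=> /L2P[smF i].
apply: (@aeint_le _ _ (mitv _) _ (fun t => 1 + `|F t| ^+ 2)).
- exact: (sm_norm (mitv _) smF).
- apply: aeintD => //.
  by apply: aeint_cst => //; exact: mitvoo_lty.
- apply: aeW => t _; rewrite normr_id; have := sqr_ge0 (`|F t| - 1); nra.
Qed.

Lemma L2_ip E (F G : R -> E) : L2 T F -> L2 T G ->
  aeint D (fun t => ip (F t) (G t)).
Proof.
move=> /L2P[smF iF] /L2P[smG iG].
apply: (@aeint_le _ _ (mitv _) _ (fun t => `|F t| ^+ 2 + `|G t| ^+ 2)).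
- exact: (sm_ip (mitv _) smF smG).
- exact: aeintD.
- apply: aeW => t _; rewrite (le_trans (ip_le _ _))//.
  have := sqr_ge0 (`|F t| - `|G t|); have := normr_ge0 (F t); have := normr_ge0 (G t); nra.
Qed.

Lemma L2_ae E (F G : R -> E) : {ae mu, forall t, D t -> F t = G t} ->
  L2 T F -> L2 T G.
Proof.
move=> h /L2P[smF i]; apply/L2P; split; first exact: sm_ae smF.
by apply: aeint_ae i; apply: filterS h => t h Dt; rewrite h.
Qed.

Lemma L2_le E (F : R -> E) (psi : R -> R) : strongly_measurable D F ->
  aeint D (fun t => psi t ^+ 2) -> {ae mu, forall t, D t -> `|F t| <= psi t} ->
  L2 T F.
Proof.
move=> smF i h; apply/L2P; split => //; apply: aeint_le i _; first exact: mitv.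
  apply: (@aemeas_comp _ _ (fun x => x ^+ 2)); last exact: (sm_norm (mitv _) smF).
  exact: exprn_measurable.
apply: filterS h => t h Dt; rewrite ger0_norm ?exprn_ge0//.
have hh := h Dt; have psi0 := le_trans (normr_ge0 _) hh.
by rewrite ler_pXn2r ?nnegrE.
Qed.

Lemma L2_bounded E (F : R -> E) (M : R) : strongly_measurable D F ->
  {ae mu, forall t, D t -> `|F t| <= M} -> L2 T F.
Proof.
move=> smF; apply: L2_le => //.
by apply: aeint_cst => //; exact: mitvoo_lty.
Qed.

Lemma sm_comb E (F G : R -> E) (a : R) (A : set R) : separable E ->
  measurable (A : set Rm) ->
  strongly_measurable A F -> strongly_measurable A G ->
  strongly_measurable A (fun t => a *: F t + G t).
Proof.
move=> sepE mA smF smG; apply: sm_weak => // e; under eq_fun do rewrite ip_linearl.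
apply: aemeasD; first apply: aemeasZ; exact: sm_ip_cst.
Qed.

Lemma sqr_comb E (x y : E) (a : R) :
  `|a *: x + y| ^+ 2 <= 2 * a ^+ 2 * `|x| ^+ 2 + 2 * `|y| ^+ 2.
Proof.
rewrite -!ip_norm ipDl !ipDr !ipZl !ipZr (ip_sym y x).
have := ip_ge0 (a *: x - y); rewrite ipBl !ipBr !ipZl !ipZr (ip_sym y x); lra.
Qed.

Lemma L2_comb E (F G : R -> E) (a : R) : separable E -> L2 T F -> L2 T G ->
  L2 T (fun t => a *: F t + G t).
Proof.
move=> sepE /L2P[smF iF] /L2P[smG iG]; apply/L2P.
have smFG : strongly_measurable D (fun t => a *: F t + G t).
  exact: (sm_comb a sepE (mitv _) smF smG).
split => //.
apply: (@aeint_le _ _ (mitv _) _ (fun t => 2 * a ^+ 2 * `|F t| ^+ 2 + 2 * `|G t| ^+ 2)).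
- apply: (@aemeas_comp _ _ (fun x => x ^+ 2)); last exact: (sm_norm (mitv _) smFG).
  exact: exprn_measurable.
- by apply: aeintD; [exact: mitv| |]; apply: aeintZ => //.
- by apply: aeW => t _; rewrite ger0_norm ?exprn_ge0// sqr_comb.
Qed.

Lemma L2_0 E : L2 T (fun=> 0 : E).
Proof.
apply: (@L2_bounded _ _ 0); last by apply: aeW => t _; rewrite normr0.
by exists (fun=> [::]) => //; apply: aeW => t _; under eq_fun do rewrite simple_fun_nil; exact: cvg_cst.
Qed.

Lemma L2D E (F G : R -> E) : separable E -> L2 T F -> L2 T G ->
  L2 T (fun t => F t + G t).
Proof.
move=> sepE hF /(L2_comb 1 sepE hF).
by under eq_fun do rewrite scale1r.
Qed.

Lemma L2Z E (F : R -> E) (a : R) : separable E -> L2 T F ->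
  L2 T (fun t => a *: F t).
Proof.
move=> sepE hF; have := L2_comb a sepE hF (@L2_0 E).
by under eq_fun do rewrite addr0.
Qed.

Lemma L2N E (F : R -> E) : separable E -> L2 T F -> L2 T (fun t => - F t).
Proof.
by move=> sepE /(L2Z (-1) sepE); under eq_fun do rewrite scaleN1r.
Qed.

Lemma L2B E (F G : R -> E) : separable E -> L2 T F -> L2 T G ->
  L2 T (fun t => F t - G t).
Proof. by move=> sepE hF /(L2N sepE); exact: L2D. Qed.

Lemma ip_L2_ae E (F F' G G' : R -> E) :
  {ae mu, forall t, D t -> F t = F' t} -> {ae mu, forall t, D t -> G t = G' t} ->
  ip_L2 T F G = ip_L2 T F' G'.
Proof.
move=> h1 h2; apply: ae_eq_Rintegral; apply: filterS2 h1 h2 => t h1 h2 Dt.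
by rewrite h1// h2.
Qed.

Lemma ip_L2Dl E (F F' G : R -> E) : L2 T F -> L2 T F' -> L2 T G ->
  ip_L2 T (fun t => F t + F' t) G = ip_L2 T F G + ip_L2 T F' G.
Proof.
move=> h1 h2 h3; rewrite /ip_L2; under eq_Rintegral do rewrite ipDl.
by rewrite Rintegral_aeD//; exact: L2_ip.
Qed.

Lemma ip_L2Bl E (F F' G : R -> E) : L2 T F -> L2 T F' -> L2 T G ->
  ip_L2 T (fun t => F t - F' t) G = ip_L2 T F G - ip_L2 T F' G.
Proof.
move=> h1 h2 h3; rewrite /ip_L2; under eq_Rintegral do rewrite ipBl.
by rewrite Rintegral_aeB//; exact: L2_ip.
Qed.

Lemma ip_L2Dr E (F G G' : R -> E) : L2 T F -> L2 T G -> L2 T G' ->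
  ip_L2 T F (fun t => G t + G' t) = ip_L2 T F G + ip_L2 T F G'.
Proof.
move=> h1 h2 h3; rewrite /ip_L2; under eq_Rintegral do rewrite ipDr.
by rewrite Rintegral_aeD//; exact: L2_ip.
Qed.

(** * The space H1: derivatives, pointwise bounds, boundary value problems *)

Section H1.
Variable E : hilbertType R.
Hypothesis sepE : separable E.
Implicit Types (u v p q : R -> E) (e : E) (t : R).

Lemma itv_sub t : t <= T -> `]0, t[%classic `<=` D.
Proof.
by move=> tT s; rewrite /= !in_itv/= => /andP[-> st]; exact: lt_le_trans tT.
Qed.

Lemma ip_bochner p t e : strongly_measurable D p -> aeint D (fun s => `|p s|) ->
  t <= T ->
  ip (bochner `]0, t[ p) e = \int[mu]_(s in `]0, t[) ip (p s) e.
Proof.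
move=> smp ip tT; apply: bochnerP => //; first exact: mitvoo_lty.
  exact: sm_sub (itv_sub tT) smp.
by apply: aeint_sub ip; [exact: mitv|exact: mitv|exact: itv_sub].
Qed.

Lemma ip_bochner_L2 p t e : L2 T p -> t <= T ->
  ip (bochner `]0, t[ p) e = \int[mu]_(s in `]0, t[) ip (p s) e.
Proof. by move=> hp; apply: ip_bochner; [exact: L2_sm|exact: L2_norm]. Qed.

Lemma aeint_ip_L2 p t e : L2 T p -> t <= T -> aeint `]0, t[ (fun s => ip (p s) e).
Proof.
move=> hp tT; apply: (aeint_sub (mitv _) (mitv _) (itv_sub tT)).
by apply: aeint_ip; [exact: mitv|exact: L2_sm|exact: L2_norm].
Qed.

Lemma bochner_comb p q t (a : R) : L2 T p -> L2 T q -> t <= T ->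
  bochner `]0, t[ (fun s => a *: p s + q s) =
  a *: bochner `]0, t[ p + bochner `]0, t[ q.
Proof.
move=> hp hq tT; apply: ip_inj => e.
have ip2 := ip_bochner_L2 e (L2_comb a sepE hp hq) tT.
apply: (etrans ip2) => {ip2}; under eq_Rintegral do rewrite ip_linearl.
have ipe := aeint_ip_L2 e hp tT; have iqe := aeint_ip_L2 e hq tT.
rewrite (Rintegral_aeD (mitv _) (aeintZ (mitv _) a ipe) iqe).
rewrite (Rintegral_aeZ (mitv _) a ipe) ip_linearl.
by congr (a * _ + _); apply: esym; [exact: (ip_bochner_L2 e hp tT)|exact: (ip_bochner_L2 e hq tT)].
Qed.

Lemma bochner_ae p q t : {ae mu, forall s, D s -> p s = q s} -> L2 T p ->
  t <= T -> bochner `]0, t[ p = bochner `]0, t[ q.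
Proof.
move=> pq hp tT; apply: ip_inj => e.
apply: (etrans (ip_bochner_L2 e hp tT)).
apply: (etrans _ (esym (ip_bochner_L2 e (L2_ae pq hp) tT))).
by apply: ae_eq_Rintegral; apply: filterS pq => s h /(itv_sub tT) /h ->.
Qed.

Lemma bochner0 p : L2 T p -> bochner `]0, 0[ p = 0.
Proof.
move=> hp; apply: ip_inj => e; rewrite ip_bochner_L2 ?ltW// ip0l.
by rewrite set_itvoo0 Rintegral_set0.
Qed.

Lemma is_ddt_comb u v p q (a : R) : is_ddt T u p -> is_ddt T v q ->
  is_ddt T (fun t => a *: u t + v t) (fun t => a *: p t + q t).
Proof.
move=> [hp hu] [hq hv]; split; first exact: L2_comb.
move=> t /[dup] tT /andP[_ tT']; rewrite hu// hv// bochner_comb//.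
by rewrite scalerDr !addrA; congr (_ + _); rewrite -!addrA; congr (_ + _); rewrite addrC.
Qed.

Lemma is_ddt_ae u p q : {ae mu, forall s, D s -> p s = q s} -> is_ddt T u p ->
  is_ddt T u q.
Proof.
move=> pq [hp hu]; split; first exact: L2_ae hp.
move=> t /[dup] tT /andP[_ tT']; apply: (etrans (hu _ tT)).
exact: (congr1 (+%R (u 0)) (bochner_ae pq hp tT')).
Qed.

(** For each vector [d k] of a dense sequence the scalar function [ip (p t - q t) (d k)] has zero
    primitive, hence vanishes almost everywhere. Countability gives one null set for all [k], and a
    vector orthogonal to a dense set is 0. *)
Lemma is_ddt_unique u p q : is_ddt T u p -> is_ddt T u q ->
  {ae mu, forall t, D t -> p t = q t}.
Proof.
move=> [hp hup] [hq huq]; have [d dd] := separable_seq sepE.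
have : {ae mu, forall t, forall k, D t -> ip (p t) (d k) - ip (q t) (d k) = 0}.
  apply: ae_foralln => k.
  have ipk : aeint D (fun t => ip (p t) (d k)) by exact: aeint_ip_L2.
  have iqk : aeint D (fun t => ip (q t) (d k)) by exact: aeint_ip_L2.
  apply: Rintegral_itv0_eq0; first by apply: aeintB => //.
  move=> t /[dup] tT /andP[_ tT'].
  rewrite Rintegral_aeB; [|exact: mitv|exact: aeint_ip_L2|exact: aeint_ip_L2].
  rewrite -(ip_bochner_L2 _ hp tT') -(ip_bochner_L2 _ hq tT') -ipBl.
  have := hup t tT; rewrite (huq _ tT) => /addrI ->.
  by rewrite subrr ip0l.
apply: filterS => t h Dt; apply/eqP; rewrite -subr_eq0; apply/eqP.
set x := p t - q t.
have xd k : ip x (d k) = 0 by rewrite /x ipBl h.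
apply/eqP/contraT => x0.
have x_gt0 : 0 < `|x| by rewrite normr_gt0.
have [k xk] := dd x _ x_gt0.
(* Orthogonality makes the left side [|x|^2 + |d k|^2], a contradiction. *)
have : `|x - d k| ^+ 2 < `|x| ^+ 2 by rewrite ltr_pXn2r// nnegrE.
rewrite sqr_normB xd mulr0 subr0 gtrDl ltNge exprn_ge0//.
Qed.

Lemma ddtP u : H1 T u -> is_ddt T u (ddt T u).
Proof. by move=> [p hp]; apply: (@xgetPex _ _ [set p | is_ddt T u p]); exists p. Qed.

Lemma ddt_ae u p : is_ddt T u p -> {ae mu, forall t, D t -> ddt T u t = p t}.
Proof. move=> hp; exact: (is_ddt_unique (ddtP (ex_intro _ p hp)) hp). Qed.

Lemma ddt_L2 u : H1 T u -> L2 T (ddt T u).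
Proof. by move=> /ddtP[]. Qed.

Lemma H1_comb u v (a : R) : H1 T u -> H1 T v -> H1 T (fun t => a *: u t + v t).
Proof.
by move=> [p hp] [q hq]; exists (fun t => a *: p t + q t); exact: is_ddt_comb.
Qed.

Lemma ddt_comb u v (a : R) : H1 T u -> H1 T v ->
  {ae mu, forall t, D t ->
    ddt T (fun t => a *: u t + v t) t = a *: ddt T u t + ddt T v t}.
Proof. by move=> /ddtP hu /ddtP hv; apply: ddt_ae; exact: is_ddt_comb. Qed.

Lemma H1D u v : H1 T u -> H1 T v -> H1 T (fun t => u t + v t).
Proof. by move=> hu /(H1_comb 1 hu); under eq_fun do rewrite scale1r. Qed.

Lemma H1_sm u : H1 T u -> strongly_measurable D u.
Proof.
move=> [p [hp hu]]; apply: sm_weak => // e.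
apply: (@aemeas_ae _ _ _ (fun t => ip (u 0) e + \int[mu]_(s in `]0, t[) ip (p s) e)).
  apply: aeW => t; rewrite /= in_itv/= => /andP[t0 tT].
  by rewrite hu ?ltW// ipDl ip_bochner_L2// ltW.
apply: aemeasD; first exact: aemeas_cst.
by apply: aemeas_primitive; exact: aeint_ip_L2.
Qed.

(** The embedding of H1 into bounded functions. Testing the Bochner integral of [p] against itself
    bounds it by the integral of [|p|] over the whole interval, and Cauchy-Schwarz against 1
    supplies the factor [sqrt T]. *)
Lemma H1_bound u p t : is_ddt T u p -> 0 <= t <= T ->
  `|u t| <= `|u 0| + Num.sqrt T * Num.sqrt (ip_L2 T p p).
Proof.
move=> [hp hu] /[dup] t0T /andP[t0 tT]; rewrite hu//.
rewrite (le_trans (ler_normD _ _))// lerD2l.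
set y := bochner _ _; have [->|y0] := eqVneq y 0.
  by rewrite normr0 mulr_ge0// sqrtr_ge0.
have y_gt0 : 0 < `|y| by rewrite normr_gt0.
have ipn := L2_norm hp.
have /L2P[_ ip2] := hp.
have le1 : `|y| <= \int[mu]_(s in D) `|p s|.
  rewrite -(ler_pM2l y_gt0) -expr2 -ip_norm {1}/y ip_bochner_L2//.
  have iD : aeint D (fun s => `|ip (p s) y|).
    by apply: aeint_norm; exact: aeint_ip_L2.
  apply: (le_trans (ler_norm _)).
  apply: (le_trans (normr_Rintegral_ae (mitv _) (aeint_ip_L2 _ hp tT))).
  apply: (@le_trans _ _ (\int[mu]_(s in D) `|ip (p s) y|)).
    (* The domain of a nonnegative integrand is enlarged; both integrals are compared on the line
       after extension by zero. *)
    rewrite Rintegral_mkcond [leRHS]Rintegral_mkcond.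
    have iE A : measurable (A : set Rm) -> A `<=` D ->
        aeint setT ((fun s => `|ip (p s) y|) \_ A).
      move=> mA AD; have [q iq hq] := aeint_sub (mitv _) mA AD iD.
      exists (q \_ A).
        by rewrite -restrict_EFin; apply/(iffLR (integrable_mkcond _ mA)).
      apply: filterS hq => s hq _; rewrite !patchE; case: ifPn => // /set_mem As.
      by rewrite hq.
    apply: le_Rintegral_ae => //.
    - by apply: iE; [exact: mitv|exact: itv_sub].
    - by apply: iE; [exact: mitv|].
    - apply: aeW => s _; rewrite !patchE; case: ifPn => [/set_mem/(itv_sub tT)/mem_set -> //|_].
      by case: ifP => _; [exact: normr_ge0|exact: lexx].
  rewrite -Rintegral_aeZ//.
  apply: le_Rintegral_ae => //.
    exact: aeintZ.
  by apply: aeW => s _; rewrite mulrC ip_le.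
apply: (le_trans le1).
have le2 := Rintegral_sqr_ge (mitv _) fine_mitvoo (mitvoo_lty _ _) ipn ip2.
have E2 : ip_L2 T p p = \int[mu]_(t in D) `|p t| ^+ 2.
  by rewrite /ip_L2; under eq_Rintegral do rewrite ip_norm.
rewrite E2 -sqrtrM; last exact: ltW.
rewrite -[leLHS]ger0_norm ?Rintegral_ge0// -sqrtr_sqr ler_wsqrtr//.
Qed.

Lemma H1_bounded u : H1 T u -> exists2 M, 0 <= M & forall t, 0 <= t <= T -> `|u t| <= M.
Proof.
move=> [p hp]; exists (`|u 0| + Num.sqrt T * Num.sqrt (ip_L2 T p p)).
  by rewrite addr_ge0// mulr_ge0// sqrtr_ge0.
by move=> t; exact: H1_bound.
Qed.

Lemma in_D t : D t -> 0 <= t <= T.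
Proof. by rewrite /= in_itv/= => /andP[/ltW-> /ltW->]. Qed.

Lemma H1_L2 u : H1 T u -> L2 T u.
Proof.
move=> /[dup] /H1_sm smu /H1_bounded[M _ hM]; apply: (@L2_bounded _ _ M) => //.
by apply: aeW => t /in_D; exact: hM.
Qed.

Lemma ip_H1Dr v u u' : H1 T v -> H1 T u -> H1 T u' ->
  ip_H1 T v (fun t => u t + u' t) = ip_H1 T v u + ip_H1 T v u'.
Proof.
move=> hv hu hu'; rewrite /ip_H1 ipDr.
have h : {ae mu, forall t, D t -> ddt T (fun t => u t + u' t) t = ddt T u t + ddt T u' t}.
  have <- : (fun t => 1 *: u t + u' t) = (fun t => u t + u' t).
    by apply/funext => t; rewrite scale1r.
  by apply: filterS (ddt_comb 1 hu hu') => t h /h ->; rewrite scale1r.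
rewrite (ip_L2_ae (F' := ddt T v) _ h); last exact: aeW.
rewrite ip_L2Dr; [ring|exact: ddt_L2|exact: ddt_L2|exact: ddt_L2].
Qed.

Lemma H1_primitive p (c : E) : L2 T p ->
  is_ddt T (fun t => c + bochner `]0, t[ p) p.
Proof. by move=> hp; split => // t _; rewrite (bochner0 hp) addr0. Qed.

(** This accounts for the term [int_0^t I~^* I w] in the adjoint of [d/dt]: such a primitive
    vanishes at 0, so the initial-value part of the H1 product disappears. *)
Lemma ip_H1_primitive v p : H1 T v -> L2 T p ->
  ip_H1 T v (fun t => bochner `]0, t[ p) = ip_L2 T (ddt T v) p.
Proof.
move=> hv hp; rewrite /ip_H1 bochner0// ip0r addr0.
apply: ip_L2_ae; first exact: aeW.
apply: ddt_ae; have := H1_primitive 0 hp.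
by under eq_fun do rewrite add0r.
Qed.

Lemma bvp_exists (r : R -> E) (b : E) : L2 T r -> exists u, solves_bvp T r b u.
Proof.
(* [a] is the value of [u'(0)] forced by [u'(T) = 0]; the condition at 0 then forces
   [u(0) = a - b]. *)
move=> hr; pose a := - bochner `]0, T[ r.
pose p t := a + bochner `]0, t[ r.
have hp : is_ddt T p r by exact: H1_primitive.
have p2 : L2 T p by apply: H1_L2; exists r.
exists (fun t => (a - b) + bochner `]0, t[ p), p, r; split.
- exact: H1_primitive.
- exact: hp.
- exact: aeW.
- by rewrite /p addNr.
- by rewrite /p (bochner0 hr) (bochner0 p2) !addr0 opprB addrCA subrr addr0.
Qed.

Lemma Rintegral_lt_itv (phi : R -> R) t : t <= T ->
  \int[mu]_(s in `]0, t[) phi s = \int[mu]_(s in D) ((s < t)%R%:R * phi s).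
Proof.
move=> tT; rewrite Rintegral_mkcond [RHS]Rintegral_mkcond; apply: eq_Rintegral => s _.
rewrite !patchE; case: (boolP (s \in D)) => [/set_mem|]; rewrite /= ?in_itv/=.
  move=> /andP[s0 _]; case: (boolP (s < t)) => st.
    by rewrite mem_set ?mul1r//= in_itv/= s0.
  by rewrite memNset ?mul0r//= in_itv/= s0 (negbTE st).
move=> sD; case: ifPn => // /set_mem /(itv_sub tT) /mem_set.
by rewrite (negbTE sD).
Qed.

Lemma Rintegral_itvB_gt (phi : R -> R) t : t <= T -> aeint D phi ->
  \int[mu]_(s in `]0, t[) phi s - \int[mu]_(s in D) phi s =
  - \int[mu]_(s in D) ((t < s)%R%:R * phi s).
Proof.
move=> tT iphi; rewrite Rintegral_lt_itv//.
have ilt (b : R -> bool) : measurable_fun setT (b : Rm -> bool) -> aeint D (fun s => (b s)%:R * phi s).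
  move=> mb; apply: (@aeint_le _ _ (mitv _) _ (fun s => `|phi s|)).
  - apply: aemeasM; last exact: aeint_meas.
    apply: aemeasW; apply: measurable_funTS.
    rewrite (_ : (fun s => _) = \1_[set s | b s]); last first.
      by apply/funext => s; rewrite indicE; congr ((nat_of_bool _)%:R); apply/idP/idP; rewrite inE.
    apply: measurable_indic; rewrite (_ : [set s | b s] = b @^-1` [set true])//.
    by rewrite -[X in measurable X]setTI; exact: mb.
  - by apply: aeint_norm.
  - by apply: aeW => s _; rewrite normrM normr_nat; case: (b s); rewrite ?mul1r// mul0r.
have i1 : aeint D (fun s => (s < t)%R%:R * phi s).
  by apply: ilt; exact: measurable_fun_ltr.
have i2 : aeint D (fun s => (t < s)%R%:R * phi s).
  by apply: ilt; exact: measurable_fun_ltr.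
apply/eqP; rewrite subr_eq addrC -subr_eq opprK -Rintegral_aeD//.
apply/eqP/ae_eq_Rintegral; apply: filterS (ae_all_neq t) => s st _.
by case: (ltgtP s t) st => //= _ _; rewrite ?mul1r ?mul0r ?addr0 ?add0r.
Qed.

(* Integrating by parts twice leaves no boundary term at [T], where [u'] vanishes. *)
Lemma ip_H1_bvp (r : R -> E) (b : E) u v : solves_bvp T r b u -> L2 T r ->
  H1 T v -> ip_H1 T v u = - ip_L2 T v r - ip (v 0) b.
Proof.
move=> [p [q [hu hp qr pT pub]]] hr hv.
have hr' : is_ddt T p r by exact: is_ddt_ae qr hp.
have [_ pE] := hr'; have [hv' vE] := ddtP hv.
set v' := ddt T v in hv' vE.
have p0 : p 0 = - bochner `]0, T[ r.
  have := pE T; rewrite lexx ltW// pT => /(_ isT) /esym/eqP.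
  by rewrite addr_eq0 => /eqP.
have u0 : u 0 = p 0 - b by rewrite -pub opprB addrCA subrr addr0.
have irip e : aeint D (fun t => ip e (r t)).
  rewrite (_ : (fun t => _) = fun t => ip (r t) e); first exact: aeint_ip_L2.
  by apply/funext => t; rewrite ip_sym.
have ivip e : aeint D (fun t => ip (v' t) e) by exact: aeint_ip_L2.
rewrite /ip_H1 -/v' (ip_L2_ae (F' := v') (G' := p)); [|exact: aeW|exact: ddt_ae].
have p_L2 : L2 T p by case: hu.
(* Because [p T = 0], [p t] is minus the integral of [r] over ]t, T[. *)
have E1 : ip_L2 T v' p =
    - \int[mu]_(t in D) \int[mu]_(s in D) ((t < s)%R%:R * ip (v' t) (r s)).
  apply/eqP; rewrite -eqr_oppLR -Rintegral_aeN; [|exact: mitv|exact: L2_ip].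
  apply/eqP/eq_Rintegral => t /set_mem Dt; have /andP[t0 tT] := in_D Dt.
  rewrite -[RHS]opprK -Rintegral_itvB_gt// pE ?t0// p0 ip_sym ipDl ipNl !ip_bochner_L2//.
  congr (- _); rewrite addrC.
  by congr (_ - _); apply: eq_Rintegral => s _; rewrite ip_sym.
(* After the exchange the inner integral of [v'] over ]0, s[ is [v s - v 0], and the constant [v 0]
   pairs with the integral of [r], which is [- p 0]. *)
have E2 : \int[mu]_(t in D) \int[mu]_(s in D) ((t < s)%R%:R * ip (v' t) (r s)) =
    ip_L2 T v r + ip (v 0) (p 0).
  rewrite fubini_ip; [|exact: mitv|exact: L2_sm|exact: L2_norm|exact: L2_sm|exact: L2_norm].
  rewrite p0 ipNr (ip_sym (v 0)) ip_bochner_L2//.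
  rewrite -Rintegral_aeB; [|exact: mitv| |exact: aeint_ip_L2]; last first.
    by apply: L2_ip => //; exact: H1_L2.
  apply: eq_Rintegral => s /set_mem Ds; have /andP[s0 sT] := in_D Ds.
  rewrite -Rintegral_lt_itv// -ip_bochner_L2// vE ?s0// ipDl (ip_sym (v 0)).
  by rewrite addrAC subrr add0r.
(* The product of [v 0] and [p 0] cancels because [u 0 = p 0 - b]. *)
by rewrite E1 E2 u0 ipBr opprD addrA subrK.
Qed.
End H1.
End SobolevL2.

(** * Gelfand triples *)

Section BoundedLinear.
Context {R : realType}.

(** By continuity at 0 some ball of radius [e] is mapped into the unit ball; scaling [x] to norm
    [e / 2] gives the constant [2 / e]. *)
Lemma lac_bound (E F : normedModType R) (A : E -> F) : linear_and_continuous A ->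
  exists2 C : R, 0 <= C & forall x, `|A x| <= C * `|x|.
Proof.
move=> [linA cA].
have AZ a x : A (a *: x) = a *: A x.
  have A0 : A 0 = 0.
    by have := linA 1 0 0; rewrite !scale1r addr0 => /eqP; rewrite -subr_eq0 opprD addNKr oppr_eq0 => /eqP.
  by have := linA a x 0; rewrite !addr0 A0 addr0.
have A0 : A 0 = 0 by rewrite -(scale0r 0) AZ scale0r.
have /cvgrPdist_lt/(_ 1 ltr01) := cA 0.
rewrite A0 => /nbhs_normP[/= e e0 he].
exists (2 / e); first by rewrite divr_ge0// ltW.
move=> x; have [->|x0] := eqVneq x 0; first by rewrite A0 !normr0 mulr0.
have x_gt0 : 0 < `|x| by rewrite normr_gt0.
have := he (e / (2 * `|x|) *: x); rewrite /ball_/= sub0r normrN normrZ.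
rewrite ger0_norm; last by rewrite divr_ge0 ?ltW// mulr_gt0.
have -> : e / (2 * `|x|) * `|x| = e / 2.
  by move: (`|x|) x_gt0 => X X0; field; apply: lt0r_neq0.
have e2 : e / 2 < e by lra.
move=> /(_ e2); rewrite sub0r normrN AZ normrZ ger0_norm; last first.
  by rewrite divr_ge0 ?ltW// mulr_gt0.
move=> h; have : e / (2 * `|x|) * `|A x| <= 1 by exact: ltW.
rewrite -ler_pdivlMl; last by rewrite divr_gt0// mulr_gt0.
move=> /le_trans; apply; rewrite mulr1 invf_div.
rewrite le_eqVlt; apply/orP; left; apply/eqP.
by move: (`|x|) => X; field; apply: lt0r_neq0.
Qed.

Lemma bound_lac (E F : normedModType R) (A : E -> F) (C : R) : linear A ->
  (forall x, `|A x| <= C * `|x|) -> linear_and_continuous A.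
Proof.
move=> linA AC; split=> // x; apply/cvgrPdist_le => /= e e0.
have C1 : 0 < `|C| + 1 by rewrite ltr_wpDl.
have : \forall y \near x, `|x - y| <= e / (`|C| + 1).
  have /cvgrPdist_le : (id y @[y --> x] --> x) by exact: cvg_id.
  by apply; rewrite divr_gt0.
apply: filterS => y xy.
have -> : A x - A y = A (x - y).
  by have := linA (-1) y x; rewrite !scaleN1r ![- _ + _]addrC => ->.
rewrite (le_trans (AC _))// (@le_trans _ _ ((`|C| + 1) * `|x - y|))//.
  by rewrite ler_wpM2r// (le_trans (ler_norm C))// lerDl.
by rewrite mulrC -ler_pdivlMr.
Qed.

(** [banach_adjoint] is a choice that defaults to 0, so each use has to exhibit one adjoint value
    first, by Riesz or by the representation of functionals in [Vd]. *)
Lemma banach_adjointP (E F : Type) (E' : normedModType R) (F' : Type)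
    (bE : E' -> E -> R) (bF : F' -> F -> R) (A : E -> F) (phi : F') :
  (exists psi, forall x, bE psi x = bF phi (A x)) ->
  forall x, bE (banach_adjoint bE bF A phi) x = bF phi (A x).
Proof. by move=> [psi h]; apply: (@xgetPex _ 0 [set psi | forall x, bE psi x = bF phi (A x)]); exists psi. Qed.

Lemma hilbert_adjointP (E F : hilbertType R) (A : E -> F) (y : F) :
  linear_and_continuous A ->
  forall x, ip (banach_adjoint (fun p q : E => ip p q) (fun p q : F => ip p q) A y) x =
    ip y (A x).
Proof.
move=> /[dup] -[linA _] /lac_bound[C C0 AC].
apply: (@banach_adjointP _ _ _ _ (fun p q : E => ip p q) (fun p q : F => ip p q)).
have [] := @riesz _ _ (fun x => ip y (A x)) (`|y| * C).
- by move=> a x x'; rewrite linA ipDr ipZr.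
- by move=> x; rewrite (le_trans (ip_le _ _))// -mulrA ler_wpM2l.
by move=> psi h; exists psi => x; rewrite h ip_sym.
Qed.
End BoundedLinear.

Section Gelfand.
Context {R : realType} {V H Vd : hilbertType R}.
Variables (iota : V -> H) (dual : Vd -> V -> R).
Hypothesis VHVd : gelfand_triple iota dual.

Let dual_space : is_dual_space dual. Proof. by case: VHVd. Qed.

Lemma dual_linl (a : R) phi psi v :
  dual (a *: phi + psi) v = a * dual phi v + dual psi v.
Proof. by case: dual_space => h _ _ _ _; exact: h. Qed.

Lemma dual_linr (a : R) phi v w :
  dual phi (a *: v + w) = a * dual phi v + dual phi w.
Proof. by case: dual_space => _ h _ _ _; exact: h. Qed.

Lemma dual_bound : exists2 C : R, 0 <= C & forall phi v, `|dual phi v| <= C * `|phi| * `|v|.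
Proof.
case: dual_space => _ _ _ [C hC] _; exists `|C| => // phi v.
by rewrite (le_trans (hC _ _))// !ler_wpM2r// ler_norm.
Qed.

Lemma dual_repr (l : V -> R) (C : R) :
  (forall (a : R) v w, l (a *: v + w) = a * l v + l w) ->
  (forall v, `|l v| <= C * `|v|) -> exists phi, forall v, dual phi v = l v.
Proof.
move=> ll lC; case: dual_space => _ _ h _ _.
have [|phi E] := h l; first by apply: (@bound_lac _ V R^o l C).
by exists phi => v; rewrite E.
Qed.

Lemma isoItP phi v : ip (isoIt dual phi) v = dual phi v.
Proof.
have [C C0 hC] := dual_bound.
have [a x y|v'|y hy] := @riesz _ _ (dual phi) (C * `|phi|).
- exact: dual_linr.
- exact: hC.
apply: (@xgetPex _ 0 [set p | forall v, ip p v = dual phi v]).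
by exists y => w; rewrite hy ip_sym.
Qed.

Lemma isoIt_lin (a : R) phi psi :
  isoIt dual (a *: phi + psi) = a *: isoIt dual phi + isoIt dual psi.
Proof.
by apply: ip_inj => e; rewrite ip_linearl !isoItP dual_linl.
Qed.

(** The dual norm of [phi] is at most the norm of its Riesz vector, and [c] is the constant
    comparing [|phi|] with the dual norm. This lower bound gives injectivity of I~ and continuity of
    its inverse. *)
Lemma isoIt_norm_ge : exists2 c : R, 0 < c & forall phi, c * `|phi| <= `|isoIt dual phi|.
Proof.
case: dual_space => _ _ _ _ [c c0 hc]; exists c => // phi.
by apply: hc => // v; rewrite -isoItP ip_le.
Qed.

Lemma isoIt_inj : injective (isoIt dual).
Proof.
move=> phi psi E; apply/eqP; rewrite -subr_eq0 -normr_eq0 eq_le normr_ge0 andbT.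
have [c c0 hc] := isoIt_norm_ge.
have := hc (- 1 *: psi + phi); rewrite isoIt_lin E !scaleN1r addNr normr0.
by rewrite pmulr_rle0// addrC.
Qed.

Lemma isoIt_invK p : isoIt dual (isoIt_inv dual p) = p.
Proof.
have [||phi hphi] := @dual_repr (fun v => ip p v) `|p|.
- by move=> a v w; rewrite ipDr ipZr.
- by move=> v; exact: ip_le.
apply: (@xgetPex _ 0 [set phi | isoIt dual phi = p]); exists phi.
by apply: ip_inj => e; rewrite isoItP hphi.
Qed.

Lemma dual_isoIt_inv p v : dual (isoIt_inv dual p) v = ip p v.
Proof. by rewrite -isoItP isoIt_invK. Qed.

Lemma isoIt_inv_lin (a : R) p q :
  isoIt_inv dual (a *: p + q) = a *: isoIt_inv dual p + isoIt_inv dual q.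
Proof. by apply: isoIt_inj; rewrite isoIt_lin !isoIt_invK. Qed.

(** The functional [ip _ phi] on [Vd] is pulled back to V along the inverse of I~, with norm at most
    [c^-1 * |phi|]. Riesz in V represents it by a vector, which is I applied to [phi]. *)
Lemma isoIP psi phi : dual psi (isoI dual phi) = ip psi phi.
Proof.
have [c c0 hc] := isoIt_norm_ge.
have [||y hy] := @riesz _ _ (fun v => ip (isoIt_inv dual v) phi) (c^-1 * `|phi|).
- by move=> a v w; rewrite isoIt_inv_lin ip_linearl.
- move=> v; rewrite (le_trans (ip_le _ _))// [leRHS]mulrAC ler_wpM2r//.
  by rewrite -ler_pdivrMl ?invr_gt0// invrK (le_trans (hc _))// isoIt_invK.
apply: (@xgetPex _ 0 [set p | forall psi, dual psi p = ip psi phi]).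
exists y => psi'; rewrite -isoItP -hy; congr ip.
by apply: isoIt_inj; rewrite isoIt_invK.
Qed.

Lemma embP v w : dual (emb iota dual v) w = ip (iota v) (iota w).
Proof.
case: VHVd => /[dup] -[linI _] /lac_bound[C C0 hC] _ _ _.
apply: (@banach_adjointP _ V H Vd H dual (fun h k : H => ip h k)).
apply: (@dual_repr _ (`|iota v| * C)).
  by move=> a x y; rewrite linI ipDr ipZr.
by move=> x; rewrite (le_trans (ip_le _ _))// -mulrA ler_wpM2l.
Qed.

Lemma emb_lin (a : R) v w : emb iota dual (a *: v + w) = a *: emb iota dual v + emb iota dual w.
Proof.
apply: isoIt_inj; apply: ip_inj => e; rewrite !isoItP dual_linl !embP.
by case: VHVd => -[linI _] _ _ _; rewrite linI ip_linearl.
Qed.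

(** The embedding is [iota] followed by its adjoint, so the bound [K] of [iota] enters twice; [c^-1]
    comes from measuring in [Vd] instead of in the dual norm. *)
Lemma emb_bound : exists2 C : R, 0 <= C & forall v, `|emb iota dual v| <= C * `|v|.
Proof.
case: VHVd => /lac_bound[K K0 hK] _ _ _.
have [c c0 hc] := isoIt_norm_ge; exists (c^-1 * (K * K)).
  by rewrite mulr_ge0 ?mulr_ge0// invr_ge0 ltW.
move=> v; rewrite -mulrA -ler_pdivrMl ?invr_gt0// invrK.
apply: (le_trans (hc _)); set p := isoIt dual _.
have [->|p0] := eqVneq p 0; first by rewrite normr0 !mulr_ge0.
have p_gt0 : 0 < `|p| by rewrite normr_gt0.
rewrite -(ler_pM2l p_gt0) -expr2 -ip_norm {1}/p isoItP embP.
rewrite (le_trans (le_trans (ler_norm _) (ip_le _ _)))//.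
rewrite (le_trans (ler_pM _ _ (hK _) (hK _)))//.
by rewrite le_eqVlt; apply/orP; left; apply/eqP; ring.
Qed.

(** Since [(I~^* I w, v)_V = (I w, I~ v)_V = <v, I w> = (v, w)_V^*], the map [I~^* I] is the Hilbert
    adjoint of the embedding of V into V^*. *)
Lemma isoIt_adj_isoI w v :
  ip (isoIt_adj iota dual (isoI dual w)) v = ip (emb iota dual v) w.
Proof.
rewrite /isoIt_adj hilbert_adjointP; first by rewrite ip_sym isoItP isoIP.
have [C C0 hC] := emb_bound; have [K K0 hK] := dual_bound.
apply: (@bound_lac _ _ _ _ (K * C)).
  by move=> a x y; rewrite emb_lin isoIt_lin.
move=> x; set p := isoIt dual _.
have [->|p0] := eqVneq p 0; first by rewrite normr0 !mulr_ge0.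
have p_gt0 : 0 < `|p| by rewrite normr_gt0.
rewrite -(ler_pM2l p_gt0) -expr2 -ip_norm {1}/p isoItP mulrC.
rewrite (le_trans (le_trans (ler_norm _) (hK _ _)))//.
by rewrite ler_wpM2r// -mulrA ler_wpM2l.
Qed.

Section DualAdjoints.
Variables (X Z : hilbertType R) (t : R).

Lemma isoIt_adj_dual (A : V -> Vd) w : linear_and_continuous A ->
  forall v, ip (isoIt dual (banach_adjoint dual (bidual dual) A (isoI dual w))) v =
    ip w (A v).
Proof.
move=> /[dup] -[linA _] /lac_bound[C C0 hC] v; rewrite isoItP.
rewrite (@banach_adjointP _ _ _ _ _ dual (bidual dual)) /bidual ?isoIP 1?ip_sym//.
have [||phi h] := @dual_repr (fun v => ip w (A v)) (`|w| * C).
- by move=> a x y; rewrite linA ipDr ipZr.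
- by move=> x; rewrite (le_trans (ip_le _ _))// -mulrA ler_wpM2l.
by exists phi => x; rewrite h isoIP ip_sym.
Qed.

Lemma isoIt_adj_hilbert (A : V -> Z) z : linear_and_continuous A ->
  forall v, ip (isoIt dual (banach_adjoint dual (fun z y : Z => ip z y) A z)) v =
    ip z (A v).
Proof.
move=> /[dup] -[linA _] /lac_bound[C C0 hC] v; rewrite isoItP.
apply: (@banach_adjointP _ _ _ _ _ dual (fun z y : Z => ip z y)).
apply: (@dual_repr _ (`|z| * C)).
- by move=> a x y; rewrite linA ipDr ipZr.
- by move=> x; rewrite (le_trans (ip_le _ _))// -mulrA ler_wpM2l.
Qed.

Lemma adj_dual (B : X -> Vd) w : linear_and_continuous B ->
  forall xi, ip (banach_adjoint (fun xi eta : X => ip xi eta) (bidual dual) B (isoI dual w)) xi =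
    ip w (B xi).
Proof.
move=> /[dup] -[linB _] /lac_bound[C C0 hC] xi.
rewrite (@banach_adjointP _ _ _ _ _ (fun xi eta : X => ip xi eta) (bidual dual)).
  by rewrite /bidual isoIP ip_sym.
have [||y h] := @riesz _ _ (fun xi => ip w (B xi)) (`|w| * C).
- by move=> a x y; rewrite linB ipDr ipZr.
- by move=> x; rewrite (le_trans (ip_le _ _))// -mulrA ler_wpM2l.
by exists y => x; rewrite /bidual isoIP ip_sym -h ip_sym.
Qed.

(** The inverse of I~ sends [h] to the functional [(h, .)_V], to which the Banach adjoint of the
    derivative of [u0] applies. *)
Lemma u0_starP (u0 : X -> V) th h : linear_and_continuous (du0 u0 th) ->
  forall xi, ip (u0_star dual u0 th h) xi = ip h (du0 u0 th xi).
Proof.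
move=> /[dup] -[linB _] /lac_bound[C C0 hC] xi; rewrite /u0_star /u0_adj.
rewrite (@banach_adjointP _ _ _ _ _ (fun xi eta : X => ip xi eta) dual).
  exact: dual_isoIt_inv.
have [||y hy] := @riesz _ _ (fun xi => ip h (du0 u0 th xi)) (`|h| * C).
- by move=> a x y; rewrite linB ipDr ipZr.
- by move=> x; rewrite (le_trans (ip_le _ _))// -mulrA ler_wpM2l.
by exists y => x; rewrite dual_isoIt_inv hy ip_sym.
Qed.
End DualAdjoints.

(** The inverse of I~ is continuous and onto, so it maps a dense sequence of V to a dense sequence
    of [Vd]. *)
Lemma separable_dual : separable V -> separable Vd.
Proof.
move=> /separable_seq[d dd].
exists (range (fun k => isoIt_inv dual (d k))); first exact: (card_image_le _ _).
move=> O [phi Ophi] oO.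
have [c c0 hc] := isoIt_norm_ge.
have /nbhs_normP[e /= e0 he] : nbhs phi O by exact: open_nbhs_nbhs.
have [k hk] := dd (isoIt dual phi) _ (mulr_gt0 c0 e0).
exists (isoIt_inv dual (d k)); split; last by exists k.
apply: he; rewrite /ball_/= -(ltr_pM2l c0); apply: le_lt_trans hk.
have := hc (-1 *: isoIt_inv dual (d k) + phi).
by rewrite isoIt_lin isoIt_invK !scaleN1r ![- _ + _]addrC.
Qed.
End Gelfand.

(** * Presented Hilbert spaces *)

Section PreHilbert.
Context {R : realType}.
Implicit Types E F G : hspace R.

(** The laws are asked of members only, since integrals of other representatives carry no meaning.
    The form is merely semidefinite: representatives equal almost everywhere may differ as
    functions. *)
Definition pre_hilbert E : Prop :=
  [/\ forall (a : R) (x y : E), hmem x -> hmem y -> hmem (a *: x + y),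
      forall (a : R) (x y z : E), hmem x -> hmem y -> hmem z ->
        hip (a *: x + y) z = a * hip x z + hip y z,
      forall x y : E, hmem x -> hmem y -> hip x y = hip y x &
      forall x : E, hmem x -> 0 <= hip x x].

Lemma hip_combr E (a : R) (x y z : E) : pre_hilbert E -> hmem x -> hmem y -> hmem z ->
  hip z (a *: x + y) = a * hip z x + hip z y.
Proof.
move=> [m l s _] hx hy hz.
rewrite (s z _ hz (m a x y hx hy)) (l a x y z hx hy hz).
by rewrite (s x z hx hz) (s y z hy hz).
Qed.

Lemma hip_comb_le E (a : R) (x y : E) : pre_hilbert E -> hmem x -> hmem y ->
  hip (a *: x + y) (a *: x + y) <= 2 * a ^+ 2 * hip x x + 2 * hip y y.
Proof.
move=> pE hx hy; have [m l s p] := pE.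
have sq b : hip (b *: x + y) (b *: x + y) =
    b ^+ 2 * hip x x + 2 * b * hip x y + hip y y.
  rewrite (l b x y (b *: x + y) hx hy (m b x y hx hy)).
  rewrite (hip_combr b pE hx hy hx) (hip_combr b pE hx hy hy) (s y x hy hx); ring.
have := p _ (m (- a) x y hx hy); rewrite !sq; lra.
Qed.

(** Squared norms replace norms, so that sums and pairs of operators are handled by [hip_comb_le]
    without square roots or a triangle inequality. *)
Lemma bounded_linear_opP E F (A : E -> F) : pre_hilbert E -> pre_hilbert F ->
  bounded_linear_op A <->
  [/\ maps_into A,
      forall (a : R) (x y : E), hmem x -> hmem y ->
        hip (A (a *: x + y) - (a *: A x + A y)) (A (a *: x + y) - (a *: A x + A y)) <= 0 &
      exists2 K : R, 0 <= K & forall x : E, hmem x -> hip (A x) (A x) <= K * hip x x].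
Proof.
move=> [_ _ _ pE] [_ _ _ pF]; split=> -[mA linA bA]; split=> //.
- by move=> a x y hx hy; have := linA a x y hx hy; rewrite /heq/hnorm => /eqP; rewrite sqrtr_eq0.
- case: bA => C hC; exists (C ^+ 2); first exact: sqr_ge0.
  move=> x hx; have hA := pF _ (mA _ hx).
  rewrite -[leLHS]sqr_sqrtr// -[X in _ * X]sqr_sqrtr ?pE// -exprMn.
  have := hC x hx; rewrite /hnorm => h.
  by rewrite ler_pXn2r ?nnegrE ?sqrtr_ge0// (le_trans _ h)// sqrtr_ge0.
- by move=> a x y hx hy; apply/eqP; rewrite sqrtr_eq0 linA.
- case: bA => K K0 hK; exists (Num.sqrt K) => x hx.
  by rewrite /hnorm -sqrtrM// ler_wsqrtr// hK.
Qed.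

Lemma bounded_linear_comb E F (A B : E -> F) (c : R) :
  pre_hilbert E -> pre_hilbert F ->
  bounded_linear_op A -> bounded_linear_op B ->
  bounded_linear_op (fun x => c *: A x + B x).
Proof.
move=> pE pF /(bounded_linear_opP _ pE pF)[mA lA [K K0 hK]].
move=> /(bounded_linear_opP _ pE pF)[mB lB [L L0 hL]].
have [mE _ _ _] := pE; have [mF _ _ pos] := pF.
apply/bounded_linear_opP => //; split.
- by move=> x hx; apply: (mF); [exact: mA|exact: mB].
- move=> a x y hx hy.
  have defectA : hmem (A (a *: x + y) - (a *: A x + A y)).
    rewrite addrC -scaleN1r; apply: (mF); last exact: (mA _ (mE _ _ _ hx hy)).
    by apply: (mF); [exact: mA|exact: mA].
  have defectB : hmem (B (a *: x + y) - (a *: B x + B y)).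
    rewrite addrC -scaleN1r; apply: (mF); last exact: (mB _ (mE _ _ _ hx hy)).
    by apply: (mF); [exact: mB|exact: mB].
  rewrite (_ : _ - _ = c *: (A (a *: x + y) - (a *: A x + A y)) +
      (B (a *: x + y) - (a *: B x + B y))); last first.
    rewrite scalerBr addrACA -opprD; congr (_ - _).
    by rewrite !scalerDr !scalerA (mulrC c a) addrACA.
  apply: (le_trans (hip_comb_le _ pF defectA defectB)).
  have h1 := lA a x y hx hy; have h2 := lB a x y hx hy.
  have : 0 <= 2 * c ^+ 2 by rewrite mulr_ge0 ?sqr_ge0.
  move: (2 * c ^+ 2) (hip _ _) (hip _ _) h1 h2 => C P Q h1 h2 C0; nra.
- exists (2 * c ^+ 2 * K + 2 * L).
    by rewrite addr_ge0// mulr_ge0// mulr_ge0// sqr_ge0.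
  move=> x hx; apply: (le_trans (hip_comb_le _ pF (mA _ hx) (mB _ hx))).
  have -> : (2 * c ^+ 2 * K + 2 * L) * hip x x =
      2 * c ^+ 2 * (K * hip x x) + 2 * (L * hip x x) by ring.
  apply: lerD.
    by apply: ler_wpM2l; [rewrite mulr_ge0 ?sqr_ge0|exact: hK].
  by apply: ler_wpM2l => //; exact: hL.
Qed.

Lemma bounded_linear_add E F (A B : E -> F) : pre_hilbert E -> pre_hilbert F ->
  bounded_linear_op A -> bounded_linear_op B ->
  bounded_linear_op (fun x => A x + B x).
Proof.
move=> pE pF bA /(bounded_linear_comb 1 pE pF bA).
by rewrite (_ : (fun x => 1 *: A x + B x) = fun x => A x + B x)//; apply/funext => x; rewrite scale1r.
Qed.

Lemma bounded_linear_sub E F (A B : E -> F) : pre_hilbert E -> pre_hilbert F ->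
  bounded_linear_op A -> bounded_linear_op B ->
  bounded_linear_op (fun x => A x - B x).
Proof.
move=> pE pF bA bB; have := bounded_linear_comb (-1) pE pF bB bA.
by rewrite (_ : (fun x => -1 *: B x + A x) = fun x => A x - B x)//; apply/funext => x; rewrite scaleN1r addrC.
Qed.

Lemma pre_hilbert_prod E F : pre_hilbert E -> pre_hilbert F ->
  pre_hilbert (hs_prod E F).
Proof.
move=> [m l s p] [m' l' s' p']; split.
- by move=> a x y [h1 h2] [h3 h4]; split; [exact: m|exact: m'].
- move=> a x y z [h1 h2] [h3 h4] [h5 h6] /=.
  by rewrite l// l'// mulrDr addrACA.
- by move=> x y [h1 h2] [h3 h4] /=; rewrite s// s'.
- by move=> x [h1 h2] /=; rewrite addr_ge0 ?p ?p'.
Qed.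

Lemma bounded_linear_fst E F G (A : E -> G) :
  pre_hilbert E -> pre_hilbert F -> pre_hilbert G ->
  bounded_linear_op A -> bounded_linear_op (fun x : hs_prod E F => A x.1).
Proof.
move=> pE pF pG /(bounded_linear_opP _ pE pG)[mA lA [K K0 hK]].
apply/(bounded_linear_opP _ (pre_hilbert_prod pE pF) pG); split.
- by move=> x [h1 _]; exact: mA.
- by move=> a x y [h1 _] [h2 _]; exact: lA.
- exists K => // x [h1 h2]; apply: (le_trans (hK _ h1)).
  by rewrite ler_wpM2l//= lerDl; case: pF => _ _ _; apply.
Qed.

Lemma bounded_linear_snd E F G (A : F -> G) :
  pre_hilbert E -> pre_hilbert F -> pre_hilbert G ->
  bounded_linear_op A -> bounded_linear_op (fun x : hs_prod E F => A x.2).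
Proof.
move=> pE pF pG /(bounded_linear_opP _ pF pG)[mA lA [K K0 hK]].
apply/(bounded_linear_opP _ (pre_hilbert_prod pE pF) pG); split.
- by move=> x [_ h1]; exact: mA.
- by move=> a x y [_ h1] [_ h2]; exact: lA.
- exists K => // x [h1 h2]; apply: (le_trans (hK _ h2)).
  by rewrite ler_wpM2l//= lerDr; case: pE => _ _ _; apply.
Qed.

Lemma bounded_linear_pair E F G (A : E -> F) (B : E -> G) :
  pre_hilbert E -> pre_hilbert F -> pre_hilbert G ->
  bounded_linear_op A -> bounded_linear_op B ->
  @bounded_linear_op _ E (hs_prod F G) (fun x => (A x, B x)).
Proof.
move=> pE pF pG /(bounded_linear_opP _ pE pF)[mA lA [K K0 hK]].
move=> /(bounded_linear_opP _ pE pG)[mB lB [L L0 hL]].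
apply/(bounded_linear_opP _ pE (pre_hilbert_prod pF pG)); split.
- by move=> x hx; split; [exact: mA|exact: mB].
- move=> a x y hx hy; rewrite -[leRHS]addr0.
  by apply: (lerD (lA a x y hx hy) (lB a x y hx hy)).
- exists (K + L); first exact: addr_ge0.
  by move=> x hx; rewrite mulrDl; apply: (lerD (hK x hx) (hL x hx)).
Qed.

Lemma pre_hilbert_full (V : hilbertType R) : pre_hilbert (hs_full V).
Proof.
split=> //=.
- by move=> a x y z _ _ _; exact: ip_linearl.
- by move=> x y _ _; exact: ip_sym.
- by move=> x _; exact: ip_ge0.
Qed.

Lemma pre_hilbert_L2 (T : R) (V : hilbertType R) : separable V ->
  pre_hilbert (hs_L2 T V).
Proof.
move=> sepV; split=> [a x y|a x y z hx hy hz|x y hx hy|x hx].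
- exact: L2_comb.
- rewrite /= /ip_L2; have i1 := L2_ip hx hz; have i2 := L2_ip hy hz.
  rewrite -Rintegral_aeZ// -Rintegral_aeD//; last exact: aeintZ.
  by apply: eq_Rintegral => t _; rewrite -ip_linearl.
- by apply: eq_Rintegral => t _; rewrite ip_sym.
- by apply: Rintegral_ge0 => t _; exact: ip_ge0.
Qed.

Lemma pre_hilbert_H1 (T : R) (V : hilbertType R) : 0 < T -> separable V ->
  pre_hilbert (hs_H1 T V).
Proof.
move=> T0 sepV; have [m l s p] := pre_hilbert_L2 T sepV.
have dL (u : R -> V) : H1 T u -> L2 T (ddt T u) by exact: ddt_L2.
split=> [a x y|a x y z hx hy hz|x y hx hy|x hx].
- exact: H1_comb.
- rewrite /= /ip_H1 ip_linearl mulrDr addrACA; congr (_ + _).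
  have E1 := l a (ddt T x) (ddt T y) (ddt T z) (dL _ hx) (dL _ hy) (dL _ hz).
  rewrite /= in E1; rewrite -E1.
  by apply: ip_L2_ae; [exact: ddt_comb|exact: aeW].
- by rewrite /= /ip_H1 ip_sym; congr (_ + _); exact: (s _ _ (dL _ hx) (dL _ hy)).
- by rewrite /= /ip_H1 addr_ge0 ?ip_ge0//; exact: (p _ (dL _ hx)).
Qed.
End PreHilbert.

(** * Nemytskii operators *)

Section DirectionalDerivative.
Context {R : realType}.

Lemma diff_quotient_cvg (E F : normedModType R) (Phi : E -> F) (a d : E)
    (s : nat -> R) : derivable Phi a d -> (forall n, s n != 0) ->
  s @ \oo --> (0 : R) ->
  (fun n => (s n)^-1 *: (Phi (a + s n *: d) - Phi a)) @ \oo --> 'D_d Phi a.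
Proof.
move=> dPhi s0 slim.
have sd : s @ \oo --> (0 : R)^'.
  move=> P; rewrite /dnbhs/= /within/= => P0.
  have H : \forall n \near \oo, s n != 0 -> P (s n) := slim _ P0.
  by change (\forall n \near \oo, P (s n)); apply: filterS H => n; exact.
have := cvg_comp _ _ sd dPhi.
by rewrite /comp/=; under eq_fun do rewrite /shift/= [_ *: d + a]addrC.
Qed.

Section Partial.
Variables (V X F : hilbertType R) (f : R -> V * X -> F) (t : R).
Hypothesis ft : gateaux_differentiable (f t).

Lemma diff_uE v th eta : diff_u f t v th eta = 'D_(eta, 0) (f t) (v, th).
Proof.
rewrite /diff_u /derive.
have -> : (fun h : R => h^-1 *: (((fun v' => f t (v', th)) \o shift v) (h *: eta) - f t (v, th))) =
    (fun h : R => h^-1 *: ((f t \o shift (v, th)) (h *: (eta, 0)) - f t (v, th))).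
  apply/funext => h; rewrite /shift/=.
  rewrite -[h *: (eta, 0) + _]/(h *: eta + v, h *: (0 : X) + th).
  by rewrite scaler0 add0r.
by [].
Qed.

Lemma diff_thE v th xi : diff_th f t v th xi = 'D_(0, xi) (f t) (v, th).
Proof.
rewrite /diff_th /derive.
have -> : (fun h : R => h^-1 *: (((fun x => f t (v, x)) \o shift th) (h *: xi) - f t (v, th))) =
    (fun h : R => h^-1 *: ((f t \o shift (v, th)) (h *: (0, xi)) - f t (v, th))).
  apply/funext => h; rewrite /shift/=.
  rewrite -[h *: (0, xi) + _]/(h *: (0 : V) + v, h *: xi + th).
  by rewrite scaler0 add0r.
by [].
Qed.

Lemma norm_pairl (v : V) : `|(v, 0 : X)| = `|v|.
Proof. by rewrite prod_normE/= normr0 max_l. Qed.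

Lemma norm_pairr (x : X) : `|(0 : V, x)| = `|x|.
Proof. by rewrite prod_normE/= normr0 max_r. Qed.

Lemma diff_u_lac v th : linear_and_continuous (diff_u f t v th).
Proof.
have [_ /[dup] -[lin _] /lac_bound[C _ hC]] := ft (v, th).
apply: (@bound_lac _ _ _ _ C).
  move=> a x y; rewrite !diff_uE -lin.
  rewrite -[a *: (x, 0) + _]/(a *: x + y, a *: (0 : X) + 0).
  by rewrite scaler0 addr0.
by move=> x; rewrite diff_uE (le_trans (hC _))// norm_pairl.
Qed.

Lemma diff_th_lac v th : linear_and_continuous (diff_th f t v th).
Proof.
have [_ /[dup] -[lin _] /lac_bound[C _ hC]] := ft (v, th).
apply: (@bound_lac _ _ _ _ C).
  move=> a x y; rewrite !diff_thE -lin.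
  rewrite -[a *: (0, x) + _]/(a *: (0 : V) + 0, a *: x + y).
  by rewrite scaler0 addr0.
by move=> x; rewrite diff_thE (le_trans (hC _))// norm_pairr.
Qed.

Lemma diff_sumE v th eta xi :
  diff_u f t v th eta + diff_th f t v th xi = 'D_(eta, xi) (f t) (v, th).
Proof.
have [_ [lin _]] := ft (v, th); rewrite diff_uE diff_thE.
have := lin 1 (eta, 0) (0, xi); rewrite !scale1r => <-.
by rewrite -[(eta, 0) + _]/(eta + 0, 0 + xi) addr0 add0r.
Qed.

Lemma partial_quotient_cvg v th eta xi (s : nat -> R) : (forall n, s n != 0) ->
  s @ \oo --> (0 : R) ->
  (fun n => (s n)^-1 *: (f t (v + s n *: eta, th + s n *: xi) - f t (v, th))) @ \oo
    --> diff_u f t v th eta + diff_th f t v th xi.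
Proof.
move=> s0 slim; rewrite diff_sumE.
have [dft _] := ft (v, th).
exact: (diff_quotient_cvg (dft (eta, xi)) s0 slim).
Qed.
End Partial.

Lemma sqr_cvg0 (a : nat -> R) : a @ \oo --> (0 : R) ->
  (fun n => a n ^+ 2) @ \oo --> (0 : R).
Proof.
move=> a0; rewrite (_ : (fun n => _) = a \* a); last first.
  by apply/funext => n; rewrite expr2.
by rewrite -(mul0r (0 : R)); exact: cvgM.
Qed.

Lemma lac0 (E F : normedModType R) (A : E -> F) : linear_and_continuous A -> A 0 = 0.
Proof.
move=> /lac_bound[C _ hC]; apply/eqP; rewrite -normr_eq0 eq_le normr_ge0 andbT.
by rewrite (le_trans (hC _))// normr0 mulr0.
Qed.
End DirectionalDerivative.

Section Nemytskii.
Context {R : realType}.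
Notation mu := (@lebesgue_measure R).
Notation Rm := (measurableTypeR R).
Variables (V X F : hilbertType R) (T : R) (f : R -> V * X -> F).
Hypotheses (T_gt0 : 0 < T) (V_sep : separable V) (F_sep : separable F).
Hypotheses (f_car : caratheodory T f) (f_diff : ae_gateaux T f).
Hypothesis f_lip : locally_lipschitz T f.
Notation D := (`]0, T[%classic : set R).

(** Induction on the list: on [A] the term [x] is absorbed into the base point [c], off [A] it
    disappears. Hence the general [c], and a base case with a constant state. *)
Lemma aemeas_car_simple (s : simple V) (c : V) th e : is_simple s ->
  aemeas D (fun t => ip (f t (c + simple_fun s t, th)) e).
Proof.
elim: s c => [|[A x] s ih] c.
  move=> _; rewrite (_ : (fun t => _) = fun t => ip (f t (c, th)) e); last first.
    by apply/funext => t; rewrite simple_fun_nil addr0.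
  by apply: sm_ip_cst; [exact: mitv|case: f_car].
move=> /is_simple_cons[/= mA ss].
have E1 t : ip (f t (c + simple_fun ((A, x) :: s) t, th)) e =
    \1_A t * ip (f t ((c + x) + simple_fun s t, th)) e +
    (1 - \1_A t) * ip (f t (c + simple_fun s t, th)) e.
  rewrite simple_fun_cons/= indicE; case: (t \in A).
    by rewrite scale1r addrA subrr mul0r addr0 mul1r.
  by rewrite scale0r add0r mul0r subr0 mul1r add0r.
have mI : aemeas D \1_A by apply: aemeasW; exact: measurable_indic.
rewrite (funext E1).
apply: aemeasD; apply: aemeasM; [exact: mI|exact: ih| |exact: ih].
by apply: aemeasB; [exact: aemeas_cst|exact: mI].
Qed.

(** Continuity of [f t] carries the limit from simple states over to [u]; here the two halves of the
    Caratheodory condition meet. *)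
Lemma sm_nem (u : R -> V) th : strongly_measurable D u ->
  strongly_measurable D (nem f u th).
Proof.
move=> [s ss hs]; apply: sm_weak => // e.
apply: (@aemeas_lim _ _ _ (fun n t => ip (f t (0 + simple_fun (s n) t, th)) e)).
- exact: mitv.
- by move=> n; exact: aemeas_car_simple.
have [_ fc] := f_car; apply: filterS2 hs fc => t h1 h2 Dt.
apply: cvg_ip; last exact: cvg_cst.
under eq_fun do rewrite add0r.
apply: (cvg_comp (fun n => (simple_fun (s n) t, th)) (f t)); last exact: h2.
by apply: cvg_pair; [exact: h1|exact: cvg_cst].
Qed.

Section AtState.
Variables (u : R -> V) (th : X).
Hypothesis u_H1 : H1 T u.

Let u_sm : strongly_measurable D u. Proof. exact: H1_sm. Qed.

Lemma sm_quotient (v : R -> V) (xi : X) (s : R) : strongly_measurable D v ->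
  strongly_measurable D
    (fun t => s^-1 *: (f t (u t + s *: v t, th + s *: xi) - f t (u t, th))).
Proof.
move=> smv; apply: sm_weak => // e.
under [X in aemeas _ X]eq_fun do rewrite ipZl ipBl.
apply: aemeasZ; apply: aemeasB.
  apply: sm_ip_cst; first exact: mitv.
  apply: (@sm_nem (fun t => u t + s *: v t)).
  have := sm_comb s V_sep (mitv _) smv u_sm.
  by apply: sm_ae; apply: aeW => t _; rewrite addrC.
by apply: sm_ip_cst; [exact: mitv|exact: sm_nem].
Qed.

(** A limit of measurable difference quotients with steps [1 / (n + 1)]. The total derivative is
    treated at once; each partial one follows by setting the other direction to 0. *)
Lemma sm_nem_sum (v : R -> V) (xi : X) : strongly_measurable D v ->
  strongly_measurable D (fun t => nem_u f u th v t + nem_th f u th xi t).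
Proof.
move=> smv; apply: sm_weak => // e.
pose s (n : nat) : R := n.+1%:R^-1.
apply: (@aemeas_lim _ _ _ (fun n t => ip ((s n)^-1 *:
  (f t (u t + s n *: v t, th + s n *: xi) - f t (u t, th))) e)).
- exact: mitv.
- by move=> n; apply: sm_ip_cst; [exact: mitv|exact: sm_quotient].
apply: filterS f_diff => t h Dt; apply: cvg_ip; last exact: cvg_cst.
apply: partial_quotient_cvg; first exact: h.
  by move=> n; rewrite invr_neq0.
exact: cvg_harmonic.
Qed.

Lemma sm_nem_u (v : R -> V) : strongly_measurable D v ->
  strongly_measurable D (nem_u f u th v).
Proof.
move=> /(sm_nem_sum 0); apply: sm_ae; apply: filterS f_diff => t h Dt.
by rewrite /nem_th (lac0 (diff_th_lac (h Dt) _ _)) addr0.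
Qed.

Lemma sm_nem_th (xi : X) : strongly_measurable D (nem_th f u th xi).
Proof.
have : strongly_measurable D (fun=> 0 : V) by exact: (L2_sm (L2_0 T V)).
move=> /(sm_nem_sum xi); apply: sm_ae; apply: filterS f_diff => t h Dt.
by rewrite /nem_u (lac0 (diff_u_lac (h Dt) _ _)) add0r.
Qed.

Lemma lip_quotient (G : V * X -> F) (M K : R) (v eta : V) (x xi : X) (s : R) :
  s != 0 ->
  (forall (v1 v2 : V) (th1 th2 : X),
    `|v1| <= M -> `|v2| <= M -> `|th1| <= M -> `|th2| <= M ->
    `|G (v1, th1) - G (v2, th2)| <= K * (`|v1 - v2| + `|th1 - th2|)) ->
  `|v + s *: eta| <= M -> `|v| <= M -> `|x + s *: xi| <= M -> `|x| <= M ->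
  `|s^-1 *: (G (v + s *: eta, x + s *: xi) - G (v, x))| <= K * (`|eta| + `|xi|).
Proof.
move=> s0 GK h1 h2 h3 h4; rewrite normrZ normfV ler_pdivrMl ?normr_gt0//.
apply: (le_trans (GK _ _ _ _ h1 h2 h3 h4)).
rewrite ![_ + _ *: _ - _]addrAC !subrr !add0r !normrZ -mulrDr.
by rewrite mulrCA.
Qed.

Lemma nem_L2 : L2 T (nem f u th).
Proof.
have [M0 M00 hM0] := H1_bounded T_gt0 V_sep u_H1.
have [lipM f0] := f_lip.
have M1 : 0 <= M0 + `|th| by exact: addr_ge0.
have [K K0 hK] := lipM _ M1.
(* The majorant compares [f t (u t, th)] with [f t (0, 0)], all arguments staying within radius
   [M0 + |th|]. *)
apply: (@L2_le _ _ _ _ (fun t => `|f t (0, 0)| + K * (M0 + `|th|))).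
- exact: sm_nem.
- have /L2P[_ i0] := f0; have i1 := L2_norm f0.
  have ic : aeint D (fun=> (K * (M0 + `|th|)) ^+ 2).
    by apply: aeint_cst; [exact: mitv|exact: mitvoo_lty].
  set c := K * _ in ic *.
  have i2 := aeintD (mitv _) (aeintD (mitv _) i0 (aeintZ (mitv _) (2 * c) i1)) ic.
  by apply: aeint_ae i2; apply: aeW => t _; ring.
- apply: filterS hK => t h Dt.
  rewrite -lerBlDl (le_trans (lerB_dist _ _))//.
  apply: (le_trans (h Dt (u t) 0 th 0 _ _ _ _)).
  + by rewrite (le_trans (hM0 _ (in_D Dt)))// lerDl.
  + by rewrite normr0.
  + by rewrite lerDr.
  + by rewrite normr0.
  + by rewrite !subr0 ler_wpM2l// lerD2r; exact: hM0 (in_D Dt).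
Qed.

(* Limits of difference quotients inherit the local Lipschitz constant. *)
Lemma diff_bound : exists2 K : R, 0 <= K &
  {ae mu, forall t, D t -> forall eta xi,
    `|diff_u f t (u t) th eta + diff_th f t (u t) th xi| <= K * (`|eta| + `|xi|)}.
Proof.
have [M0 M00 hM0] := H1_bounded T_gt0 V_sep u_H1.
have [lipM f0] := f_lip.
(* The extra 1 leaves room for the increments [s n *: eta] and [s n *: xi], of norm at most 1 for
   large [n]; [K] is therefore independent of the direction. *)
have M1 : 0 <= M0 + `|th| + 1 by rewrite addr_ge0// addr_ge0.
have [K K0 hK] := lipM _ M1; exists K => //.
apply: filterS2 hK f_diff => t h1 h2 Dt eta xi.
pose s (n : nat) : R := n.+1%:R^-1.
have s0 n : s n != 0 by rewrite invr_neq0.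
have slim : s @ \oo --> (0 : R) by exact: cvg_harmonic.
have := partial_quotient_cvg (h2 Dt) (v := u t) (th := th) (eta := eta) (xi := xi) s0 slim.
move=> /cvg_norm qlim; rewrite -(cvg_lim _ qlim)//.
apply: limr_le; first exact: cvgP qlim.
have small (E : normedModType R) (x : E) : \forall n \near \oo, `|s n *: x| <= 1.
  have : (fun n => s n *: x) @ \oo --> (0 : R) *: x by exact: cvgZr_tmp.
  rewrite scale0r => /cvgrPdist_le/(_ 1 ltr01); apply: filterS => n.
  by rewrite sub0r normrN.
near=> n.
apply: (@lip_quotient (f t) _ _ _ _ _ _ (s n) (s0 n) (h1 Dt)).
- rewrite (le_trans (ler_normD _ _))//; apply: lerD; last by near: n; exact: small.
  by rewrite (le_trans (hM0 _ (in_D Dt)))// lerDl.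
- by rewrite (le_trans (hM0 _ (in_D Dt)))// -addrA lerDl addr_ge0.
- rewrite (le_trans (ler_normD _ _))//; apply: lerD; last by near: n; exact: small.
  by rewrite lerDr.
- by rewrite addrAC lerDr addr_ge0.
Unshelve. all: by end_near. Qed.

Lemma nem_u_bound : exists2 K : R, 0 <= K &
  {ae mu, forall t, D t -> forall eta, `|diff_u f t (u t) th eta| <= K * `|eta|}.
Proof.
have [K K0 hK] := diff_bound; exists K => //.
apply: filterS2 hK f_diff => t h1 h2 Dt eta.
by have := h1 Dt eta 0; rewrite (lac0 (diff_th_lac (h2 Dt) _ _)) normr0 !addr0.
Qed.

Lemma nem_th_bound : exists2 K : R, 0 <= K &
  {ae mu, forall t, D t -> forall xi, `|diff_th f t (u t) th xi| <= K * `|xi|}.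
Proof.
have [K K0 hK] := diff_bound; exists K => //.
apply: filterS2 hK f_diff => t h1 h2 Dt xi.
by have := h1 Dt 0 xi; rewrite (lac0 (diff_u_lac (h2 Dt) _ _)) normr0 !add0r.
Qed.

Lemma nem_u_L2 (v : R -> V) : L2 T v -> L2 T (nem_u f u th v).
Proof.
move=> /L2P[smv iv]; have [K K0 hK] := nem_u_bound.
apply: (@L2_le _ _ _ _ (fun t => K * `|v t|)).
- exact: sm_nem_u.
- have := aeintZ (mitv _) (K ^+ 2) iv.
  by apply: aeint_ae; apply: aeW => t _; rewrite exprMn.
- by apply: filterS hK => t h Dt; exact: h.
Qed.

Lemma nem_th_L2 (xi : X) : L2 T (nem_th f u th xi).
Proof.
have [K K0 hK] := nem_th_bound.
apply: (@L2_bounded _ _ _ _ (K * `|xi|)); first exact: sm_nem_th.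
by apply: filterS hK => t h Dt; exact: h.
Qed.

(** Dominated convergence for the squared remainder. The perturbed states stay in a fixed ball
    because the direction [v] is in H1, hence bounded; for a direction merely in L2 the local
    Lipschitz constant could not be fixed. *)
Lemma nem_quotient_cvg (v : R -> V) (xi : X) (s : nat -> R) : H1 T v ->
  (forall n, s n != 0) -> s @ \oo --> (0 : R) ->
  (fun n => \int[mu]_(t in D) (`|(s n)^-1 *:
      (f t (u t + s n *: v t, th + s n *: xi) - f t (u t, th)) -
    (nem_u f u th v t + nem_th f u th xi t)| ^+ 2)) @ \oo --> (0 : R).
Proof.
move=> v_H1 s0 slim.
have [Mu Mu0 hMu] := H1_bounded T_gt0 V_sep u_H1.
have [Mv Mv0 hMv] := H1_bounded T_gt0 V_sep v_H1.
have [S S0 hS] : exists2 S : R, 0 <= S & forall n, `|s n| <= S.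
  have /cvg_seq_bounded[S [_ hS]] := cvgP _ slim.
  exists (`|S| + 1); first by rewrite addr_ge0.
  by move=> n; apply: (hS (`|S| + 1)) => //; rewrite (le_lt_trans (ler_norm S))// ltrDl.
(* A common radius for the states [u + s n *: v] and the parameters [th + s n *: xi], where [S]
   bounds all the steps. *)
pose M := Mu + S * Mv + (`|th| + S * `|xi|).
have SMv : 0 <= S * Mv by exact: mulr_ge0.
have Sxi : 0 <= S * `|xi| by exact: mulr_ge0.
have M0 : 0 <= M by rewrite /M !addr_ge0.
have [lipM f0] := f_lip; have [K K0 hK] := lipM _ M0.
have smq n := sm_quotient xi (s n) (H1_sm V_sep v_H1).
have smd := sm_nem_sum xi (H1_sm V_sep v_H1).
have cv : {ae mu, forall t, D t -> (fun n => `|(s n)^-1 *: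
      (f t (u t + s n *: v t, th + s n *: xi) - f t (u t, th)) -
    (nem_u f u th v t + nem_th f u th xi t)|) @ \oo --> (0 : R)}.
  apply: filterS f_diff => t h Dt.
  have := partial_quotient_cvg (h Dt) (v := u t) (th := th) (eta := v t) (xi := xi) s0 slim.
  move=> q; rewrite -(normr0 F) -(subrr (nem_u f u th v t + nem_th f u th xi t)).
  by apply: cvg_norm; apply: cvgB; [exact: q|exact: cvg_cst].
have qle : {ae mu, forall t, D t -> forall n, `|(s n)^-1 *:
      (f t (u t + s n *: v t, th + s n *: xi) - f t (u t, th))| <= K * (Mv + `|xi|)}.
  apply: filterS hK => t h Dt n.
  have vt := hMv t (in_D Dt); have ut := hMu t (in_D Dt).
  have svt : `|s n *: v t| <= S * Mv by rewrite normrZ ler_pM.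
  have sxi : `|s n *: xi| <= S * `|xi| by rewrite normrZ ler_wpM2r.
  apply: (le_trans (@lip_quotient (f t) _ _ _ _ _ _ (s n) (s0 n) (h Dt) _ _ _ _)).
  - by rewrite (le_trans (ler_normD _ _))// /M (le_trans (lerD ut svt))// lerDl addr_ge0.
  - by rewrite (le_trans ut)// /M -!addrA lerDl !addr_ge0.
  - by rewrite (le_trans (ler_normD _ _))// /M (le_trans (lerD (lexx _) sxi))// lerDr addr_ge0.
  - by rewrite /M addrC -!addrA lerDl !addr_ge0.
  - by rewrite ler_wpM2l// lerD2r.
(* [B] bounds the quotients and, in the limit, the derivative, so [(B + B)^2] dominates the squared
   remainder. *)
pose B := K * (Mv + `|xi|).
have dle : {ae mu, forall t, D t -> `|nem_u f u th v t + nem_th f u th xi t| <= B}.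
  apply: filterS2 qle f_diff => t h1 h2 Dt.
  have := partial_quotient_cvg (h2 Dt) (v := u t) (th := th) (eta := v t) (xi := xi) s0 slim.
  move=> /cvg_norm q; rewrite -(cvg_lim _ q)//.
  apply: limr_le; first exact: cvgP q.
  by apply: nearW => n; exact: h1.
have E0 : \int[mu]_(t in D) 0 = 0 :> R by rewrite Rintegral_cst ?mul0r//; exact: mitv.
rewrite -[X in _ --> X]E0; apply: (@dominated_cvg_Rintegral _ _ (mitv _) _ _ (fun=> (B + B) ^+ 2)).
- move=> n; apply: (@aemeas_comp _ _ (fun x => x ^+ 2)); first exact: exprn_measurable.
  apply: sm_norm; first exact: mitv.
  have := sm_comb (-1) F_sep (mitv _) smd (smq n).
  by apply: sm_ae; apply: aeW => t _; rewrite scaleN1r addrC.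
- by apply: aeint_cst; [exact: mitv|exact: mitvoo_lty].
- move=> n; apply: filterS2 qle dle => t h1 h2 Dt.
  rewrite ger0_norm ?exprn_ge0//.
  rewrite ler_pXn2r ?nnegrE// ?(le_trans _ (lerD (h1 Dt n) (h2 Dt))) ?addr_ge0//.
  exact: ler_normB.
- by apply: filterS cv => t h Dt; apply: sqr_cvg0; exact: h.
Qed.
End AtState.
End Nemytskii.

(** * Norm estimates and adjoints in L2 *)

Section L2Operators.
Context {R : realType}.
Notation mu := (@lebesgue_measure R).
Variable T : R.
Hypothesis T_gt0 : 0 < T.
Notation D := (`]0, T[%classic : set R).

Lemma sm_cst (E : hilbertType R) (e : E) : separable E ->
  strongly_measurable D (fun=> e).
Proof. by move=> sepE; apply: sm_weak => // x; exact: aemeas_cst. Qed.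

Lemma ip_L2_sqr (E : hilbertType R) (F : R -> E) :
  ip_L2 T F F = \int[mu]_(t in D) (`|F t| ^+ 2).
Proof. by apply: eq_Rintegral => t _; rewrite ip_norm. Qed.

Lemma ip_L2_ae0 (E : hilbertType R) (F : R -> E) :
  {ae mu, forall t, D t -> F t = 0} -> ip_L2 T F F = 0.
Proof.
move=> h; rewrite (ip_L2_ae h h) /ip_L2; under eq_Rintegral do rewrite ip0l.
by rewrite Rintegral_cst ?mul0r//.
Qed.

Lemma ip_L2_le (E F : hilbertType R) (f : R -> E) (g : R -> F) (K : R) : 0 <= K ->
  L2 T f -> L2 T g -> {ae mu, forall t, D t -> `|f t| <= K * `|g t|} ->
  ip_L2 T f f <= K ^+ 2 * ip_L2 T g g.
Proof.
move=> K0 /L2P[_ i1] /L2P[_ i2] h; rewrite !ip_L2_sqr -Rintegral_aeZ//.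
apply: le_Rintegral_ae => //; first exact: aeintZ.
apply: filterS h => t h Dt; rewrite -exprMn ler_pXn2r ?nnegrE ?mulr_ge0//.
exact: h.
Qed.

(** Squaring the pointwise bound of [H1_bound] gives [2 * |v 0|^2 + 2 * T * I] with [I] the squared
    L2 norm of the derivative. Integration contributes the factor [T]. *)
Lemma ip_L2_H1_le (E : hilbertType R) (v : R -> E) : separable E -> H1 T v ->
  ip_L2 T v v <= T * (2 + 2 * T) * ip_H1 T v v.
Proof.
move=> sepE vH; have vd := ddtP vH.
have I0 : 0 <= ip_L2 T (ddt T v) (ddt T v).
  by apply: Rintegral_ge0 => t _; exact: ip_ge0.
set I := ip_L2 T (ddt T v) (ddt T v) in I0 *.
have bnd : {ae mu, forall t, D t -> `|v t| ^+ 2 <= 2 * ip (v 0) (v 0) + 2 * T * I}.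
  apply: aeW => t /in_D /(H1_bound T_gt0 sepE vd) h.
  apply: (@le_trans _ _ ((`|v 0| + Num.sqrt T * Num.sqrt I) ^+ 2)).
    by rewrite ler_pXn2r ?nnegrE ?addr_ge0 ?mulr_ge0 ?sqrtr_ge0.
  have e1 : (Num.sqrt T * Num.sqrt I) ^+ 2 = T * I by rewrite exprMn !sqr_sqrtr// ltW.
  rewrite ip_norm -mulrA -e1; move: (Num.sqrt T * _) (`|v 0|) => a b.
  by have := sqr_ge0 (a - b); lra.
have /L2P[_ iv] := H1_L2 T_gt0 sepE vH.
rewrite ip_L2_sqr; set c := 2 * _ + _ in bnd.
apply: (@le_trans _ _ (\int[mu]_(t in D) c)).
  apply: le_Rintegral_ae => //.
  by apply: aeint_cst => //; exact: mitvoo_lty.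
rewrite Rintegral_cst//.
rewrite fine_mitvoo// /ip_H1 -/I /c.
have := ip_ge0 (v 0); move: (ip _ _) => J J0.
have : 0 <= T * I by rewrite mulr_ge0// ltW.
have : 0 <= T * J by rewrite mulr_ge0// ltW.
have : 0 <= T * (T * J) by rewrite !mulr_ge0// ltW.
move=> h1 h2 h3.
rewrite -subr_ge0 (_ : _ - _ = 2 * (T * I) + 2 * (T * (T * J))); last by ring.
by rewrite addr_ge0// mulr_ge0.
Qed.

(* Adjoints of uniformly bounded families are weakly measurable, hence, by
   separability, strongly measurable. *)
Lemma L2_adjoint (E F : hilbertType R) (A : R -> E -> F) (w : R -> F) (S : R -> E)
    (K : R) : separable E -> 0 <= K -> L2 T w ->
  (forall e, strongly_measurable D (fun t => A t e)) ->
  {ae mu, forall t, D t -> forall e, `|A t e| <= K * `|e|} ->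
  {ae mu, forall t, D t -> forall e, ip (S t) e = ip (w t) (A t e)} ->
  L2 T S.
Proof.
move=> sepE K0 wL2 mA bA SA; apply: (@L2_le _ _ _ _ (fun t => K * `|w t|)).
- apply: sm_weak => // e.
  apply: (@aemeas_ae _ _ _ (fun t => ip (w t) (A t e))).
    by apply: filterS SA => t h Dt; exact: h.
  by apply: sm_ip => //; exact: L2_sm.
- have /L2P[_ iw] := wL2; have := aeintZ (mitv _) (K ^+ 2) iw.
  by apply: aeint_ae; apply: aeW => t _; rewrite exprMn.
- apply: filterS2 bA SA => t h1 h2 Dt.
  have [->|S0] := eqVneq (S t) 0; first by rewrite normr0 mulr_ge0.
  have S_gt0 : 0 < `|S t| by rewrite normr_gt0.
  (* The defining identity is tested with [e = S t]. *)
  rewrite -(ler_pM2l S_gt0) -expr2 -ip_norm h2//.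
  rewrite (le_trans (le_trans (ler_norm _) (ip_le _ _)))//.
  rewrite (le_trans (ler_wpM2l _ (h1 Dt (S t))))//.
  by rewrite le_eqVlt; apply/orP; left; apply/eqP; ring.
Qed.

Section NemytskiiAdjoint.
Variables (V X F : hilbertType R) (f : R -> V * X -> F).
Hypotheses (V_sep : separable V) (X_sep : separable X) (F_sep : separable F).
Hypotheses (f_car : caratheodory T f) (f_diff : ae_gateaux T f).
Hypothesis f_lip : locally_lipschitz T f.
Variables (u : R -> V) (th : X).
Hypothesis u_H1 : H1 T u.

Lemma nem_u_bounded : @bounded_linear_op R (hs_H1 T V) (hs_L2 T F) (nem_u f u th).
Proof.
have [K K0 hK] := nem_u_bound T_gt0 V_sep f_diff f_lip th u_H1.
have mL2 v : H1 T v -> L2 T (nem_u f u th v).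
  by move=> vH; apply: nem_u_L2 => //; exact: H1_L2.
apply/bounded_linear_opP; [exact: pre_hilbert_H1|exact: pre_hilbert_L2|split].
- exact: mL2.
- move=> a x y hx hy; rewrite le_eqVlt; apply/orP; left; apply/eqP/ip_L2_ae0.
  apply: filterS f_diff => t h Dt.
  have [lin _] := diff_u_lac (h Dt) (u t) th.
  apply/eqP; rewrite subr_eq0; apply/eqP; exact: lin.
- exists (K ^+ 2 * (T * (2 + 2 * T))).
    have T2 : 0 <= 2 + 2 * T by rewrite addr_ge0// mulr_ge0// ltW.
    by rewrite mulr_ge0 ?sqr_ge0// mulr_ge0// ltW.
  move=> v vH; apply: (@le_trans _ _ (K ^+ 2 * ip_L2 T v v)).
    apply: ip_L2_le => //; [exact: mL2|exact: H1_L2|].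
    by apply: filterS hK => t h Dt; exact: h.
  by rewrite -mulrA ler_wpM2l ?sqr_ge0//; exact: ip_L2_H1_le.
Qed.

Lemma nem_th_bounded : @bounded_linear_op R (hs_full X) (hs_L2 T F) (nem_th f u th).
Proof.
have [K K0 hK] := nem_th_bound T_gt0 V_sep f_diff f_lip th u_H1.
have mL2 xi : L2 T (nem_th f u th xi) by exact: nem_th_L2.
apply/bounded_linear_opP; [exact: pre_hilbert_full|exact: pre_hilbert_L2|split].
- by move=> x _; exact: mL2.
- move=> a x y hx hy; rewrite le_eqVlt; apply/orP; left; apply/eqP/ip_L2_ae0.
  apply: filterS f_diff => t h Dt.
  have [lin _] := diff_th_lac (h Dt) (u t) th.
  apply/eqP; rewrite subr_eq0; apply/eqP; exact: lin.
- exists (T * K ^+ 2); first by rewrite mulr_ge0 ?sqr_ge0// ltW.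
  move=> x _; rewrite /= ip_L2_sqr; have /L2P[_ i] := mL2 x.
  apply: (@le_trans _ _ (\int[mu]_(t in D) (K * `|x|) ^+ 2)).
    apply: le_Rintegral_ae => //.
      by apply: aeint_cst => //; exact: mitvoo_lty.
    apply: filterS hK => t h Dt; rewrite ler_pXn2r ?nnegrE ?mulr_ge0//; exact: h.
  rewrite Rintegral_cst//.
  by rewrite fine_mitvoo// exprMn ip_norm le_eqVlt; apply/orP; left; apply/eqP; ring.
Qed.

Lemma nem_u_adjoint_L2 (w : R -> F) (S : R -> V) : L2 T w ->
  {ae mu, forall t, D t -> forall e, ip (S t) e = ip (w t) (diff_u f t (u t) th e)} ->
  L2 T S.
Proof.
move=> wL2 SA.
have [K K0 hK] := nem_u_bound T_gt0 V_sep f_diff f_lip th u_H1.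
apply: (L2_adjoint V_sep K0 wL2 _ hK SA) => e.
exact: (sm_nem_u V_sep F_sep f_car f_diff th u_H1 (sm_cst e V_sep)).
Qed.

Lemma nem_th_adjoint_L2 (w : R -> F) (S : R -> X) : L2 T w ->
  {ae mu, forall t, D t -> forall e, ip (S t) e = ip (w t) (diff_th f t (u t) th e)} ->
  L2 T S.
Proof.
move=> wL2 SA.
have [K K0 hK] := nem_th_bound T_gt0 V_sep f_diff f_lip th u_H1.
apply: (L2_adjoint X_sep K0 wL2 _ hK SA) => e.
exact: sm_nem_th.
Qed.

Lemma nem_u_adjoint (w : R -> F) (S : R -> V) (v : R -> V) : 
  {ae mu, forall t, D t -> forall e, ip (S t) e = ip (w t) (diff_u f t (u t) th e)} ->
  ip_L2 T (nem_u f u th v) w = ip_L2 T v S.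
Proof.
move=> SA; apply: ae_eq_Rintegral; apply: filterS SA => t h Dt.
by rewrite ip_sym -h// ip_sym.
Qed.

Lemma nem_th_adjoint (w : R -> F) (S : R -> X) (xi : X) : L2 T w ->
  {ae mu, forall t, D t -> forall e, ip (S t) e = ip (w t) (diff_th f t (u t) th e)} ->
  ip_L2 T (nem_th f u th xi) w = ip xi (bochner D S).
Proof.
move=> wL2 SA; have SL2 := nem_th_adjoint_L2 wL2 SA.
rewrite ip_sym (ip_bochner_L2 X_sep xi SL2 (lexx T)).
by apply: ae_eq_Rintegral; apply: filterS SA => t h Dt; rewrite ip_sym -h.
Qed.
End NemytskiiAdjoint.
End L2Operators.

(** * The all-at-once operator *)

(** Time derivative and initial value are linear, so in the difference quotient of F they cancel
    against their own derivative [a]; up to sign, only the remainder of the nonlinear part is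
    left. *)
Lemma quotient_alg (R : realType) (E : normedModType R) (a b c d x y : E) (s : R) :
  s != 0 ->
  s^-1 *: (s *: a + b - c - (b - d)) - (a - x - y) = - (s^-1 *: (c - d) - (x + y)).
Proof.
move=> s0; have -> : s *: a + b - c - (b - d) = s *: a - (c - d).
  move: (s *: a) => p; rewrite !opprB.
  have -> : p + b - c = p - c + b by rewrite addrAC.
  by rewrite -(addrA (p - c) b) (addrC b) subrK addrAC -addrA.
move: (c - d) => q; rewrite scalerBr scalerA mulVf// scale1r.
move: (s^-1 *: q) => r; rewrite !opprB addrC -addrA [x - a + _]addrA subrK.
by rewrite addrA [y + x]addrC.
Qed.

Section AllAtOnceOperators.
Context {R : realType} {X Z H V Vd : hilbertType R}.
Notation mu := (@lebesgue_measure R).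
Variables (T : R) (iota : V -> H) (dual : Vd -> V -> R).
Variables (f : R -> V * X -> Vd) (g : R -> V * X -> Z) (u0 : X -> V).
Hypotheses (T_gt0 : 0 < T) (X_sep : separable X) (Z_sep : separable Z).
Hypotheses (V_sep : separable V) (VHVd : gelfand_triple iota dual).
Hypotheses (f_car : caratheodory T f) (g_car : caratheodory T g).
Hypotheses (f_diff : ae_gateaux T f) (g_diff : ae_gateaux T g).
Hypothesis u0_diff : gateaux_differentiable u0.
Hypotheses (f_lip : locally_lipschitz T f) (g_lip : locally_lipschitz T g).
Notation D := (`]0, T[%classic : set R).

Let Vd_sep : separable Vd. Proof. exact: separable_dual VHVd V_sep. Qed.

Lemma emb_L2 (p : R -> V) : L2 T p -> L2 T (fun t => emb iota dual (p t)).
Proof.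
move=> /[dup] /L2_sm smp /L2P[_ ip2]; have [C C0 hC] := emb_bound VHVd.
apply: (@L2_le _ _ _ _ (fun t => C * `|p t|)).
- apply: sm_weak => // e.
  (* Moving the embedding to the other factor leaves the inner product of [p t] with a fixed vector
     of V. *)
  rewrite (_ : (fun t => _) =
      fun t => ip (p t) (isoIt_adj iota dual (isoI dual e))); last first.
    by apply/funext => t; rewrite -(isoIt_adj_isoI VHVd) ip_sym.
  exact: sm_ip_cst.
- have := aeintZ (mitv _) (C ^+ 2) ip2.
  by apply: aeint_ae; apply: aeW => t _; rewrite exprMn.
- by apply: aeW => t _; exact: hC.
Qed.

Lemma FF_maps_into : maps_into (FF T iota dual f g u0).
Proof.
move=> [u th] [/= uH _]; split; last exact: nem_L2.
split=> //; apply: L2B => //; last exact: nem_L2.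
by apply: emb_L2; exact: ddt_L2.
Qed.

Lemma emb_ddt_bounded : @bounded_linear_op R (hs_H1 T V) (hs_L2 T Vd)
  (fun v t => emb iota dual (ddt T v t)).
Proof.
have [C C0 hC] := emb_bound VHVd.
have mL2 v : H1 T v -> L2 T (fun t => emb iota dual (ddt T v t)).
  by move=> vH; apply: emb_L2; exact: ddt_L2.
apply/bounded_linear_opP; [exact: pre_hilbert_H1|exact: pre_hilbert_L2|split].
- exact: mL2.
- move=> a x y hx hy; rewrite le_eqVlt; apply/orP; left; apply/eqP/ip_L2_ae0.
  apply: filterS (ddt_comb V_sep a hx hy) => t h Dt.
  apply/eqP; rewrite subr_eq0; apply/eqP.
  apply: (etrans (congr1 (emb iota dual) (h Dt))); exact: emb_lin.
- exists (C ^+ 2); first exact: sqr_ge0.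
  move=> v vH; apply: (@le_trans _ _ (C ^+ 2 * ip_L2 T (ddt T v) (ddt T v))).
    apply: ip_L2_le => //; [exact: mL2|exact: ddt_L2|].
    by apply: aeW => t _; exact: hC.
  by rewrite ler_wpM2l ?sqr_ge0// /= /ip_H1 lerDl ip_ge0.
Qed.

Lemma initial_bounded : @bounded_linear_op R (hs_H1 T V) (hs_full V) (fun v => v 0).
Proof.
apply/bounded_linear_opP; [exact: pre_hilbert_H1|exact: pre_hilbert_full|split] => //.
- by move=> a x y _ _ /=; rewrite subrr ip0l.
- exists 1 => // v vH; rewrite mul1r /= /ip_H1 lerDr.
  by apply: Rintegral_ge0 => t _; exact: ip_ge0.
Qed.

Lemma du0_lac th : linear_and_continuous (du0 u0 th).
Proof. by case: (u0_diff th). Qed.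

Lemma du0_bounded th : @bounded_linear_op R (hs_full X) (hs_full V) (du0 u0 th).
Proof.
have [lin _] := du0_lac th; have [C C0 hC] := lac_bound (du0_lac th).
apply/bounded_linear_opP; [exact: pre_hilbert_full|exact: pre_hilbert_full|split] => //.
- by move=> a x y _ _ /=; rewrite lin subrr ip0l.
- exists (C ^+ 2); first exact: sqr_ge0.
  by move=> x _ /=; rewrite !ip_norm -exprMn ler_pXn2r ?nnegrE// mulr_ge0.
Qed.

Section AtState.
Variables (u : R -> V) (th : X).
Hypothesis u_H1 : H1 T u.

Lemma ddt_sub_nem_u_bounded : @bounded_linear_op R (hs_H1 T V) (hs_L2 T Vd)
  (ddt_sub_nem_u T iota dual f u th).
Proof.
apply: (@bounded_linear_sub R (hs_H1 T V) (hs_L2 T Vd)).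
- exact: pre_hilbert_H1.
- exact: pre_hilbert_L2.
- exact: emb_ddt_bounded.
- exact: nem_u_bounded.
Qed.

Lemma dFF_bounded : bounded_linear_op (dFF T iota dual f g u0 u th).
Proof.
have p1 := pre_hilbert_H1 T_gt0 V_sep.
have p2 := pre_hilbert_full X.
have p12 := pre_hilbert_prod p1 p2.
have q1 := pre_hilbert_L2 T Vd_sep.
have q2 := pre_hilbert_full V.
have q3 := pre_hilbert_L2 T Z_sep.
have b1 := bounded_linear_sub p12 q1
  (bounded_linear_fst p1 p2 q1 ddt_sub_nem_u_bounded)
  (bounded_linear_snd p1 p2 q1
     (nem_th_bounded T_gt0 V_sep Vd_sep f_car f_diff f_lip th u_H1)).
have b2 := bounded_linear_sub p12 q2
  (bounded_linear_fst p1 p2 q2 initial_bounded)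
  (bounded_linear_snd p1 p2 q2 (du0_bounded th)).
have b3 := bounded_linear_add p12 q3
  (bounded_linear_fst p1 p2 q3
     (nem_u_bounded T_gt0 V_sep Z_sep g_car g_diff g_lip th u_H1))
  (bounded_linear_snd p1 p2 q3
     (nem_th_bounded T_gt0 V_sep Z_sep g_car g_diff g_lip th u_H1)).
exact: (bounded_linear_pair p12 (pre_hilbert_prod q1 q2) q3
  (bounded_linear_pair p12 q1 q2 b1 b2) b3).
Qed.

(** The squared norm of the remainder is the sum of three scalar sequences, one per component of the
    codomain: the Nemytskii remainders of [f] and [g], and the remainder of [u0]. *)
Lemma FF_gateaux : is_gateaux (FF T iota dual f g u0) (u, th)
  (dFF T iota dual f g u0 u th).
Proof.
split; first exact: dFF_bounded.
(* The punctured limit is tested along sequences, as dominated convergence requires. *)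
move=> [v xi] [/= v_H1 _]; apply/cvgr_dnbhsP => s [s0 slim].
set Y := fun n => (s n)^-1 *: (FF T iota dual f g u0 ((u, th) + s n *: (v, xi)) -
   FF T iota dual f g u0 (u, th)) - dFF T iota dual f g u0 u th (v, xi).
suff : (fun n => hip (Y n) (Y n)) @ \oo --> (0 : R).
  move=> h; have := cvg_comp _ Num.sqrt h (@sqrt_continuous R 0).
  by rewrite sqrtr0.
have l1 := nem_quotient_cvg T_gt0 V_sep Vd_sep f_car f_diff f_lip th u_H1 xi v_H1 s0 slim.
have l3 := nem_quotient_cvg T_gt0 V_sep Z_sep g_car g_diff g_lip th u_H1 xi v_H1 s0 slim.
have l2 : (fun n => `|(s n)^-1 *: (u0 (th + s n *: xi) - u0 th) - du0 u0 th xi| ^+ 2)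
    @ \oo --> (0 : R).
  apply: sqr_cvg0; have [du _] := u0_diff th.
  have q := diff_quotient_cvg (du xi) s0 slim.
  rewrite -(normr0 V) -(subrr (du0 u0 th xi)).
  by apply: cvg_norm; apply: cvgB; [exact: q|exact: cvg_cst].
pose I (F : hilbertType R) (G : R -> V * X -> F) n :=
  \int[mu]_(t in D) (`|(s n)^-1 *:
      (G t (u t + s n *: v t, th + s n *: xi) - G t (u t, th)) -
    (nem_u G u th v t + nem_th G u th xi t)| ^+ 2).
pose J n := `|(s n)^-1 *: (u0 (th + s n *: xi) - u0 th) - du0 u0 th xi| ^+ 2.
have E n : hip (Y n) (Y n) = I Vd f n + J n + I Z g n.
  have uE : (fun t => s n *: v t + u t) = (u + s n *: v : R -> V).
    by apply/funext => t; rewrite addrC.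
  have E1 : ip_L2 T (Y n).1.1 (Y n).1.1 =
      \int[mu]_(t in D) (`|(s n)^-1 *:
        (f t (u t + s n *: v t, th + s n *: xi) - f t (u t, th)) -
      (nem_u f u th v t + nem_th f u th xi t)| ^+ 2).
    rewrite ip_L2_sqr; apply: ae_eq_Rintegral.
    (* [ddt] is linear only almost everywhere, so the linear part cancels under the integral
       sign. *)
    have := ddt_comb V_sep (s n) v_H1 u_H1; rewrite uE => hd.
    apply: filterS hd => t /[apply] hd.
    rewrite -[in RHS]normrN; congr (`|_| ^+ 2).
    have emE : emb iota dual (ddt T (u + s n *: v : R -> V) t) =
        s n *: emb iota dual (ddt T v t) + emb iota dual (ddt T u t).
      by rewrite hd; exact: emb_lin.
    rewrite -(@quotient_alg _ _ (emb iota dual (ddt T v t)) (emb iota dual (ddt T u t)) _ _ _ _ _ (s0 n)).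
    by rewrite -emE.
  have E2 : ip (Y n).1.2 (Y n).1.2 =
      `|(s n)^-1 *: (u0 (th + s n *: xi) - u0 th) - du0 u0 th xi| ^+ 2.
    rewrite ip_norm -[in RHS]normrN; congr (`|_| ^+ 2).
    have := @quotient_alg R V (v 0) (u 0) (u0 (th + s n *: xi)) (u0 th) (du0 u0 th xi) 0 _ (s0 n).
    by rewrite subr0 addr0 => <-; rewrite [s n *: v 0 + _]addrC.
  have E3 : ip_L2 T (Y n).2 (Y n).2 =
      \int[mu]_(t in D) (`|(s n)^-1 *:
        (g t (u t + s n *: v t, th + s n *: xi) - g t (u t, th)) -
      (nem_u g u th v t + nem_th g u th xi t)| ^+ 2).
    by rewrite ip_L2_sqr.
  by rewrite /I /J -E1 -E2 -E3.
rewrite (funext E) -(addr0 (0 : R)) -{1}(addr0 (0 : R)).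
exact: cvgD (cvgD l1 l2) l3.
Qed.

(** The pointwise Hilbert adjoint of the [u]-derivative of [g]. The boundary value problem for [uz]
    has the opposite right-hand side, whereas the one for [uw] has [rhs_w] itself. *)
Definition rhs_z (z : R -> Z) t := isoIt dual (gu_adj dual g u th t (z t)).
Definition rhs_w (w : R -> Vd) t :=
  isoIt dual (fu_adj dual f u th t (isoI dual (w t))).
Definition emb_star (w : R -> Vd) t := isoIt_adj iota dual (isoI dual (w t)).

Lemma rhs_zP z : {ae mu, forall t, D t -> forall e,
  ip (rhs_z z t) e = ip (z t) (diff_u g t (u t) th e)}.
Proof.
apply: filterS g_diff => t h Dt e.
exact: (isoIt_adj_hilbert VHVd (z t) (diff_u_lac (h Dt) (u t) th)).
Qed.

Lemma rhs_wP w : {ae mu, forall t, D t -> forall e,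
  ip (rhs_w w t) e = ip (w t) (diff_u f t (u t) th e)}.
Proof.
apply: filterS f_diff => t h Dt e.
exact: (isoIt_adj_dual VHVd (w t) (diff_u_lac (h Dt) (u t) th)).
Qed.

Lemma fth_adjP w : {ae mu, forall t, D t -> forall xi,
  ip (fth_adj dual f u th t (isoI dual (w t))) xi = ip (w t) (diff_th f t (u t) th xi)}.
Proof.
apply: filterS f_diff => t h Dt xi.
exact: (adj_dual VHVd (w t) (diff_th_lac (h Dt) (u t) th)).
Qed.

Lemma gth_adjP z : {ae mu, forall t, D t -> forall xi,
  ip (gth_adj g u th t (z t)) xi = ip (z t) (diff_th g t (u t) th xi)}.
Proof.
apply: filterS g_diff => t h Dt xi.
exact: (hilbert_adjointP (z t) (diff_th_lac (h Dt) (u t) th)).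
Qed.

Lemma rhs_z_L2 z : L2 T z -> L2 T (rhs_z z).
Proof. by move=> zL2; exact: (nem_u_adjoint_L2 T_gt0 V_sep Z_sep g_car g_diff g_lip u_H1 zL2 (rhs_zP z)). Qed.

Lemma rhs_w_L2 w : L2 T w -> L2 T (rhs_w w).
Proof. by move=> wL2; exact: (nem_u_adjoint_L2 T_gt0 V_sep Vd_sep f_car f_diff f_lip u_H1 wL2 (rhs_wP w)). Qed.

Lemma emb_star_L2 w : L2 T w -> L2 T (emb_star w).
Proof.
move=> wL2; have [C C0 hC] := emb_bound VHVd.
apply: (@L2_adjoint _ _ _ _ (fun=> emb iota dual) w _ C) => //.
- by move=> e; exact: sm_cst.
- by apply: aeW => t _; exact: hC.
- by apply: aeW => t _ e; rewrite /emb_star (isoIt_adj_isoI VHVd) ip_sym.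
Qed.

(** The minus sign in the problem for [uz] cancels the one in [ip_H1_bvp]. *)
Lemma nem_u_starP z uz v : L2 T z -> H1 T v -> solves_uz T dual g u th z uz ->
  ip_L2 T (nem_u g u th v) z = ip_H1 T v uz.
Proof.
move=> zL2 vH su.
rewrite (ip_H1_bvp T_gt0 V_sep su (L2N V_sep (rhs_z_L2 zL2)) vH) ip0r subr0.
rewrite (nem_u_adjoint v (rhs_zP z)) /ip_L2 -Rintegral_aeN; last 2 first.
- exact: mitv.
- apply: L2_ip; [exact: H1_L2|exact: L2N (rhs_z_L2 zL2)].
by apply: eq_Rintegral => t _; rewrite ipNr opprK.
Qed.

Lemma ddt_sub_nem_u_star_H1 w uw : solves_uw T dual f u th w (uw w) -> L2 T w ->
  H1 T (ddt_sub_nem_u_star iota dual uw w).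
Proof.
move=> [p [q [hp _ _ _ _]]] wL2.
apply: H1D => //; first by exists p.
exists (emb_star w); have := H1_primitive T_gt0 V_sep 0 (emb_star_L2 wL2).
by rewrite (_ : (fun t => 0 + _) = fun t => bochner `]0, t[ (emb_star w))//;
  apply/funext => t; rewrite add0r.
Qed.

(** The embedded time derivative is represented by the primitive of [emb_star w], and [- f'_u] by
    [uw w], for which the minus sign of [ip_H1_bvp] is the desired one. *)
Lemma ddt_sub_nem_u_starP w uw v : L2 T w -> H1 T v ->
  solves_uw T dual f u th w (uw w) ->
  ip_L2 T (ddt_sub_nem_u T iota dual f u th v) w =
  ip_H1 T v (ddt_sub_nem_u_star iota dual uw w).
Proof.
move=> wL2 vH /[dup] su [p [q [hp _ _ _ _]]].
have mL2 := emb_star_L2 wL2.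
have H1m : H1 T (fun t => bochner `]0, t[ (emb_star w)).
  exists (emb_star w); have := H1_primitive T_gt0 V_sep 0 mL2.
  by rewrite (_ : (fun t => 0 + _) = fun t => bochner `]0, t[ (emb_star w))//;
    apply/funext => t; rewrite add0r.
have H1u : H1 T (uw w) by exists p.
apply: (etrans _ (esym (ip_H1Dr V_sep vH H1u H1m))).
rewrite (ip_H1_primitive T_gt0 V_sep vH mL2).
rewrite (ip_H1_bvp T_gt0 V_sep su (rhs_w_L2 wL2) vH) ip0r subr0.
have nL2 : L2 T (nem_u f u th v) by apply: nem_u_L2 => //; exact: H1_L2.
rewrite (ip_L2Bl (emb_L2 (ddt_L2 vH)) nL2 wL2) addrC.
rewrite (nem_u_adjoint v (rhs_wP w)); congr (_ + _).
apply: eq_Rintegral => t _; rewrite [RHS]ip_sym.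
exact: (esym (isoIt_adj_isoI VHVd _ _)).
Qed.

(** With zero right-hand side and [b = - h], only the boundary term of [ip_H1_bvp] survives. *)
Lemma initial_starP (h : V) (uh v : R -> V) : H1 T v -> solves_uh T h uh -> ip (v 0) h = ip_H1 T v uh.
Proof.
move=> vH su; rewrite (ip_H1_bvp T_gt0 V_sep su (L2_0 T V) vH) ipNr opprK.
rewrite /ip_L2 (_ : Rintegral _ _ _ = 0) ?oppr0 ?add0r//.
under eq_Rintegral do rewrite ip0r.
by rewrite Rintegral_cst ?mul0r//.
Qed.

Lemma bvp_H1 r b x : @solves_bvp R V T r b x -> H1 T x.
Proof. by move=> [p [q [hp _ _ _ _]]]; exists p. Qed.

Lemma nem_th_starP z xi : L2 T z ->
  ip_L2 T (nem_th g u th xi) z = ip xi (gth_star T g u th z).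
Proof.
move=> zL2.
exact: (nem_th_adjoint T_gt0 V_sep X_sep Z_sep g_car g_diff g_lip u_H1 xi zL2 (gth_adjP z)).
Qed.

Lemma fth_starP w xi : L2 T w ->
  ip_L2 T (nem_th f u th xi) w = ip xi (fth_star T dual f u th w).
Proof.
move=> wL2.
exact: (nem_th_adjoint T_gt0 V_sep X_sep Vd_sep f_car f_diff f_lip u_H1 xi wL2 (fth_adjP w)).
Qed.

Section Solutions.
Variables (uz : (R -> Z) -> R -> V) (uw : (R -> Vd) -> R -> V) (uh : V -> R -> V).
Hypothesis uzP : forall z, L2 T z -> solves_uz T dual g u th z (uz z).
Hypothesis uwP : forall w, L2 T w -> solves_uw T dual f u th w (uw w).
Hypothesis uhP : forall h : V, solves_uh T h (uh h).

(** A block operator has as adjoint the transposed block of the entrywise adjoints: the six entries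
    are paired separately. *)
Lemma FF_star_adjoint : @is_adjoint R (dom_space T) (cod_space T)
  (dFF T iota dual f g u0 u th) (FF_star T iota dual f g u0 uz uw uh u th).
Proof.
split; first exact: dFF_bounded.
  move=> [[w h] z] [[/= wL2 _] zL2]; split => //=.
  apply: H1D => //; last exact: bvp_H1 (uzP zL2).
  apply: H1D => //; last exact: bvp_H1 (uhP h).
  exact: (ddt_sub_nem_u_star_H1 (uwP wL2) wL2).
move=> [v xi] [[w h] z] [/= vH _] [[/= wL2 _] zL2].
have Hw := ddt_sub_nem_u_star_H1 (uwP wL2) wL2.
have Hh := bvp_H1 (uhP h); have Hz := bvp_H1 (uzP zL2).
have vL2 := H1_L2 T_gt0 V_sep vH.
have a1 : L2 T (ddt_sub_nem_u T iota dual f u th v).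
  by apply: L2B => //; [exact: emb_L2 (ddt_L2 vH)|exact: nem_u_L2].
have a2 : L2 T (nem_th f u th xi) by exact: nem_th_L2.
have a3 : L2 T (nem_u g u th v) by exact: nem_u_L2.
have a4 : L2 T (nem_th g u th xi) by exact: nem_th_L2.
rewrite (ip_L2Bl a1 a2 wL2) (ip_L2Dl a3 a4 zL2) ipBl.
rewrite (ip_H1Dr V_sep vH (H1D V_sep Hw Hh) Hz) (ip_H1Dr V_sep vH Hw Hh).
rewrite (ddt_sub_nem_u_starP wL2 vH (uwP wL2)) (fth_starP xi wL2).
rewrite (initial_starP vH (uhP h)) (nem_u_starP zL2 vH (uzP zL2)) (nem_th_starP xi zL2).
rewrite !ipDr !ipNr -(ip_sym (u0_star _ _ _ _)) (u0_starP VHVd h (du0_lac th)).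
rewrite (ip_sym h).
(* Regrouping from the three rows of the derivative to the two rows of its adjoint. *)
have arith (a b c d e k : R) : a - b + (c - d) + (e + k) = a + c + e + (- b - d + k) by ring.
exact: arith.
Qed.
End Solutions.
End AtState.
End AllAtOnceOperators.

Theorem proposition3p4 (R : realType) (T : R)
    (X Z H V Vd : hilbertType R) (iota : V -> H) (dual : Vd -> V -> R)
    (f : R -> V * X -> Vd) (g : R -> V * X -> Z) (u0 : X -> V)
    (T_gt0 : 0 < T)
    (X_sep : separable X) (Z_sep : separable Z)
    (H_sep : separable H) (V_sep : separable V)
    (VHVd : gelfand_triple iota dual)
    (f_car : caratheodory T f) (g_car : caratheodory T g)
    (f_diff : ae_gateaux T f) (g_diff : ae_gateaux T g)
    (u0_diff : gateaux_differentiable u0)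
    (f_lip : locally_lipschitz T f) (g_lip : locally_lipschitz T g) :
  maps_into (FF T iota dual f g u0) /\
  forall (u : R -> V) (th : X), H1 T u ->
  [/\ is_gateaux (FF T iota dual f g u0) (u, th)
        (dFF T iota dual f g u0 u th),
      [/\ forall z, L2 T z -> exists uz, solves_uz T dual g u th z uz,
          forall w, L2 T w -> exists uw, solves_uw T dual f u th w uw &
          forall h : V, exists uh, solves_uh T h uh] &
      forall (uz : (R -> Z) -> R -> V) (uw : (R -> Vd) -> R -> V)
             (uh : V -> R -> V),
        (forall z, L2 T z -> solves_uz T dual g u th z (uz z)) ->
        (forall w, L2 T w -> solves_uw T dual f u th w (uw w)) ->
        (forall h : V, solves_uh T h (uh h)) ->
        [/\ @is_adjoint R (dom_space T) (cod_space T)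
              (dFF T iota dual f g u0 u th)
              (FF_star T iota dual f g u0 uz uw uh u th),
            [/\ @is_adjoint R (hs_H1 T V) (hs_L2 T Z) (nem_u g u th) uz,
                @is_adjoint R (hs_full X) (hs_L2 T Z)
                  (nem_th g u th) (gth_star T g u th) &
                @is_adjoint R (hs_H1 T V) (hs_full V) (fun v => v 0) uh],
            @is_adjoint R (hs_full X) (hs_full V)
              (du0 u0 th) (u0_star dual u0 th),
            @is_adjoint R (hs_H1 T V) (hs_L2 T Vd)
              (ddt_sub_nem_u T iota dual f u th)
              (ddt_sub_nem_u_star iota dual uw) &
            @is_adjoint R (hs_full X) (hs_L2 T Vd)
              (nem_th f u th) (fth_star T dual f u th)]].
Proof.
have Vd_sep : separable Vd by exact: separable_dual VHVd V_sep.
split; first exact: FF_maps_into.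
move=> u th u_H1; split.
- exact: FF_gateaux.
- split=> [z zL2|w wL2|h].
  + exact: (bvp_exists T_gt0 V_sep 0 (L2N V_sep (rhs_z_L2 T_gt0 Z_sep V_sep VHVd g_car g_diff g_lip th u_H1 zL2))).
  + exact: (bvp_exists T_gt0 V_sep 0 (rhs_w_L2 T_gt0 V_sep VHVd f_car f_diff f_lip th u_H1 wL2)).
  + exact: (bvp_exists T_gt0 V_sep (- h) (L2_0 T V)).
move=> uz uw uh uzP uwP uhP; split.
- exact: FF_star_adjoint.
- split.
  + split; first exact: nem_u_bounded.
      by move=> z zL2; exact: bvp_H1 (uzP z zL2).
    move=> v z vH zL2.
    exact: (nem_u_starP T_gt0 Z_sep V_sep VHVd g_car g_diff g_lip u_H1 zL2 vH (uzP z zL2)).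
  + split; [exact: nem_th_bounded|by []|].
    by move=> xi z _ zL2; exact: nem_th_starP.
  + split; first exact: initial_bounded.
      by move=> h _; exact: bvp_H1 (uhP h).
    by move=> v h vH _; exact: initial_starP.
- split; [exact: du0_bounded|by []|].
  move=> xi h _ _ /=; rewrite -(ip_sym (u0_star _ _ _ _)).
  by rewrite (u0_starP VHVd h (du0_lac u0_diff th)) ip_sym.
- split; first exact: ddt_sub_nem_u_bounded.
    by move=> w wL2; apply: ddt_sub_nem_u_star_H1 => //; exact: uwP.
  by move=> v w vH wL2; apply: ddt_sub_nem_u_starP => //; exact: uwP.
- split; [exact: nem_th_bounded|by []|].
  move=> xi w _ wL2 /=.
  exact (@fth_starP R X H V Vd T iota dual f T_gt0 X_sep V_sep VHVd f_car f_diff f_lip u th u_H1 w xi wL2).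
Qed.
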